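(* Let $X=\mathbb{CP}^1$ and let $(\boldsymbol{\mathfrak g},\boldsymbol K)$ be the contraction family of Harish-Chandra pairs over $X$ for $SL(2)$ defined in the context. The isomorphism class of a generically irreducible quasi-admissible $(\boldsymbol{\mathfrak g},\boldsymbol K)$-module $\mathcal F=\bigoplus_n\mathcal F_n$ for which $\deg(\mathcal F_n)\neq\deg(\mathcal F_{n+2})$ whenever $\mathcal F_n$ and $\mathcal F_{n+2}$ are both nonzero is determined by: (i) the list of weights of $\mathcal F$, (ii) the degrees $\deg(\mathcal F_n)$ (for all weights $n$), and (iii) the action of the Casimir section $C$ (that is, the rational function on $X$ by which $C$ acts on $\mathcal F$). In other words, any two such modules having the same data (i), (ii), (iii) are isomorphic as $(\boldsymbol{\mathfrak g},\boldsymbol K)$-modules.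
   Context: All objects are complex algebraic. $X=\mathbb{CP}^1$ has homogeneous coordinates $[\alpha:\beta]$, and $z=\alpha/\beta$. The family: $\boldsymbol{\mathfrak g}$ is the sheaf of sections of the rank-three subbundle of the trivial bundle over $X$ with fiber $\mathfrak{sl}(2,\mathbb C)\times\mathfrak{sl}(2,\mathbb C)$ whose fiber over $[\alpha:\beta]$ is the Lie subalgebra $$\left\{\left(\begin{bmatrix}a&\alpha b\\ \beta c&-a\end{bmatrix},\begin{bmatrix}a&\beta b\\ \alpha c&-a\end{bmatrix}\right): a,b,c\in\mathbb C\right\}.$$ It is a sheaf of Lie algebras over $O_X$ (pointwise bracket). $\boldsymbol K=K\times X$ is the constant family of groups with fiber $K=\{k_a=(h_a,h_a): a\in\mathbb C^\times\}$, $h_a=\operatorname{diag}(a,a^{-1})$. It acts on $\boldsymbol{\mathfrak g}$ by the adjoint action, and $\operatorname{Lie}(\boldsymbol K)=O_X\otimes\operatorname{Lie}(K)$ is included in $\boldsymbol{\mathfrak g}$ in the obvious way. A $(\boldsymbol{\mathfrak g},\boldsymbol K)$-module (algebraic family of Harish-Chandra modules) is a flat quasicoherent $O_X$-module $\mathcal F$ with an algebraic $O_X$-linear action of $\boldsymbol K$ and an $O_X$-linear Lie algebra action $\boldsymbol{\mathfrak g}\otimes_{O_X}\mathcal F\to\mathcal F$ that is $\boldsymbol K$-equivariant and such that the differential of the $\boldsymbol K$-action equals the restriction of the $\boldsymbol{\mathfrak g}$-action to $\operatorname{Lie}(\boldsymbol K)$. It has a weight decomposition $\mathcal F=\bigoplus_{n\in\mathbb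 Z}\mathcal F_n$, where $k_a$ acts on $\mathcal F_n$ by $a^n$; the weights of $\mathcal F$ are the $n$ with $\mathcal F_n\neq0$. $\mathcal F$ is quasi-admissible if every $\mathcal F_n$ is coherent (hence locally free of finite rank). $\mathcal F$ is generically irreducible if $\Bbbk\otimes_{O_X}\mathcal F$ is an irreducible module over the Lie algebra $\Bbbk\otimes_{O_X}\boldsymbol{\mathfrak g}$, where $\Bbbk$ is the algebraic closure of the field of rational functions on $X$. For the present family this is equivalent, for quasi-admissible $\mathcal F$, to all but at most countably many fibers of $\mathcal F$ being irreducible. For a generically irreducible quasi-admissible $\mathcal F$ each nonzero $\mathcal F_n$ is an invertible sheaf, with degree $\deg(\mathcal F_n)\in\mathbb Z$. Casimir section: define rational sections of $\boldsymbol{\mathfrak g}$ (the letter $X$ below denotes a section, not the base) $$X=\left(\begin{bmatrix}0&z\\ 0&0\end{bmatrix},\begin{bmatrix}0&1\\ 0&0\end{bmatrix}\right),\quad Y=\left(\begin{bmatrix}0&0\\ z^{-1}&0\end{bmatrix},\begin{bmatrix}0&0\\ 1&0\end{bmatrix}\right),\quad H=\left(\begin{bmatrix}1&0\\ 0&-1\end{bmatrix},\begin{bmatrix}1&0\\ 0&-1\end{bmatrix}\right).$$ The Casimir section is the rational section $C=H^2+2XY+2YX=H^2+2H+4YX$ of the center of the sheaf of enveloping algebras $\mathcal U(\boldsymbol{\mathfrak g})$. On a generically irreducible quasi-admissible module it acts by multiplication by a rational function of $z$. *)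

(* Defs.v *)
From HB Require Import structures.
From mathcomp Require Import all_boot all_order all_algebra.
From mathcomp Require Import boolp classical_sets cardinality fsbigop reals.
From mathcomp Require Import complex.

Set Implicit Arguments.
Unset Strict Implicit.
Unset Printing Implicit Defensive.

Import GRing.Theory.
Local Open Scope ring_scope.

Definition Cplx (R : realType) : fieldType := R[i].

Definition ratfun (R : realType) : fieldType := {fraction {poly (Cplx R)}}.

(* [Some a] is the point [a : 1] (where z = a); [None] is [1 : 0]
   (where z = oo). *)
Definition pt (R : realType) : choiceType := option (Cplx R).

Definition alpha (R : realType) (p : pt R) : Cplx R :=
  if p is Some a then a else 1.
Definition beta (R : realType) (p : pt R) : Cplx R :=
  if p is Some _ then 1 else 0.

(* Value at [a : b] of the degree-k homogenization of n. *)
Definition hval (R : realType) (k : nat) (n : {poly (Cplx R)}) (p : pt R) :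
    Cplx R :=
  \sum_(i < k.+1) n`_i * alpha p ^+ i * beta p ^+ (k - i).

(* f is regular at p with value v: near p, f is a quotient of two homogeneous
   forms of the same degree, the denominator of which does not vanish at p. *)
Definition value_at (R : realType) (f : ratfun R) (p : pt R) (v : Cplx R) :
    Prop :=
  exists (k : nat) (n d : {poly (Cplx R)}),
    [/\ (size n <= k.+1)%N, (size d <= k.+1)%N, hval k d p != 0,
        f * FracField.tofrac d = FracField.tofrac n &
        v = hval k n p / hval k d p].

(* Nonempty Zariski open subsets of the projective line are exactly the
   complements of finite sets.  The line is irreducible, so that sheaves may be
   described by their sections over nonempty opens. *)
Record zopen (R : realType) := ZOpen {
  zset :> pt R -> Prop;
  zset_cofinite : finite_set [set p | ~ zset p]%classic }.

Definition zsub (R : realType) (V U : zopen R) : Prop :=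
  forall p : pt R, V p -> U p.

(* A nonempty open subset is affine unless it is the whole line. *)
Definition affine (R : realType) (U : zopen R) : Prop :=
  exists p : pt R, ~ U p.

Definition regular_on (R : realType) (U : zopen R) (f : ratfun R) : Prop :=
  forall p : pt R, U p -> exists v, value_at f p v.

Definition regular_pred (R : realType) (U : zopen R) : {pred (ratfun R)} :=
  fun f => `[< regular_on U f >].

Section Regular.
Variable R : realType.
Implicit Types (p : pt R) (f g : ratfun R) (n d : {poly (Cplx R)}).

Lemma hval_some k n (a : Cplx R) :
  (size n <= k.+1)%N -> hval k n (Some a : pt R) = n.[a].
Proof.
move=> sn; rewrite (horner_coef_wide _ sn); apply: eq_bigr => i _ /=.
by rewrite expr1n mulr1.
Qed.

Lemma hval_none k n : hval k n (None : pt R) = n`_k.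
Proof.
rewrite /hval big_ord_recr /= big1 => [|i _].
  by rewrite add0r expr1n subnn expr0 !mulr1.
by rewrite expr0n subn_eq0 leqNgt (ltn_ord i) mulr0.
Qed.

Lemma size_mul_hom k l n d : (size n <= k.+1)%N -> (size d <= l.+1)%N ->
  (size (n * d)%R <= (k + l).+1)%N.
Proof.
move=> sn sd; apply: leq_trans (size_polyMleq _ _) _.
by rewrite -ltnS; case: (size n + size d)%N (leq_add sn sd) => // m;
   rewrite addSn addnS /= ltnS.
Qed.

Lemma hvalM k l n d p : (size n <= k.+1)%N -> (size d <= l.+1)%N ->
  hval (k + l) (n * d) p = hval k n p * hval l d p.
Proof.
move=> sn sd; case: p => [a|].
  by rewrite !hval_some ?hornerM ?size_mul_hom.
rewrite !hval_none coefM (bigD1 (inord k)) //= inordK ?ltnS ?leq_addr //.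
rewrite addKn big1 ?addr0 // => i ik.
have {}ik : (i : nat) != k.
  apply: contra ik => /eqP ik; apply/eqP/val_inj => /=.
  by rewrite inordK ?ltnS ?leq_addr.
case: (ltngtP i k) ik => // ik _.
  rewrite [d`__]nth_default ?mulr0 //; apply: leq_trans sd _.
  by rewrite ltn_subRL ltn_add2r.
by rewrite nth_default ?mul0r //; apply: leq_trans sn ik.
Qed.

Lemma hvalB k n d p : hval k (n - d) p = hval k n p - hval k d p.
Proof.
by rewrite /hval -sumrB; apply: eq_bigr => i _; rewrite coefB !mulrBl.
Qed.

Lemma value_atB f g p v w :
  value_at f p v -> value_at g p w -> value_at (f - g) p (v - w).
Proof.
move=> [k [n [d [sn sd d0 fE ->]]]] [l [m [e [sm se e0 gE ->]]]].
exists (k + l)%N, (n * e - d * m), (d * e).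
have s1 := size_mul_hom sn se; have s2 := size_mul_hom sd sm.
split; rewrite ?size_mul_hom ?hvalB ?hvalM //.
- rewrite (leq_trans (size_polyD _ _)) // geq_max size_polyN.
  by rewrite s1.
- by rewrite mulf_neq0.
- by rewrite tofracB !tofracM -fE -gE mulrBl mulrA mulrCA.
- by rewrite -mulNr addf_div // mulNr [hval l m p * _]mulrC.
Qed.

Lemma value_atM f g p v w :
  value_at f p v -> value_at g p w -> value_at (f * g) p (v * w).
Proof.
move=> [k [n [d [sn sd d0 fE ->]]]] [l [m [e [sm se e0 gE ->]]]].
exists (k + l)%N, (n * m), (d * e).
split; rewrite ?size_mul_hom ?hvalM ?mulf_neq0 //.
- by rewrite !tofracM -fE -gE mulrACA.
- by rewrite mulf_div.
Qed.

Lemma value_at_const (c : Cplx R) p :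
  value_at (FracField.tofrac c%:P : ratfun R) p c.
Proof.
exists 0%N, c%:P, 1%:P; rewrite /hval !big_ord1 /= !coefC /= !mulr1.
split; rewrite ?size_polyC ?leq_b1 ?oner_neq0 ?divr1 //.
Qed.

Fact regular_subring (U : zopen R) : subring_closed (regular_pred U).
Proof.
split=> [|f g /asboolP fU /asboolP gU|f g /asboolP fU /asboolP gU].
- apply/asboolP => p _; exists 1.
  by have := value_at_const 1 p; rewrite tofrac1.
- apply/asboolP => p Up; have [v fv] := fU p Up; have [w gw] := gU p Up.
  by exists (v - w); apply: value_atB.
- apply/asboolP => p Up; have [v fv] := fU p Up; have [w gw] := gU p Up.
  by exists (v * w); apply: value_atM.
Qed.

End Regular.

HB.instance Definition _ (R : realType) (U : zopen R) :=
  GRing.isSubringClosed.Build (ratfun R) (regular_pred U) (regular_subring U).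

(* O_X(U), as a subring of the field of rational functions. *)
Record regfun (R : realType) (U : zopen R) := RegFun {
  rfval :> ratfun R;
  rfvalP : rfval \in regular_pred U }.

HB.instance Definition _ (R : realType) (U : zopen R) :=
  [isSub for @rfval R U].
HB.instance Definition _ (R : realType) (U : zopen R) :=
  [Choice of regfun U by <:].
HB.instance Definition _ (R : realType) (U : zopen R) :=
  [SubChoice_isSubComNzRing of regfun U by <:].

Fact cst_subproof (R : realType) (U : zopen R) (c : Cplx R) :
  (FracField.tofrac c%:P : ratfun R) \in regular_pred U.
Proof. by apply/asboolP => p _; exists c; exact: value_at_const. Qed.

Definition cst (R : realType) (U : zopen R) (c : Cplx R) : regfun U :=
  RegFun (cst_subproof U c).

Fact rres_subproof (R : realType) (U V : zopen R) (h : zsub V U)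
  (f : regfun U) : rfval f \in regular_pred V.
Proof.
by case: f => f /= /asboolP fU; apply/asboolP => p /h; exact: fU.
Qed.

Definition rres (R : realType) (U V : zopen R) (h : zsub V U) (f : regfun U) :
  regfun V := RegFun (rres_subproof h f).

Record Omodule (R : realType) := OModule {
  om_sec :> forall U : zopen R, lmodType (regfun U);
  om_res : forall U V : zopen R, zsub V U -> om_sec U -> om_sec V;
  om_resD : forall U V (h : zsub V U) m n,
    om_res h (m + n) = om_res h m + om_res h n;
  om_resZ : forall U V (h : zsub V U) (f : regfun U) m,
    om_res h (f *: m) = rres h f *: om_res h m;
  om_res_id : forall U (h : zsub U U) m, om_res h m = m;
  om_res_comp : forall U V W (h1 : zsub V U) (h2 : zsub W V) (h3 : zsub W U) m,
    om_res h2 (om_res h1 m) = om_res h3 m;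
  om_local : forall (I : Type) (W : I -> zopen R) U (h : forall i, zsub (W i) U),
    (forall p, U p -> exists i, W i p) ->
    forall m : om_sec U, (forall i, om_res (h i) m = 0) -> m = 0;
  om_glue : forall (I : Type) (W : I -> zopen R) U (h : forall i, zsub (W i) U),
    (forall p, U p -> exists i, W i p) ->
    forall s : (forall i, om_sec (W i)),
    (forall i j V (hi : zsub V (W i)) (hj : zsub V (W j)),
       om_res hi (s i) = om_res hj (s j)) ->
    exists m : om_sec U, forall i, om_res (h i) m = s i }.

(* For U affine and f in O_X(U), restriction to the distinguished open subset
   V = D(f) is the localization F(U) -> F(U)_f.  (That f acts invertibly on
   F(V) is automatic, f being a unit of O_X(V).) *)
Definition quasicoherent (R : realType) (F : Omodule R) : Prop :=
  forall (U V : zopen R) (h : zsub V U) (f : regfun U), affine U ->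
    (forall p, V p <-> U p /\ ~ value_at (rfval f) p 0) ->
    (forall y : F V, exists (k : nat) (m : F U),
       rres h f ^+ k *: y = om_res h m) /\
    (forall m : F U, om_res h m = 0 -> exists k : nat, f ^+ k *: m = 0).

(* Flatness through tensor products given by their universal property: if
   N -> N' is injective, so is the induced map from M (x) N to M (x) N'. *)
Definition bilinear_map (A : comNzRingType) (M N T : lmodType A)
    (b : M -> N -> T) : Prop :=
  (forall (a : A) m m' n, b (a *: m + m') n = a *: b m n + b m' n) /\
  (forall (a : A) m n n', b m (a *: n + n') = a *: b m n + b m n').

Definition is_tensor (A : comNzRingType) (M N T : lmodType A)
    (b : M -> N -> T) : Prop :=
  bilinear_map b /\
  forall (Q : lmodType A) (c : M -> N -> Q), bilinear_map c ->
    exists f : {linear T -> Q}, (forall m n, f (b m n) = c m n) /\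
      forall g : {linear T -> Q}, (forall m n, g (b m n) = c m n) -> g =1 f.

Definition flat_module (A : comNzRingType) (M : lmodType A) : Prop :=
  forall (N N' : lmodType A) (i : {linear N -> N'}), injective i ->
  forall (T T' : lmodType A) (b : M -> N -> T) (b' : M -> N' -> T'),
    is_tensor b -> is_tensor b' ->
  forall j : {linear T -> T'}, (forall m n, j (b m n) = b' m (i n)) ->
    injective j.

Definition flat (R : realType) (F : Omodule R) : Prop :=
  forall U : zopen R, affine U -> flat_module (F U).

(* 2x2 matrices with rows (a, b) and (c, d), and pairs of them. *)
Definition mat2 (S : Type) (a b c d : S) : 'M[S]_2 :=
  \matrix_(i < 2, j < 2)
    if i == ord0 then (if j == ord0 then a else b)
    else (if j == ord0 then c else d).

Definition mpair (S : nzRingType) : lmodType S := ('M[S]_2 * 'M[S]_2)%type.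

Definition bracket (S : nzRingType) (A B : mpair S) : mpair S :=
  (A.1 *m B.1 - B.1 *m A.1, A.2 *m B.2 - B.2 *m A.2).

Definition gfiber (R : realType) (p : pt R) (B : mpair (Cplx R)) : Prop :=
  exists a b c : Cplx R,
    B = (mat2 a (alpha p * b) (beta p * c) (- a),
         mat2 a (beta p * b) (alpha p * c) (- a)).

(* A is (the generic expression of) a section of the family over U. *)
Definition gsection (R : realType) (U : zopen R) (A : mpair (ratfun R)) :
    Prop :=
  forall p, U p -> exists B : mpair (Cplx R),
    [/\ gfiber p B,
        forall i j, value_at (A.1 i j) p (B.1 i j) &
        forall i j, value_at (A.2 i j) p (B.2 i j)].

Definition zvar (R : realType) : ratfun R := FracField.tofrac 'X.

Definition Xsec (R : realType) : mpair (ratfun R) :=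
  (mat2 0 (zvar R) 0 0, mat2 0 1 0 0).
Definition Ysec (R : realType) : mpair (ratfun R) :=
  (mat2 0 0 (zvar R)^-1 0, mat2 0 0 1 0).
Definition Hsec (R : realType) : mpair (ratfun R) :=
  (mat2 1 0 0 (-1), mat2 1 0 0 (-1)).

(* h_a = diag(a, a^-1), and the adjoint action of k_a = (h_a, h_a). *)
Definition hdiag (R : realType) (a : Cplx R) : 'M[ratfun R]_2 :=
  mat2 (FracField.tofrac a%:P) 0 0 (FracField.tofrac (a^-1)%:P).

Definition Ad (R : realType) (a : Cplx R) (A : mpair (ratfun R)) :
    mpair (ratfun R) :=
  (hdiag a *m A.1 *m hdiag a^-1, hdiag a *m A.2 *m hdiag a^-1).

(* [orbit_expansion act m s c]: the orbit map a |-> k_a m is the Laurent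
   polynomial \sum_(n <- s) a ^ n *: c n, with coefficients in F(U). *)
Definition orbit_expansion (R : realType) (U : zopen R)
    (M : lmodType (regfun U)) (act : Cplx R -> M -> M) (m : M)
    (s : seq int) (c : int -> M) : Prop :=
  forall a : Cplx R, a != 0 -> act a m = \sum_(n <- s) cst U (a ^ n) *: c n.

(* [gk_act U A] is only meaningful for A a section of the Lie algebra family
   over U, and [gk_kact U a] (the action of k_a) only for a != 0; all other
   values are unconstrained and never used. *)
Record gKmodule (R : realType) := GKModule {
  gk_sheaf :> Omodule R;
  gk_quasicoherent : quasicoherent gk_sheaf;
  gk_flat : flat gk_sheaf;
  gk_act : forall U, mpair (ratfun R) -> gk_sheaf U -> gk_sheaf U;
  gk_kact : forall U, Cplx R -> gk_sheaf U -> gk_sheaf U;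
  gk_act_linear_l : forall U A B (f : regfun U) (m : gk_sheaf U),
    gsection U A -> gsection U B ->
    gk_act (rfval f *: A + B) m = f *: gk_act A m + gk_act B m;
  gk_act_linear_r : forall U A (f : regfun U) (m n : gk_sheaf U),
    gsection U A -> gk_act A (f *: m + n) = f *: gk_act A m + gk_act A n;
  gk_act_res : forall U V (h : zsub V U) A (m : gk_sheaf U),
    gsection U A -> om_res h (gk_act A m) = gk_act A (om_res h m);
  gk_act_bracket : forall U A B (m : gk_sheaf U),
    gsection U A -> gsection U B ->
    gk_act (bracket A B) m = gk_act A (gk_act B m) - gk_act B (gk_act A m);
  gk_kact_linear : forall U a (f : regfun U) (m n : gk_sheaf U), a != 0 ->
    gk_kact a (f *: m + n) = f *: gk_kact a m + gk_kact a n;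
  gk_kact_res : forall U V (h : zsub V U) a (m : gk_sheaf U), a != 0 ->
    om_res h (gk_kact a m) = gk_kact a (om_res h m);
  gk_kact1 : forall U (m : gk_sheaf U), gk_kact 1 m = m;
  gk_kactM : forall U a b (m : gk_sheaf U), a != 0 -> b != 0 ->
    gk_kact (a * b) m = gk_kact a (gk_kact b m);
  gk_kact_algebraic : forall U (m : gk_sheaf U), exists s c,
    orbit_expansion (@gk_kact U) m s c;
  gk_equivariant : forall U a A (m : gk_sheaf U), a != 0 -> gsection U A ->
    gk_kact a (gk_act A m) = gk_act (Ad a A) (gk_kact a m);
  (* H spans Lie(K): it is the derivative of k_a at a = 1 *)
  gk_differential : forall U (m : gk_sheaf U) s c,
    orbit_expansion (@gk_kact U) m s c ->
    gk_act (Hsec R) m = \sum_(n <- s) c n *~ n }.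

Definition weight_vector (R : realType) (F : gKmodule R) (n : int)
    (U : zopen R) (m : F U) : Prop :=
  forall a : Cplx R, a != 0 -> gk_kact a m = cst U (a ^ n) *: m.

Definition is_weight (R : realType) (F : gKmodule R) (n : int) : Prop :=
  exists (U : zopen R) (m : F U), weight_vector n m /\ m <> 0.

(* Each F_n is coherent: its sections over an affine U form a finitely
   generated O_X(U)-module. *)
Definition quasi_admissible (R : realType) (F : gKmodule R) : Prop :=
  forall (n : int) (U : zopen R), affine U ->
  exists (r : nat) (e : 'I_r -> F U),
    (forall i, weight_vector n (e i)) /\
    forall m : F U, weight_vector n m ->
      exists c : 'I_r -> regfun U, m = \sum_i c i *: e i.

Definition algebraic_closure (E : fieldType) (k : closedFieldType)
    (emb : {rmorphism E -> k}) : Prop :=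
  forall x : k, exists2 p : {poly E}, p != 0 & root (map_poly emb p) x.

Section Generic.
Variables (R : realType) (k : closedFieldType).
Variable emb : {rmorphism ratfun R -> k}.

Definition semilinear_family (F : Omodule R) (V : lmodType k)
    (j : forall U : zopen R, F U -> V) : Prop :=
  [/\ forall U (m n : F U), j U (m + n) = j U m + j U n,
      forall U (f : regfun U) (m : F U), j U (f *: m) = emb (rfval f) *: j U m &
      forall U W (h : zsub W U) (m : F U), j W (om_res h m) = j U m].

(* V is the tensor product of k and F over O_X, with iota_U(m) = 1 (x) m. *)
Definition generic_base_change (F : Omodule R) (V : lmodType k)
    (iota : forall U : zopen R, F U -> V) : Prop :=
  semilinear_family iota /\
  forall (W : lmodType k) (j : forall U : zopen R, F U -> W),
    semilinear_family j ->
    exists f : {linear V -> W}, (forall U (m : F U), f (iota U m) = j U m) /\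
      forall g : {linear V -> W},
        (forall U (m : F U), g (iota U m) = j U m) -> g =1 f.

Definition emb_pair (A : mpair (ratfun R)) : mpair k :=
  (map_mx emb A.1, map_mx emb A.2).

(* The tensor product of k and the Lie algebra family, realized as the k-span
   of the sections of the family inside the pairs of matrices over k. *)
Definition generic_lie (B : mpair k) : Prop :=
  exists (U : zopen R) (r : nat) (c : 'I_r -> k)
         (A : 'I_r -> mpair (ratfun R)),
    (forall i, gsection U (A i)) /\ B = \sum_i c i *: emb_pair (A i).

(* rho is the action of generic_lie on V obtained by extension of scalars. *)
Definition generic_action (F : gKmodule R) (V : lmodType k)
    (iota : forall U : zopen R, F U -> V) (rho : mpair k -> V -> V) : Prop :=
  [/\ forall (x : k) A B v, generic_lie A -> generic_lie B ->
        rho (x *: A + B) v = x *: rho A v + rho B v,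
      forall (x : k) A v w, generic_lie A ->
        rho A (x *: v + w) = x *: rho A v + rho A w &
      forall U A (m : F U), gsection U A ->
        rho (emb_pair A) (iota U m) = iota U (gk_act A m)].

Definition irreducible_rep (V : lmodType k) (rho : mpair k -> V -> V) : Prop :=
  (exists v : V, v != 0) /\
  forall W : V -> Prop, W 0 ->
    (forall (x : k) v w, W v -> W w -> W (x *: v + w)) ->
    (forall A v, generic_lie A -> W v -> W (rho A v)) ->
    (forall v, W v -> v = 0) \/ (forall v, W v).

Definition generically_irreducible (F : gKmodule R) : Prop :=
  exists (V : lmodType k) (iota : forall U : zopen R, F U -> V)
         (rho : mpair k -> V -> V),
    [/\ generic_base_change iota, generic_action iota rho &
        irreducible_rep rho].

End Generic.

Definition uniformizer (R : realType) (p : pt R) : ratfun R :=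
  if p is Some a then FracField.tofrac ('X - a%:P) else (zvar R)^-1.

Definition ord_at (R : realType) (f : ratfun R) (p : pt R) (o : int) : Prop :=
  exists (u : ratfun R) (v : Cplx R),
    [/\ value_at u p v, v != 0 & f = uniformizer p ^ o * u].

(* f |-> f e is an isomorphism from O_U onto the restriction of F_n to U. *)
Definition local_generator (R : realType) (F : gKmodule R) (n : int)
    (U : zopen R) (e : F U) : Prop :=
  weight_vector n e /\
  forall V (h : zsub V U) (m : F V), weight_vector n m ->
    exists! f : regfun V, m = f *: om_res h e.

(* Order at p of the rational section s of F_n; p need not belong to V. *)
Definition section_ord (R : realType) (F : gKmodule R) (n : int)
    (V : zopen R) (s : F V) (p : pt R) (o : int) : Prop :=
  exists (U : zopen R) (e : F U) (W : zopen R) (hU : zsub W U) (hV : zsub W V)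
         (f : regfun W),
    [/\ U p, local_generator n e, om_res hV s = f *: om_res hU e &
        ord_at (rfval f) p o].

(* d is the degree of the divisor of a nonzero rational section of F_n. *)
Definition is_degree (R : realType) (F : gKmodule R) (n d : int) : Prop :=
  exists (V : zopen R) (s : F V) (o : pt R -> int),
    [/\ weight_vector n s, s <> 0, forall p, section_ord n s p (o p),
        finite_set [set p | o p != 0]%classic &
        d = \sum_(p \in [set: pt R]%classic) o p].

Definition deg (R : realType) (F : gKmodule R) (n : int) : int :=
  xget 0 [set d | is_degree F n d]%classic.

Definition consecutive_degrees_distinct (R : realType) (F : gKmodule R) :
    Prop :=
  forall n : int, is_weight F n -> is_weight F (n + 2) ->
    deg F n <> deg F (n + 2).

(* C = H^2 + 2XY + 2YX acts on F as multiplication by the rational function c,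
   over every open set on which X, Y and c are regular. *)
Definition casimir_acts_by (R : realType) (F : gKmodule R) (c : ratfun R) :
    Prop :=
  forall (U : zopen R) (f : regfun U), rfval f = c ->
    gsection U (Xsec R) -> gsection U (Ysec R) ->
  forall m : F U,
    gk_act (Hsec R) (gk_act (Hsec R) m)
    + gk_act (Xsec R) (gk_act (Ysec R) m) *+ 2
    + gk_act (Ysec R) (gk_act (Xsec R) m) *+ 2 = f *: m.

Definition isomorphic (R : realType) (F G : gKmodule R) : Prop :=
  exists phi : forall U : zopen R, {linear F U -> G U},
    [/\ forall U, bijective (phi U),
        forall U V (h : zsub V U) (m : F U),
          phi V (om_res h m) = om_res h (phi U m),
        forall U A (m : F U), gsection U A ->
          phi U (gk_act A m) = gk_act A (phi U m) &
        forall U a (m : F U), a != 0 ->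
          phi U (gk_kact a m) = gk_kact a (phi U m)].

(* Main.v *)
Require Import Defs.
From HB Require Import structures.
From mathcomp Require Import all_boot all_order all_algebra.
From mathcomp Require Import boolp classical_sets cardinality fsbigop reals.
From mathcomp Require Import complex generic_quotient zify.

(* All sections of F embed in its generic stalk, a vector space over the field
   of rational functions on which X, Y, H and K act.  Since the Casimir acts by
   a scalar, XY and YX are scalars on each weight space, so the span of the
   X^i e and Y^i e is a submodule for every weight vector e; generic
   irreducibility then makes each weight space a line and X, Y nonzero between
   adjacent weights.  Thus F_n is O(d_n), and X and Y define nonzero maps
   F_n -> F_(n+2)(1) and F_(n+2) -> F_n(1), whence |d_(n+2) - d_n| <= 1.  As the
   degrees differ, one of the two maps is an isomorphism, and the other one is
   then given by the Casimir.  Rescaling generators so that these isomorphisms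
   become the identity puts F in a normal form which only depends on the
   weights, the degrees and the Casimir. *)

Set Implicit Arguments.
Unset Strict Implicit.
Unset Printing Implicit Defensive.

Import Order.TTheory GRing.Theory Num.Theory.
Local Open Scope ring_scope.
Local Open Scope quotient_scope.

Local Notation "x %:F" := (FracField.tofrac x).

(** * The function field of the projective line *)

(** The twist by one has its origin in the family: its upper part is generated by X on the affine
    line and by z^-1 X away from 0, its lower part by zY and Y on the same charts, so each is a copy
    of O(-1). Between F_n = O(d) and F_(n+2) = O(d'), the operators thus amount to global sections
    of O(d' - d + 1) and O(d - d' + 1). These two degrees are nonnegative with sum 2; if d and d'
    differ, one of them is 0 and its section is a constant. Such constants can be absorbed into the
    generators because the links from n to n + 2 form no cycle. The main obstacle is that
    irreducibility is assumed for a tensor product with [k] which is known only by its universal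
    property: this gives maps out of it, and no immediate injectivity of the stalk into it.
    Submodules are therefore cut out as common kernels of extended functionals, and vectors are
    shown to be nonzero by functionals. Quasi-admissibility makes the weight spaces
    finite-dimensional, which supplies enough functionals. *)

Definition regular_at (R : realType) (f : ratfun R) (p : pt R) : Prop :=
  exists v, value_at f p v.

Definition unit_at (R : realType) (f : ratfun R) (p : pt R) : Prop :=
  exists2 v, v != 0 & value_at f p v.

Section FunctionField.
Variable R : realType.
Implicit Types (p : pt R) (f g : ratfun R) (n d : {poly (Cplx R)}) (a : Cplx R).

Lemma fraction_repr (A : idomainType) (x : {fraction A}) :
  exists n d : A, d != 0 /\ x = n%:F / d%:F.
Proof.
exists (\n_(repr x)), (\d_(repr x)); split; first exact: denom_ratioP.
apply: (canRL (mulfK _)); first by rewrite tofrac_eq0 denom_ratioP.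
rewrite -{1}(reprK x); case: (repr x) => [[n d] /= d0].
unlock FracField.tofrac; rewrite -[LHS]FracField.pi_mul.
apply/eqmodP; rewrite /= /FracField.equivf.
by rewrite /FracField.mulf !numden_Ratio ?mulr1 ?oner_neq0 ?mulf_neq0 ?oner_neq0 //= mulrC.
Qed.

Lemma Cplx_root (n : {poly (Cplx R)}) : size n != 1 -> exists a, root n a.
Proof. by move/closed_rootP. Qed.

Lemma Cplx_normal (n : {poly (Cplx R)}) :
  exists s : seq (Cplx R), n = lead_coef n *: \prod_(a <- s) ('X - a%:P).
Proof. by have [s Es] := @closed_field_poly_normal R[i] n; exists s. Qed.

Lemma hval_neq0 k d p : hval k d p != 0 -> d != 0.
Proof.
apply: contraNneq => ->; rewrite /hval big1 // => i _; by rewrite coef0 !mul0r.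
Qed.

Lemma value_at_uniq f p v w : value_at f p v -> value_at f p w -> v = w.
Proof.
move=> [k [n [d [sn sd d0 fE ->]]]] [l [m [e [sm se e0 gE ->]]]].
have E : n * e = d * m.
  apply/eqP; rewrite -tofrac_eq !tofracM -fE -gE; apply/eqP.
  by rewrite -!mulrA mulrCA.
apply/eqP; rewrite eqr_div //; rewrite -hvalM // E hvalM // mulrC.
by rewrite eqxx.
Qed.

Lemma value_atV f p v : v != 0 -> value_at f p v -> value_at f^-1 p v^-1.
Proof.
move=> v0 [k [n [d [sn sd d0 fE vE]]]].
have n0 : hval k n p != 0 by apply: contra_neq v0 => n0; rewrite vE n0 mul0r.
exists k, d, n; split=> //; last by rewrite vE invf_div.
rewrite -fE mulrA mulVf ?mul1r //.
apply: contra_neq (hval_neq0 n0) => f0; apply/eqP; rewrite -tofrac_eq0 -fE f0.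
by rewrite mul0r.
Qed.

Lemma value_atD f g p v w :
  value_at f p v -> value_at g p w -> value_at (f + g) p (v + w).
Proof.
move=> fv gw; rewrite -[g]opprK -[w]opprK; apply: value_atB => //.
rewrite -[- g]add0r -[- w]add0r; apply: value_atB => //.
by have := value_at_const 0 p; rewrite polyC0 tofrac0.
Qed.

Lemma value_at_poly n a : value_at (n%:F : ratfun R) (Some a) n.[a].
Proof.
exists (size n), n, 1; rewrite !hval_some ?size_poly1 ?leqnSn //.
by rewrite hornerC oner_neq0 tofrac1 mulr1 divr1; split.
Qed.

Lemma unit_at1 p : unit_at (1 : ratfun R) p.
Proof. by exists 1; rewrite ?oner_neq0 //; have := value_at_const 1 p; rewrite tofrac1. Qed.

Lemma unit_atM f g p : unit_at f p -> unit_at g p -> unit_at (f * g) p.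
Proof.
move=> [v v0 fv] [w w0 gw]; exists (v * w); rewrite ?mulf_neq0 //.
exact: value_atM.
Qed.

Lemma unit_atV f p : unit_at f p -> unit_at f^-1 p.
Proof. by move=> [v v0 fv]; exists v^-1; rewrite ?invr_eq0 //; apply: value_atV. Qed.

Lemma unit_regular f p : unit_at f p -> regular_at f p.
Proof. by case=> v _; exists v. Qed.

Lemma unit_at_const a p : a != 0 -> unit_at (a%:P%:F : ratfun R) p.
Proof. by exists a => //; apply: value_at_const. Qed.

Lemma regular_at_const a p : regular_at (a%:P%:F : ratfun R) p.
Proof. by exists a; apply: value_at_const. Qed.

Lemma regular_at0 p : regular_at (0 : ratfun R) p.
Proof. by have := regular_at_const 0 p; rewrite polyC0 tofrac0. Qed.

Lemma regular_at1 p : regular_at (1 : ratfun R) p.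
Proof. exact/unit_regular/unit_at1. Qed.

Lemma regular_atD f g p :
  regular_at f p -> regular_at g p -> regular_at (f + g) p.
Proof. by move=> [v fv] [w gw]; exists (v + w); apply: value_atD. Qed.

Lemma regular_atM f g p :
  regular_at f p -> regular_at g p -> regular_at (f * g) p.
Proof. by move=> [v fv] [w gw]; exists (v * w); apply: value_atM. Qed.

Lemma regular_at_sum (I : Type) (s : seq I) (P : pred I) (h : I -> ratfun R) p :
  (forall i, P i -> regular_at (h i) p) ->
  regular_at (\sum_(i <- s | P i) h i) p.
Proof.
move=> hP; elim/big_rec: _ => [|i x Pi]; first exact: regular_at0.
by apply: regular_atD; apply: hP.
Qed.

Lemma regular_at_poly n a : regular_at (n%:F : ratfun R) (Some a).
Proof. by exists n.[a]; apply: value_at_poly. Qed.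

Lemma unit_at_neq0 f p : unit_at f p -> f != 0.
Proof.
case=> v v0 fv; apply: contra_neq v0 => f0; apply: (value_at_uniq fv).
by rewrite f0; have := value_at_const 0 p; rewrite polyC0 tofrac0.
Qed.

Lemma unit_at_poly n a : ~~ root n a -> unit_at (n%:F : ratfun R) (Some a).
Proof. by move=> r; exists n.[a] => //; apply: value_at_poly. Qed.

Lemma uniformizer_neq0 p : uniformizer p != 0.
Proof.
case: p => [a|]; rewrite /uniformizer ?invr_eq0 tofrac_eq0 ?polyX_eq0 //.
by rewrite polyXsubC_eq0.
Qed.

Lemma zvar_neq0 : zvar R != 0.
Proof. by rewrite tofrac_eq0 polyX_eq0. Qed.

Lemma value_at_uniformizer p : value_at (uniformizer p) p 0.
Proof.
case: p => [a|].
  have := value_at_poly ('X - a%:P) a; by rewrite hornerXsubC subrr.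
exists 1%N, 1, 'X; rewrite !hval_none size_poly1 size_polyX coefX coef1 /=.
by rewrite oner_neq0 mul0r mulVf ?zvar_neq0 ?tofrac1.
Qed.

Lemma unit_at_exp f p (i : int) : unit_at f p -> unit_at (f ^ i) p.
Proof.
have N m : unit_at f p -> unit_at (f ^+ m) p.
  move=> fp; elim: m => [|m IH]; rewrite ?expr0 ?exprS; first exact: unit_at1.
  exact: unit_atM.
by case: i => m fp; [exact: N | apply/unit_atV/N].
Qed.

Lemma ord_atP f p o : ord_at f p o <-> unit_at (f * uniformizer p ^ (- o)) p.
Proof.
have u0 := uniformizer_neq0 p.
split=> [[u [v [uv v0 ->]]]|[v v0 uv]].
  by exists v => //; rewrite mulrAC -expfzDr // subrr expr0z mul1r.
exists (f * uniformizer p ^ (- o)), v; split=> //.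
by rewrite mulrCA -expfzDr // subrr expr0z mulr1.
Qed.

Lemma uniformizer_exp_regular p (i : int) :
  0 <= i -> regular_at (uniformizer p ^ i) p.
Proof.
case: i => // m _; elim: m => [|m IH]; first by rewrite expr0z; apply: regular_at1.
rewrite -exprnP exprS; apply: regular_atM => //.
by exists 0; apply: value_at_uniformizer.
Qed.

(** If a negative power were regular, multiplying it by the opposite positive power, which vanishes
    at [p], would give the constant 1 the value 0. *)
Lemma uniformizer_exp_nregular p (i : int) :
  regular_at (uniformizer p ^ i) p -> 0 <= i.
Proof.
case: i => // m [v pv]; exfalso.
have u0 := uniformizer_neq0 p.
have [w pw] : regular_at (uniformizer p ^+ m) p.
  exact: (@uniformizer_exp_regular p m).
have := value_atM (value_atM (value_at_uniformizer p) pw) pv.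
rewrite -exprS NegzE -exprnN mulfV ?expf_neq0 // !mul0r => /value_at_uniq.
have := value_at_const 1 p; rewrite tofrac1 => p1 /(_ _ p1) /eqP.
by rewrite eq_sym oner_eq0.
Qed.

Lemma ord_at_regular f p o : ord_at f p o -> regular_at f p <-> 0 <= o.
Proof.
move=> fo; have [v [w [uw w0 fE]]] := fo; split=> [fr|o0]; last first.
  by rewrite fE; apply: regular_atM; [exact: uniformizer_exp_regular|exists w].
apply: (@uniformizer_exp_nregular p).
have vu : unit_at v p by exists w.
have := regular_atM fr (unit_regular (unit_atV vu)).
by rewrite fE mulfK // (unit_at_neq0 vu).
Qed.

Lemma ord_at_unit f p : ord_at f p 0 <-> unit_at f p.
Proof. by rewrite ord_atP oppr0 expr0z mulr1. Qed.

Lemma ord_atM f g p o o' :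
  ord_at f p o -> ord_at g p o' -> ord_at (f * g) p (o + o').
Proof.
move=> /ord_atP fo /ord_atP go; apply/ord_atP.
by rewrite opprD expfzDr ?uniformizer_neq0 // mulrACA; apply: unit_atM.
Qed.

Lemma ord_atV f p o : ord_at f p o -> ord_at f^-1 p (- o).
Proof.
by move=> /ord_atP /unit_atV fo; apply/ord_atP; rewrite -invr_expz -invfM.
Qed.

Lemma ord_at_uniq f p o o' : ord_at f p o -> ord_at f p o' -> o = o'.
Proof.
have le i j : ord_at f p i -> ord_at f p j -> i <= j.
  move=> fi fj; rewrite -subr_ge0.
  have /ord_at_regular <- := ord_atM fj (ord_atV fi).
  have /ord_atP/unit_at_neq0 := fi; rewrite mulf_eq0 negb_or => /andP[f0 _].
  by rewrite mulfV //; apply: regular_at1.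
by move=> fo fo'; apply: le_anti; rewrite !le.
Qed.

Lemma unit_at_infty n d : n != 0 -> d != 0 -> size n = size d ->
  unit_at (n%:F / d%:F : ratfun R) None.
Proof.
move=> n0 d0 snd; exists (lead_coef n / lead_coef d).
  by rewrite mulf_neq0 ?invr_eq0 ?lead_coef_eq0.
exists (size d).-1, n, d; rewrite !hval_none snd !prednK ?size_poly_gt0 //.
rewrite /lead_coef snd; split=> //; first by rewrite lead_coef_eq0.
by rewrite mulfVK ?tofrac_eq0.
Qed.

(** Degree zero is part of the predicate, so that it can be propagated through products and
    inverses; it is what makes the degree of a line bundle independent of the rational section. *)
Definition principal_divisor f := exists o : pt R -> int,
  [/\ forall p, ord_at f p (o p), finite_set [set p | o p != 0]%classic &
      \sum_(p \in [set: pt R]%classic) o p = 0].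

Lemma fsum_split (o o' : pt R -> int) :
  finite_set [set p | o p != 0]%classic ->
  finite_set [set p | o' p != 0]%classic ->
  finite_set [set p | o p + o' p != 0]%classic /\
  \sum_(p \in [set: pt R]%classic) (o p + o' p) =
  \sum_(p \in [set: pt R]%classic) o p + \sum_(p \in [set: pt R]%classic) o' p.
Proof.
move=> fo fo'; pose A := ([set p | o p != 0] `|` [set p | o' p != 0])%classic.
have fA : finite_set A by rewrite finite_setU.
have AE p : ~ A p -> o p = 0 /\ o' p = 0.
  by move=> nA; split; apply: contra_notP nA => /eqP; [left|right].
split.
  apply: sub_finite_set fA => p /= s0; apply: contrapT => /AE[E1 E2].
  by rewrite E1 E2 addr0 eqxx in s0.
have W (h : pt R -> int) : (forall p, ~ A p -> h p = 0) ->
    \sum_(p \in [set: pt R]%classic) h p = \sum_(p \in A) h p.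
  by move=> hA; apply/esym/fsbig_widen => // p [_ /hA].
rewrite (W o) => [|p /AE[]//]; rewrite (W o') => [|p /AE[]//].
rewrite (W (fun p => o p + o' p)) => [|p /AE[-> ->]]; last by rewrite addr0.
exact: fsbig_split.
Qed.

Lemma principal_divisorM f g : principal_divisor f -> principal_divisor g -> principal_divisor (f * g).
Proof.
move=> [o [fo o1 o2]] [o' [go o1' o2']]; exists (fun p => o p + o' p).
have [h1 h2] := fsum_split o1 o1'.
by split=> // [p|]; [exact: ord_atM | rewrite h2 o2 o2'].
Qed.

Lemma principal_divisorV f : principal_divisor f -> principal_divisor f^-1.
Proof.
move=> [o [fo o1 o2]]; exists (fun p => - o p).
have o1' : finite_set [set p | - o p != 0]%classic.
  by apply: sub_finite_set o1 => p /=; rewrite oppr_eq0.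
have [_] := fsum_split o1 o1'; rewrite o2 add0r => <-.
split=> // [p|]; first exact: ord_atV.
by apply: fsbig1 => p _; rewrite subrr.
Qed.

Lemma principal_divisor_const a : a != 0 -> principal_divisor (a%:P%:F).
Proof.
move=> a0; exists (fun=> 0); split=> [p||].
- exact/ord_at_unit/unit_at_const.
- by apply: sub_finite_set (finite_set0 _) => p /= /eqP.
- exact: fsbig1.
Qed.

(** A simple zero at [a] is balanced by a simple pole at infinity. *)
Lemma principal_divisor_XsubC a : principal_divisor (('X - a%:P)%:F).
Proof.
have fin (b : pt R) (i : int) :
    finite_set [set p | (if p == b then i else 0) != 0]%classic.
  apply: sub_finite_set (finite_set1 b) => p; rewrite /mkset /=.
  by case: (p =P b) => // _; rewrite eqxx.
have sum1 (b : pt R) (i : int) :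
    \sum_(p \in [set: pt R]%classic) (if p == b then i else 0) = i.
  rewrite -(fsbig_widen [set b]%classic) ?fsbig_set1 ?eqxx //.
  by move=> p [_ /= /eqP/negbTE ->].
have [h1 h2] := fsum_split (fin (Some a) 1) (fin None (-1)).
exists (fun p => (if p == Some a then 1 else 0) + (if p == None then -1 else 0)).
split=> // [[b|]|]; last by rewrite h2 !sum1 subrr.
- rewrite addr0; case: eqP => [[<-]|ab].
    by apply/ord_atP; rewrite exprN1 mulfV ?(uniformizer_neq0 (Some b)) //; exact: unit_at1.
  apply/ord_at_unit/unit_at_poly; rewrite root_XsubC.
  by apply/eqP => E; apply: ab; rewrite E.
- rewrite /= add0r; apply/ord_atP; rewrite opprK expr1z /uniformizer /zvar.
  by apply: unit_at_infty; rewrite ?polyXsubC_eq0 ?polyX_eq0 // size_XsubC size_polyX.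
Qed.

(** Numerator and denominator split into a constant and linear factors over the complex numbers, and
    the property is multiplicative. *)
Lemma principal_divisorP f : f != 0 -> principal_divisor f.
Proof.
have [n [d [d0 ->]]] := fraction_repr f; rewrite mulf_eq0 negb_or tofrac_eq0.
case/andP=> n0 _.
have P m : m != 0 -> principal_divisor (m%:F).
  move=> m0; have [s ->] := Cplx_normal m.
  rewrite -mul_polyC tofracM; apply: principal_divisorM; first by apply: principal_divisor_const; rewrite lead_coef_eq0.
  elim: s => [|a s IH]; last by rewrite big_cons tofracM; apply: principal_divisorM => //; apply: principal_divisor_XsubC.
  by rewrite big_nil -polyC1; apply: principal_divisor_const; rewrite oner_neq0.
by apply: principal_divisorM; [exact: P | apply/principal_divisorV/P].
Qed.

Lemma ord_at_exists f p : f != 0 -> exists o, ord_at f p o.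
Proof. by move=> /principal_divisorP[o [fo _ _]]; exists (o p). Qed.

Lemma regular_cofinite f : exists s : seq (pt R),
  forall p, p \notin s -> regular_at f p.
Proof.
have [->|f0] := eqVneq f 0; first by exists [::] => p _; apply: regular_at0.
have [o [fo fin _]] := principal_divisorP f0; have /finite_seqP[s sE] := fin.
exists s => p ps; apply/(ord_at_regular (fo p)).
suff -> : o p = 0 by [].
apply: contraNeq ps => op; suff : [set` s]%classic p by [].
by rewrite -sE.
Qed.

(** Induction on the size of a denominator: regularity of [f] at a root of the denominator forces
    the numerator to vanish there too, so that a linear factor cancels. *)
Lemma regular_poly f :
  (forall a, regular_at f (Some a)) -> exists n : {poly (Cplx R)}, f = n%:F.
Proof.
move=> fr; have [n [d [d0 fE]]] := fraction_repr f.
have {fE} : f * d%:F = n%:F by rewrite fE mulfVK ?tofrac_eq0.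
have [m] := ubnP (size d); elim: m => // m IH in n d d0 *; rewrite ltnS => sd fE.
have [s1|/Cplx_root[a ra]] := eqVneq (size d) 1%N.
  have [c c0 dE] := size_poly1P _ (introT eqP s1); exists (n * c^-1%:P).
  rewrite tofracM -fE dE -mulrA -tofracM -polyCM mulfV ?polyC1 ?tofrac1 ?mulr1 //.
have [v [k [u [e [su se e0 uE _]]]]] := fr a; rewrite hval_some // in e0.
have ne : n * e = u * d.
  by apply/eqP; rewrite -tofrac_eq !tofracM -fE -uE mulrAC.
have rn : root n a.
  have /eqP : (n * e).[a] = 0 by rewrite ne hornerM (rootP ra) mulr0.
  by rewrite hornerM mulf_eq0 (negbTE e0) orbF.
have [n' nE] := factor_theorem _ _ rn; have [d' dE] := factor_theorem _ _ ra.
have x0 : ('X - a%:P)%:F != 0 :> ratfun R by rewrite tofrac_eq0 polyXsubC_eq0.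
have d'0 : d' != 0 by apply: contraNneq d0 => d'0; rewrite dE d'0 mul0r.
apply: (IH n' d') => //.
  by move: sd; rewrite dE size_Mmonic ?monicXsubC // size_XsubC addn2.
by apply: (mulIf x0); rewrite -mulrA -!tofracM -dE -nE.
Qed.

(** The hypotheses say that [f] is a nonzero global section of O(m). It is a polynomial, and
    comparison with its leading monomial at infinity bounds its degree by m; hence m >= 0, and only
    constants remain when m = 0. *)
Lemma twisted_global_sections f (m : int) : f != 0 ->
  (forall a, regular_at f (Some a)) -> regular_at (f * zvar R ^ (- m)) None ->
  0 <= m /\ (m = 0 -> exists2 c : Cplx R, c != 0 & f = c%:P%:F).
Proof.
move=> f0 /regular_poly[n fE]; rewrite fE in f0 *; rewrite tofrac_eq0 in f0.
pose s := (size n).-1.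
have u : unit_at (n%:F / ('X^s)%:F : ratfun R) None.
  apply: unit_at_infty; rewrite ?size_polyXn ?prednK ?size_poly_gt0 //.
  exact: monic_neq0 (monicXn _ _).
move=> r; have := regular_atM r (unit_regular (unit_atV u)).
rewrite mulrAC invf_div mulrCA mulfV ?tofrac_eq0 // mulr1 tofracXn.
rewrite -/(zvar R) exprnP -expfzDr ?zvar_neq0 //.
rewrite -[zvar R]invrK exprz_inv => /(@uniformizer_exp_nregular None).
rewrite opprD opprK addrC subr_ge0 => sm; split; first exact: le_trans sm.
move=> m0; rewrite {}m0 lez_nat leqn0 /s in sm.
have : size n == 1%N by rewrite eqn_leq size_poly_gt0 f0 andbT -subn_eq0 subn1.
by move=> /size_poly1P[c c0 ->]; exists c.
Qed.

Lemma separating_function (q p : pt R) : q != p -> exists f : ratfun R,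
  [/\ forall x, x != p -> regular_at f x,
      forall x, x != p -> x != q -> unit_at f x & value_at f q 0].
Proof.
move=> qp.
(* The linear form whose only zero is [y]. For the point at infinity it is the constant -1, which
   vanishes there when homogenized in degree 1; the wanted function is the quotient of the forms of
   [q] and [p]. *)
pose l (y : pt R) : {poly (Cplx R)} := beta y *: 'X - (alpha y)%:P.
have sl y : (size (l y) <= 2)%N.
  rewrite (leq_trans (size_polyD _ _)) // size_polyN geq_max.
  by rewrite (leq_trans (size_scale_leq _ _)) ?size_polyX // (leq_trans (size_polyC_leq1 _)).
have hl y x : (hval 1 (l y) x == 0) = (x == y).
  case: x => [a|]; [rewrite hval_some // | rewrite hval_none]; rewrite /l.
    rewrite hornerD hornerN hornerZ hornerX hornerC.
    case: y => [b|] /=; rewrite ?mul1r ?mul0r ?subr_eq0 //.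
    by rewrite eq_sym oner_eq0.
  rewrite coefB coefZ coefX coefC /= subr0 mulr1.
  by case: y => [b|] /=; rewrite ?oner_eq0 ?eqxx.
have v x : x != p -> value_at ((l q)%:F / (l p)%:F : ratfun R) x
     (hval 1 (l q) x / hval 1 (l p) x).
  move=> xp; exists 1%N, (l q), (l p); split; rewrite ?sl ?hl //.
  rewrite mulfVK // tofrac_eq0; apply: (@hval_neq0 1 _ x); by rewrite hl.
exists ((l q)%:F / (l p)%:F); split=> [x /v vx|x xp xq|].
- by eexists; exact: vx.
- by eexists; last exact: v; rewrite mulf_neq0 ?invr_eq0 ?hl.
- have := v _ qp; suff /eqP -> : hval 1 (l q) q == 0 by rewrite mul0r.
  by rewrite hl.
Qed.

(** A product of separating functions. All poles are confined to [p], which will be a point outside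
    a given affine open set. *)
Lemma vanishing_function (s : seq (pt R)) p : exists f : ratfun R,
  [/\ forall x, x != p -> regular_at f x,
      forall x, x != p -> x \notin s -> unit_at f x &
      forall x, x != p -> x \in s -> value_at f x 0].
Proof.
elim: s => [|q s [f [f1 f2 f3]]].
  by exists 1; split=> // [x _|x _ _]; [exact: regular_at1 | exact: unit_at1].
have [->|qp] := eqVneq q p.
  exists f; split=> // x xp; rewrite inE (negbTE xp) //=; [exact: f2|exact: f3].
have [g [g1 g2 g3]] := separating_function qp.
exists (g * f); split=> [x xp|x xp|x xp].
- by apply: regular_atM; [exact: g1|exact: f1].
- by rewrite inE negb_or => /andP[xq xs]; apply: unit_atM; [exact: g2|exact: f2].
- rewrite inE; case: eqP => [->|_ /= xs].
    by have [w fw] := f1 _ qp; have := value_atM g3 fw; rewrite mul0r.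
  by have [w gw] := g1 _ xp; have := value_atM gw (f3 _ xp xs); rewrite mulr0.
Qed.

End FunctionField.

(** * Cofinite open sets and regular functions *)

Section Opens.
Variable R : realType.
Implicit Types (U V W : zopen R) (p : pt R) (s : seq (pt R)).

Lemma zsub_refl U : zsub U U. Proof. by []. Qed.

Lemma zsub_trans U V W : zsub W V -> zsub V U -> zsub W U.
Proof. by move=> h1 h2 p /h1/h2. Qed.

Fact avoid_cofinite s : finite_set [set p : pt R | ~ (p \notin s)]%classic.
Proof.
apply: (@sub_finite_set _ _ [set` s]%classic); last exact: finite_seq.
by move=> p /= /negP; rewrite negbK.
Qed.

Definition avoid s : zopen R := ZOpen (avoid_cofinite s).

Fact interz_cofinite U V : finite_set [set p | ~ (U p /\ V p)]%classic.
Proof.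
apply: (@sub_finite_set _ _ ([set p | ~ U p] `|` [set p | ~ V p])%classic).
  by move=> p /= /not_andP.
by rewrite finite_setU; split; apply: zset_cofinite.
Qed.

Definition interz U V : zopen R := ZOpen (interz_cofinite U V).

Lemma interl U V : zsub (interz U V) U. Proof. by move=> p []. Qed.
Lemma interr U V : zsub (interz U V) V. Proof. by move=> p []. Qed.

Lemma zopen_avoid U : exists s, forall p, U p <-> p \notin s.
Proof.
have /finite_seqP[s sE] := zset_cofinite U; exists s => p.
have /= E := congr1 (fun A : set (pt R) => A p) sE.
split=> [Up|/negP ps].
  by apply/negP => ps; have : ~ U p by rewrite E.
by apply: contrapT; rewrite E.
Qed.

Fact domz_cofinite (f : ratfun R) :
  finite_set [set p | ~ regular_at f p]%classic.
Proof.
have [s sP] := regular_cofinite f.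
apply: (@sub_finite_set _ _ [set` s]%classic); last exact: finite_seq.
by move=> p /= fp; apply: contrapT => /negP/sP.
Qed.

Definition domz (f : ratfun R) : zopen R := ZOpen (domz_cofinite f).

Fact mkreg_subproof U (f : ratfun R) :
  regular_on U f -> f \in regular_pred U.
Proof. by move=> fU; apply/asboolP. Qed.

Definition mkreg U (f : ratfun R) (fU : regular_on U f) : regfun U :=
  RegFun (mkreg_subproof fU).

Lemma regfunP U (f : regfun U) : regular_on U (rfval f).
Proof. by case: f => f /= /asboolP. Qed.

Lemma regfun_inj U (f g : regfun U) : rfval f = rfval g -> f = g.
Proof. by move=> fg; apply: val_inj. Qed.

Lemma rfval0 U : rfval (0 : regfun U) = 0. Proof. by []. Qed.
Lemma rfvalD U (f g : regfun U) : rfval (f + g) = rfval f + rfval g.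
Proof. by []. Qed.
Lemma rfvalM U (f g : regfun U) : rfval (f * g) = rfval f * rfval g.
Proof. by []. Qed.
Lemma rfvalX U (f : regfun U) i : rfval (f ^+ i) = rfval f ^+ i.
Proof. by elim: i => [|i IH]; rewrite ?expr0 // !exprS rfvalM IH. Qed.

End Opens.

Arguments zsub_refl {R U}.
Arguments interl {R U V}.
Arguments interr {R U V}.

(* Tensoring the injection [f : A -> A] with M, realized as M itself. *)
Lemma flat_torsion_free (A : comNzRingType) (M : lmodType A) (f : A) :
  flat_module M -> (forall a, f * a = 0 -> a = 0) ->
  forall m : M, f *: m = 0 -> m = 0.
Proof.
move=> fl freg.
have ti : is_tensor (fun (m : M) (a : A^o) => (a : A) *: m).
  split.
    split=> [a m m' n|a m n n']; rewrite ?scalerDr ?scalerDl ?scalerA.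
      by rewrite mulrC.
    by [].
  move=> Q c [c1 c2].
  have cL : linear (fun m => c m (1 : A^o)) by move=> a m m'; rewrite c1.
  pose cl := GRing.isLinear.Build _ _ _ _ _ cL.
  pose cf : {linear M -> Q} := HB.pack (fun m => c m (1 : A^o)) cl.
  have c0 m : c m (0 : A^o) = 0.
    by have := c2 (-1) m 0 0; rewrite scaler0 addr0 scaleN1r addNr.
  have cE m (n : A^o) : c m n = (n : A) *: c m (1 : A^o).
    have := c2 n m (1 : A^o) 0; rewrite c0 !addr0 => <-.
    by rewrite /GRing.scale /= mulr1.
  exists cf; split=> [m n|g gE m]; first by rewrite linearZ /= -cE.
  by have := gE m (1 : A^o); rewrite scale1r.
have iL : linear (fun a : A^o => (f * (a : A) : A^o)).
  by move=> a x y; rewrite mulrDr /GRing.scale /= mulrCA.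
pose il := GRing.isLinear.Build _ _ _ _ _ iL.
pose i : {linear A^o -> A^o} := HB.pack (fun a : A^o => (f * (a : A) : A^o)) il.
have ii : injective i.
  by move=> x y /= /eqP; rewrite -subr_eq0 -mulrBr => /eqP/freg/eqP; rewrite subr_eq0 => /eqP.
have jL : linear (fun m : M => f *: m).
  by move=> a x y; rewrite scalerDr !scalerA mulrC.
pose jl := GRing.isLinear.Build _ _ _ _ _ jL.
pose j : {linear M -> M} := HB.pack (fun m : M => f *: m) jl.
have jinj : injective j.
  by apply: (fl _ _ i ii _ _ _ _ ti ti) => m n /=; rewrite scalerA.
by move=> m fm; apply: jinj; rewrite /= fm scaler0.
Qed.

(** * Injectivity of restriction maps *)

Section Restriction.
Variables (R : realType) (F : gKmodule R).
Implicit Types U V W : zopen R.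

Lemma res_irr U V (h h' : zsub V U) (m : F U) : om_res h m = om_res h' m.
Proof. by rewrite -[LHS](om_res_id zsub_refl) (om_res_comp _ _ h'). Qed.

Lemma torsion_free U (f : regfun U) (m : F U) :
  affine U -> rfval f != 0 -> f *: m = 0 -> m = 0.
Proof.
move=> aU f0; apply: flat_torsion_free; first exact: gk_flat.
move=> a fa; apply: regfun_inj; apply/eqP; have /(congr1 (@rfval _ _))/eqP := fa.
by rewrite rfvalM rfval0 mulf_eq0 (negbTE f0).
Qed.

(** An affine [U] misses a point [p], where a function may have poles while vanishing exactly at the
    finitely many points of [U] outside [V]. So every smaller open set is distinguished, and
    quasicoherence applies to it. *)
Lemma distinguished U V (h : zsub V U) : affine U -> exists f : regfun U,
  (forall p, V p <-> U p /\ ~ value_at (rfval f) p 0) /\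
  (forall p, V p -> unit_at (rfval f) p).
Proof.
move=> [p Up]; have [s sP] := zopen_avoid V.
have [f [f1 f2 f3]] := vanishing_function s p.
have ne q : U q -> q != p by move=> Uq; apply: contra_notN Up => /eqP <-.
have fU : regular_on U f by move=> q /ne; apply: f1.
have u q : V q -> unit_at f q.
  by move=> Vq; apply: f2; [apply/ne/h | apply/sP].
exists (mkreg fU); split=> // q; split=> [Vq|[Uq nv]].
  split; first exact: h.
  by have [v v0 fv] := u q Vq; move=> /(value_at_uniq fv) vE; rewrite vE eqxx in v0.
by apply/sP/negP => qs; apply: nv; apply: f3 => //; apply: ne.
Qed.

Lemma distinguished_neq0 U V (f : regfun U) p :
  V p -> (forall p, V p -> unit_at (rfval f) p) -> rfval f != 0.
Proof. by move=> Vp /(_ p Vp)/unit_at_neq0. Qed.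

Lemma zopen_nonempty U : exists p, U p.
Proof.
have [s sP] := zopen_avoid U.
have [i /eqP iE] : exists i : nat, Some (i%:R : Cplx R) \notin s.
  apply: contrapT => /forallNP nE.
  pose t := [seq Some (i%:R : Cplx R) | i <- iota 0 (size s).+1] : seq (pt R).
  have ut : uniq t.
    rewrite map_inj_uniq ?iota_uniq // => i j [] /eqP.
    by rewrite (eqr_nat R[i]) => /eqP.
  have st : {subset t <= s}.
    by move=> x /mapP[i _ ->]; have /negP := nE i; rewrite negbK.
  by have := uniq_leq_size ut st; rewrite size_map size_iota ltnn.
by exists (Some i%:R); apply/sP/eqP.
Qed.

(** Quasicoherence gives a power of the equation of the complement that kills [m]; flatness excludes
    such torsion. *)
Lemma res_eq0_affine U V (h : zsub V U) (m : F U) :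
  affine U -> om_res h m = 0 -> m = 0.
Proof.
move=> aU mV; have [f [fV fu]] := distinguished h aU.
have [_ /(_ m mV) [i fm]] := @gk_quasicoherent _ F U V h f aU fV.
have [p Vp] := zopen_nonempty V.
apply: torsion_free fm => //; rewrite rfvalX expf_neq0 //.
exact: distinguished_neq0 Vp fu.
Qed.

Lemma res0 U V (h : zsub V U) : om_res h (0 : F U) = 0.
Proof. by apply: (addrI (om_res h (0 : F U))); rewrite -om_resD !addr0. Qed.

Lemma resN U V (h : zsub V U) (m : F U) : om_res h (- m) = - om_res h m.
Proof. by apply/eqP; rewrite -addr_eq0 -om_resD addNr res0. Qed.

Lemma res_inj U V (h : zsub V U) : injective (om_res h : F U -> F V).
Proof.
suff K (m : F U) : om_res h m = 0 -> m = 0.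
  move=> m m' /eqP; rewrite -subr_eq0 -resN -om_resD => /eqP/K/eqP.
  by rewrite subr_eq0 => /eqP.
(* Two affine pieces cover [U]: the parts that avoid infinity and 0 respectively. Locality reduces
   the claim to them. *)
move=> mV; pose w (b : bool) := interz U (avoid [:: if b then None else Some 0]).
have hw b : zsub (w b) U by apply: interl.
apply: (@om_local _ F _ w U hw) => [|b].
  move=> p Up; case: p Up => [a|] Up; [exists true|exists false]; by split.
have hb : zsub (interz V (w b)) (w b) by apply: interr.
apply: (res_eq0_affine (h := hb)).
  by exists (if b then None else Some 0); case=> _ /=; rewrite inE eqxx.
rewrite (om_res_comp _ _ (zsub_trans hb (hw b))).
by rewrite -(om_res_comp h (interl (V := w b))) mV res0.
Qed.

End Restriction.

(** * The generic stalk *)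

Section StalkDef.
Variables (R : realType) (F : gKmodule R).
Implicit Types U V W : zopen R.

Definition pregerm : Type := {U : zopen R & F U}.
HB.instance Definition _ := gen_eqMixin pregerm.
HB.instance Definition _ := gen_choiceMixin pregerm.

Definition same_germ : rel pregerm := fun x y =>
  `[< exists W (h : zsub W (projT1 x)) (h' : zsub W (projT1 y)),
      om_res h (projT2 x) = om_res h' (projT2 y) >].

Fact same_germ_refl : reflexive same_germ.
Proof. by case=> U m; apply/asboolP; exists U, zsub_refl, zsub_refl. Qed.

Fact same_germ_sym : symmetric same_germ.
Proof.
by move=> x y; apply/asboolP/asboolP => -[W [h [h' E]]]; exists W, h', h.
Qed.

Fact same_germ_trans : transitive same_germ.
Proof.
move=> [V n] [U m] [W l] /asboolP[A [h1 [h2 /= E1]]] /asboolP[B [h3 [h4 /= E2]]].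
apply/asboolP; exists (interz A B), (zsub_trans (interl (V:=B)) h1),
  (zsub_trans (interr (U:=A)) h4) => /=.
rewrite -(om_res_comp h1 (interl (V:=B))) E1.
rewrite -(om_res_comp h4 (interr (U:=A))) -E2.
rewrite (om_res_comp _ _ (zsub_trans (interl (V:=B)) h2)).
by rewrite (om_res_comp _ _ (zsub_trans (interl (V:=B)) h2)).
Qed.

Canonical same_germ_equiv :=
  EquivRel same_germ same_germ_refl same_germ_sym same_germ_trans.

Definition stalk : Type := {eq_quot same_germ}.
HB.instance Definition _ : EqQuotient _ same_germ stalk := EqQuotient.on stalk.
HB.instance Definition _ := Choice.on stalk.

Definition germ U (m : F U) : stalk := \pi_stalk (existT _ U m : pregerm).

Lemma germ_surj (x : stalk) : exists U (m : F U), x = germ m.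
Proof.
by case E : (repr x) => [U m]; exists U, m; rewrite /germ -E reprK.
Qed.

Lemma germ_eqP U V (m : F U) (n : F V) : germ m = germ n <->
  exists W (h : zsub W U) (h' : zsub W V), om_res h m = om_res h' n.
Proof. by split=> [/eqmodP/asboolP|H]; [|apply/eqmodP/asboolP]. Qed.

Lemma germ_res U V (h : zsub V U) (m : F U) : germ (om_res h m) = germ m.
Proof.
by apply/germ_eqP; exists V, zsub_refl, h; rewrite om_res_id.
Qed.

Lemma germ_inj U : injective (@germ U).
Proof. by move=> m n /germ_eqP[W [h [h']]]; rewrite (res_irr h' h) => /res_inj. Qed.

Lemma germ_shrink V (x : stalk) : exists U (_ : zsub U V) (m : F U), x = germ m.
Proof.
have [U [m ->]] := germ_surj x; exists (interz U V), (interr (U:=U)),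
  (om_res (interl (V:=V)) m); by rewrite germ_res.
Qed.

Lemma germ_common V (x y z : stalk) : exists U (_ : zsub U V) (a b c : F U),
  [/\ x = germ a, y = germ b & z = germ c].
Proof.
have [U1 [h1 [a ->]]] := germ_shrink V x.
have [U2 [h2 [b ->]]] := germ_shrink U1 y.
have [U3 [h3 [c ->]]] := germ_shrink U2 z.
exists U3, (zsub_trans (zsub_trans h3 h2) h1), (om_res (zsub_trans h3 h2) a),
  (om_res h3 b), c.
by rewrite !germ_res.
Qed.

Definition stalk_add (x y : stalk) : stalk :=
  germ (om_res (interl (V:=projT1 (repr y))) (projT2 (repr x)) +
        om_res (interr (U:=projT1 (repr x))) (projT2 (repr y))).
Definition stalk_opp (x : stalk) : stalk := germ (- projT2 (repr x)).
Definition stalk_zero : stalk := germ (0 : F (avoid [::])).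
(** The representative is first restricted to the domain of [f], since [f] need not be regular where
    the representative lives; this is what makes the stalk a vector space over the whole function
    field. *)
Definition stalk_scale (f : ratfun R) (x : stalk) : stalk :=
  germ (@mkreg _ (interz (domz f) (projT1 (repr x))) f (interl (V:=_))
        *: om_res (interr (U:=domz f)) (projT2 (repr x))).

Lemma germ_repr (x : stalk) : germ (projT2 (repr x)) = x.
Proof. by rewrite -[RHS]reprK /germ; case: (repr x). Qed.

Lemma stalk_addE U (m n : F U) : stalk_add (germ m) (germ n) = germ (m + n).
Proof.
rewrite /stalk_add.
have /germ_eqP[A [h1 [h2 E1]]] := germ_repr (germ m).
have /germ_eqP[B [h3 [h4 E2]]] := germ_repr (germ n).
pose W := interz A B.
have hA : zsub W A by apply: interl.
have hB : zsub W B by apply: interr.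
apply/germ_eqP.
have h : zsub W (interz (projT1 (repr (germ m))) (projT1 (repr (germ n)))).
  by move=> p Wp; split; [apply/h1/hA | apply/h3/hB].
exists W, h, (zsub_trans hA h2); rewrite !om_resD; congr (_ + _).
  by rewrite (om_res_comp _ _ (zsub_trans hA h1)) -(om_res_comp h1 hA) E1
     (om_res_comp _ _ (zsub_trans hA h2)).
by rewrite (om_res_comp _ _ (zsub_trans hB h3)) -(om_res_comp h3 hB) E2
   (om_res_comp _ _ (zsub_trans hA h2)).
Qed.

Lemma stalk_oppE U (m : F U) : stalk_opp (germ m) = germ (- m).
Proof.
have /germ_eqP[A [h1 [h2 E1]]] := germ_repr (germ m).
by apply/germ_eqP; exists A, h1, h2; rewrite !resN E1.
Qed.

Lemma stalk_zeroE U : stalk_zero = germ (0 : F U).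
Proof.
have h : zsub U (avoid [::]) by move=> p.
by apply/germ_eqP; exists U, h, zsub_refl; rewrite !res0.
Qed.

Lemma stalk_scaleE U (f : regfun U) (m : F U) :
  stalk_scale (rfval f) (germ m) = germ (f *: m).
Proof.
rewrite /stalk_scale.
have /germ_eqP[A [h1 [h2 E1]]] := germ_repr (germ m).
have h : zsub A (interz (domz (rfval f)) (projT1 (repr (germ m)))).
  by move=> p Ap; split; [exact: regfunP (h2 _ Ap) | exact: (h1 _ Ap)].
apply/germ_eqP; exists A, h, h2; rewrite !om_resZ.
rewrite (om_res_comp _ _ h1) E1; congr (_ *: _); exact: regfun_inj.
Qed.

Fact stalk_addA : associative stalk_add.
Proof.
move=> x y z; have [U [_ [a [b [c [-> -> ->]]]]]] := germ_common (avoid [::]) x y z.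
by rewrite !stalk_addE addrA.
Qed.

Fact stalk_addC : commutative stalk_add.
Proof.
move=> x y; have [U [_ [a [b [c [-> -> _]]]]]] := germ_common (avoid [::]) x y y.
by rewrite !stalk_addE addrC.
Qed.

Fact stalk_add0 : left_id stalk_zero stalk_add.
Proof.
by move=> x; have [U [a ->]] := germ_surj x; rewrite (stalk_zeroE U) stalk_addE add0r.
Qed.

Fact stalk_addN : left_inverse stalk_zero stalk_opp stalk_add.
Proof.
move=> x; have [U [a ->]] := germ_surj x.
by rewrite stalk_oppE (stalk_zeroE U) stalk_addE addNr.
Qed.

HB.instance Definition _ :=
  GRing.isZmodule.Build stalk stalk_addA stalk_addC stalk_add0 stalk_addN.

Fact stalk_scaleA f g (x : stalk) :
  stalk_scale f (stalk_scale g x) = stalk_scale (f * g) x.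
Proof.
have [U [h [a ->]]] := germ_shrink (interz (domz f) (domz g)) x.
pose f' := mkreg (zsub_trans h (interl (V:=_)) : regular_on U f).
pose g' := mkreg (zsub_trans h (interr (U:=_)) : regular_on U g).
rewrite -[f]/(rfval f') -[g]/(rfval g') -rfvalM !stalk_scaleE.
by rewrite scalerA.
Qed.

Fact stalk_scale1 : left_id 1 stalk_scale.
Proof.
move=> x; have [U [a ->]] := germ_surj x.
by rewrite -[1]/(rfval (1 : regfun U)) stalk_scaleE scale1r.
Qed.

Fact stalk_scaleDr : right_distributive stalk_scale +%R.
Proof.
move=> f x y; have [U [h [a [b [_ [-> -> _]]]]]] := germ_common (domz f) x y y.
rewrite -[f]/(rfval (mkreg (h : regular_on U f))).
rewrite -[_ + _ in LHS]/(stalk_add _ _) -[RHS]/(stalk_add _ _).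
by rewrite !stalk_addE !stalk_scaleE stalk_addE scalerDr.
Qed.

Fact stalk_scaleDl x : {morph stalk_scale^~ x : f g / f + g}.
Proof.
move=> f g; have [U [h [a ->]]] := germ_shrink (interz (domz f) (domz g)) x.
pose f' := mkreg (zsub_trans h (interl (V:=_)) : regular_on U f).
pose g' := mkreg (zsub_trans h (interr (U:=_)) : regular_on U g).
rewrite -[f]/(rfval f') -[g]/(rfval g') -rfvalD !stalk_scaleE.
by rewrite -[RHS]/(stalk_add _ _) stalk_addE scalerDl.
Qed.

HB.instance Definition _ := GRing.Zmodule_isLmodule.Build (ratfun R) stalk
  stalk_scaleA stalk_scale1 stalk_scaleDr stalk_scaleDl.

Lemma germD U (m n : F U) : germ (m + n) = germ m + germ n.
Proof. by rewrite -stalk_addE. Qed.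

Lemma germZ U (f : regfun U) (m : F U) : germ (f *: m) = rfval f *: germ m.
Proof. by rewrite -stalk_scaleE. Qed.

Lemma germ0 U : germ (0 : F U) = 0.
Proof. by rewrite -stalk_zeroE. Qed.

Lemma germN U (m : F U) : germ (- m) = - germ m.
Proof. by rewrite -stalk_oppE. Qed.

Lemma germ_sum U (I : Type) (s : seq I) (P : pred I) (m : I -> F U) :
  germ (\sum_(i <- s | P i) m i) = \sum_(i <- s | P i) germ (m i).
Proof. by apply: (big_morph (@germ U)); [exact: germD | exact: germ0]. Qed.

(** By [germ_inj] these germs form a copy of F(U), so that the sheaf becomes a family of subgroups
    of a single vector space. *)
Definition Gam U (x : stalk) : Prop := exists m : F U, germ m = x.

Lemma Gam_sub U V x : zsub V U -> Gam U x -> Gam V x.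
Proof. by move=> h [m <-]; exists (om_res h m); rewrite germ_res. Qed.

Lemma Gam0 U : Gam U 0.
Proof. by exists 0; rewrite germ0. Qed.

Lemma GamD U x y : Gam U x -> Gam U y -> Gam U (x + y).
Proof. by move=> [m <-] [n <-]; exists (m + n); rewrite germD. Qed.

Lemma GamZ U f x : regular_on U f -> Gam U x -> Gam U (f *: x).
Proof. by move=> fU [m <-]; exists (mkreg fU *: m); rewrite germZ. Qed.

Lemma Gam_sum U (I : Type) (s : seq I) (P : pred I) (x : I -> stalk) :
  (forall i, P i -> Gam U (x i)) -> Gam U (\sum_(i <- s | P i) x i).
Proof.
move=> H; elim/big_rec: _ => [|i y Pi]; first exact: Gam0.
by apply: GamD; apply: H.
Qed.

Lemma Gam_shrink V x : exists U (_ : zsub U V), Gam U x.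
Proof. by have [U [h [m ->]]] := germ_shrink V x; exists U, h, m. Qed.

(** The local sections agree on overlaps for free: they have the same germ, and germs determine
    sections. *)
Lemma Gam_glue U x :
  (forall p, U p -> exists W : zopen R, W p /\ Gam W x) -> Gam U x.
Proof.
move=> H; pose I := {W : zopen R | zsub W U /\ Gam W x}.
pose W (i : I) := sval i.
have hW (i : I) : zsub (W i) U by case: (svalP i).
have gW (i : I) : Gam (W i) x by case: (svalP i).
pose s i := sval (cid (gW i)).
have sE i : germ (s i) = x by rewrite /s; case: cid.
have cov p : U p -> exists i, W i p.
  move=> Up; have [V [Vp Vx]] := H p Up.
  have i0 : zsub (interz U V) U /\ Gam (interz U V) x.
    by split; [exact: interl | apply: Gam_sub Vx; exact: interr].
  by exists (exist (fun W : zopen R => zsub W U /\ Gam W x) _ i0).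
have [] := @om_glue _ F I W U hW cov s.
  by move=> i j V hi hj; apply: germ_inj; rewrite !germ_res !sE.
move=> m mE; exists m.
have [p Up] := zopen_nonempty U; have [i _] := cov p Up.
by rewrite -(germ_res (hW i)) mE sE.
Qed.

(** Clearing denominators: [f] is a power of an equation of the complement of [V] in [U], so it can
    be divided out again at the points of [V]. *)
Lemma Gam_qc U V x : affine U -> zsub V U -> Gam V x ->
  exists f : ratfun R, [/\ regular_on U f, forall p, V p -> unit_at f p &
     Gam U (f *: x)].
Proof.
move=> aU h [y <-]; have [f [fV fu]] := distinguished h aU.
have [/(_ y)[k [m kE]] _] := @gk_quasicoherent _ F U V h f aU fV.
exists (rfval f ^+ k); split.
- by move=> p Up; rewrite -rfvalX; apply: regfunP.
- by move=> p /fu; rewrite exprnP; apply: unit_at_exp.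
- exists m; rewrite -(germ_res h) -kE germZ rfvalX //.
Qed.

(** An operator known only on small open sets suffices, as every germ has a representative there.
    Likewise linearity over the regular functions becomes linearity over the function field after
    shrinking. *)
Lemma stalk_operator V (op : forall U, F U -> F U) :
  (forall U, zsub U V -> linear (op U)) ->
  (forall U W (h : zsub W U) m, zsub U V -> om_res h (op U m) = op W (om_res h m)) ->
  exists phi : stalk -> stalk, linear phi /\
    forall U (m : F U), zsub U V -> phi (germ m) = germ (op U m).
Proof.
move=> opL opR.
pose G (x y : stalk) := exists U (_ : zsub U V) (m : F U), x = germ m /\ y = germ (op U m).
have GE x : exists y, G x y.
  by have [U [h [m ->]]] := germ_shrink V x; exists (germ (op U m)), U, h, m.
pose phi x := sval (cid (GE x)).
have phiE U (m : F U) : zsub U V -> phi (germ m) = germ (op U m).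
  move=> hU; rewrite /phi; case: cid => y /= [W [hW [n [/germ_eqP mn ->]]]].
  have [A [h1 [h2 E]]] := mn; apply/germ_eqP; exists A, h2, h1.
  by rewrite !opR // E.
exists phi; split=> // f x y.
have [U [h [a [b [_ [-> -> _]]]]]] := germ_common (interz V (domz f)) x y y.
have hV := zsub_trans h (interl (V:=_)).
have fU : regular_on U f := zsub_trans h (interr (U:=_)).
rewrite -[f]/(rfval (mkreg fU)) -germZ -germD !phiE //.
by rewrite opL // germD germZ.
Qed.

End StalkDef.

(** * Sections of the Lie algebra family *)

Section FamilySections.
Variable R : realType.
Implicit Types (U V W : zopen R) (p : pt R) (f g : ratfun R)
  (A B : mpair (ratfun R)).

Lemma value_at0 p : value_at (0 : ratfun R) p 0.
Proof. by have := value_at_const 0 p; rewrite polyC0 tofrac0. Qed.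

Lemma value_at1 p : value_at (1 : ratfun R) p 1.
Proof. by have := value_at_const 1 p; rewrite polyC1 tofrac1. Qed.

Lemma value_atN f p v : value_at f p v -> value_at (- f) p (- v).
Proof.
by move=> fv; rewrite -[- f]add0r -[- v]add0r; apply: value_atB; first exact: value_at0.
Qed.

Lemma mpairZ (S : nzRingType) (f : S) (A : mpair S) :
  f *: A = (f *: A.1, f *: A.2).
Proof. by []. Qed.

Lemma mpairD (S : nzRingType) (A B : mpair S) :
  A + B = (A.1 + B.1, A.2 + B.2).
Proof. by []. Qed.

(** Were f - g nonzero, its inverse would be regular at some point of [U], and evaluating the
    product there would give 0 = 1. *)
Lemma ratfun_ext U f g :
  (forall p, U p -> exists2 v, value_at f p v & value_at g p v) -> f = g.
Proof.
move=> fg; apply/eqP; rewrite -subr_eq0; apply/negP => /negP h0.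
have [p [Up [w hw]]] := zopen_nonempty (interz U (domz (f - g)^-1)).
have [v fv gv] := fg p Up; have := value_atM (value_atB fv gv) hw.
rewrite subrr mul0r mulfV // => /value_at_uniq/(_ (value_at1 p))/eqP.
by rewrite eq_sym oner_eq0.
Qed.

Lemma ord2P (i : 'I_2) : i = ord0 \/ i = ord_max.
Proof. by case: i => [[|[|]]] // ?; [left|right]; apply: val_inj. Qed.

Lemma mat2_eta (S : Type) (M : 'M[S]_2) :
  M = mat2 (M ord0 ord0) (M ord0 ord_max) (M ord_max ord0) (M ord_max ord_max).
Proof.
by apply/matrixP => i j; rewrite mxE; case: (ord2P i) => ->; case: (ord2P j) => ->.
Qed.

Lemma mat2E (S : Type) (a b c d : S) : (mat2 a b c d ord0 ord0 = a) *
  (mat2 a b c d ord0 ord_max = b) * (mat2 a b c d ord_max ord0 = c) *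
  (mat2 a b c d ord_max ord_max = d).
Proof. by rewrite !mxE. Qed.

Lemma mat2_inj (S : Type) (M N : 'M[S]_2) :
  M ord0 ord0 = N ord0 ord0 -> M ord0 ord_max = N ord0 ord_max ->
  M ord_max ord0 = N ord_max ord0 -> M ord_max ord_max = N ord_max ord_max ->
  M = N.
Proof. by move=> E1 E2 E3 E4; rewrite (mat2_eta M) (mat2_eta N) E1 E2 E3 E4. Qed.

Lemma mat2M (S : nzRingType) (a b c d a' b' c' d' : S) :
  mat2 a b c d *m mat2 a' b' c' d' =
  mat2 (a * a' + b * c') (a * b' + b * d') (c * a' + d * c') (c * b' + d * d').
Proof.
have E (M N : 'M[S]_2) i j : (M *m N) i j = M i ord0 * N ord0 j + M i ord_max * N ord_max j.
  by rewrite mxE !big_ord_recl big_ord0 addr0; congr (_ + M _ _ * N _ _); apply: val_inj.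
by apply: mat2_inj; rewrite E !mat2E.
Qed.

Lemma mat2D (S : nzRingType) (a b c d a' b' c' d' : S) :
  mat2 a b c d + mat2 a' b' c' d' = mat2 (a + a') (b + b') (c + c') (d + d').
Proof. by apply: mat2_inj; rewrite mxE !mat2E. Qed.

Lemma mat2Z (S : nzRingType) (x a b c d : S) :
  x *: mat2 a b c d = mat2 (x * a) (x * b) (x * c) (x * d).
Proof. by apply: mat2_inj; rewrite mxE !mat2E. Qed.

Lemma mat2N (S : nzRingType) (a b c d : S) :
  - mat2 a b c d = mat2 (- a) (- b) (- c) (- d).
Proof. by rewrite -scaleN1r mat2Z !mulN1r. Qed.

Lemma section_algebra (S : fieldType) (z h x y : S) :
  h *: (mat2 1 0 0 (-1), mat2 1 0 0 (-1)) +
    (x *: (mat2 0 z 0 0, mat2 0 1 0 0) + y *: (mat2 0 0 z^-1 0, mat2 0 0 1 0))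
  = (mat2 h (x * z) (y * z^-1) (- h), mat2 h x y (- h)) :> mpair S.
Proof.
rewrite !mpairZ !mpairD /= !mat2Z !mat2D.
by rewrite !(mulr0, mulr1, addr0, add0r, mulrN).
Qed.

Lemma mat2_bracket (S : fieldType) (z w : S) : z * w = 1 ->
  mat2 0 z 0 0 *m mat2 0 0 w 0 - mat2 0 0 w 0 *m mat2 0 z 0 0 =
  mat2 1 0 0 (-1).
Proof.
move=> zw; have wz : w * z = 1 by rewrite mulrC.
rewrite !mat2M mat2N mat2D.
by rewrite !(mulr0, mul0r, addr0, add0r, oppr0, zw, wz, subr0, sub0r).
Qed.

Lemma scale_upper (S : fieldType) (a x : S) :
  a *: (mat2 0 x 0 0, mat2 0 1 0 0) = (mat2 0 (a * x) 0 0, mat2 0 a 0 0)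
  :> mpair S.
Proof. by rewrite mpairZ /= !mat2Z !mulr0 mulr1. Qed.

Lemma scale_lower (S : fieldType) (a x : S) :
  a *: (mat2 0 0 x 0, mat2 0 0 1 0) = (mat2 0 0 (a * x) 0, mat2 0 0 a 0)
  :> mpair S.
Proof. by rewrite mpairZ /= !mat2Z !mulr0 mulr1. Qed.

Lemma conj_upper (S : fieldType) (a b z : S) :
  (mat2 a 0 0 b *m mat2 0 z 0 0 *m mat2 b 0 0 a,
   mat2 a 0 0 b *m mat2 0 1 0 0 *m mat2 b 0 0 a) =
  (a * a) *: (mat2 0 z 0 0, mat2 0 1 0 0) :> mpair S.
Proof.
by rewrite scale_upper !mat2M !(mulr0, mul0r, addr0, add0r, mulr1) mulrAC.
Qed.

Lemma conj_lower (S : fieldType) (a b z : S) :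
  (mat2 a 0 0 b *m mat2 0 0 z 0 *m mat2 b 0 0 a,
   mat2 a 0 0 b *m mat2 0 0 1 0 *m mat2 b 0 0 a) =
  (b * b) *: (mat2 0 0 z 0, mat2 0 0 1 0) :> mpair S.
Proof.
by rewrite scale_lower !mat2M !(mulr0, mul0r, addr0, add0r, mulr1) mulrAC.
Qed.

Lemma gsection_comb U A B f :
  regular_on U f -> gsection U A -> gsection U B -> gsection U (f *: A + B).
Proof.
move=> fU gA gB p Up; have [w fw] := fU p Up.
have [A' [[a [b [c EA]]] A1 A2]] := gA p Up.
have [B' [[a' [b' [c' EB]]] B1 B2]] := gB p Up.
exists (w *: A' + B'); split=> [|i j|i j]; last 2 first.
- by rewrite !mxE; apply: value_atD => //; apply: value_atM.
- by rewrite !mxE; apply: value_atD => //; apply: value_atM.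
exists (w * a + a'), (w * b + b'), (w * c + c'); rewrite EA EB.
rewrite mpairZ mpairD /= !mat2Z !mat2D.
by congr (_, _); congr mat2; rewrite ?mulrDr ?mulrN ?opprD // mulrCA.
Qed.

Lemma gsection0 U A : gsection U A -> gsection U (0 : mpair (ratfun R)).
Proof.
move=> gA; rewrite -(addNr A) -scaleN1r; apply: (gsection_comb _ gA gA) => p _.
by exists (- 1); apply/value_atN/value_at1.
Qed.

Lemma gsectionZ U A f : regular_on U f -> gsection U A -> gsection U (f *: A).
Proof.
by move=> fU gA; rewrite -[_ *: A]addr0; apply: (gsection_comb fU gA (gsection0 gA)).
Qed.

Lemma gsection_sub U V A : zsub V U -> gsection U A -> gsection V A.
Proof. by move=> h gA p /h/gA. Qed.

Lemma value_at_z (a : Cplx R) : value_at (zvar R) (Some a) a.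
Proof. by have := value_at_poly 'X a; rewrite hornerX. Qed.

Lemma value_at_zV_infty : value_at (zvar R)^-1 None 0.
Proof. exact: (value_at_uniformizer None). Qed.

Lemma gsection_mat U (h h' x x' y y' : ratfun R) : h' = - h ->
  (forall p, U p -> exists a b c, [/\ value_at h p a,
     value_at x p (alpha p * b), value_at x' p (beta p * b),
     value_at y p (beta p * c) & value_at y' p (alpha p * c)]) ->
  gsection U (mat2 h x y h', mat2 h x' y' h').
Proof.
move=> -> H p Up; have [a [b [c [H1 H2 H3 H4 H5]]]] := H p Up.
eexists; split; first by exists a, b, c; reflexivity.
  move=> i j; case: (ord2P i) => ->; case: (ord2P j) => -> /=; rewrite !mat2E //.
  exact: value_atN.
move=> i j; case: (ord2P i) => ->; case: (ord2P j) => -> /=; rewrite !mat2E //.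
exact: value_atN.
Qed.

(** X has a pole at infinity and Y one at 0. These multiples are the generators on the opposite
    charts: [zX] away from 0, [zY] on the affine line. *)
Definition zX : mpair (ratfun R) := (zvar R)^-1 *: Xsec R.
Definition zY : mpair (ratfun R) := zvar R *: Ysec R.

Lemma gsection_H U : gsection U (Hsec R).
Proof.
apply: gsection_mat => // p _; exists 1, 0, 0; rewrite !mulr0.
by split; [exact: value_at1 | exact: value_at0 ..].
Qed.

Lemma gsection_X : gsection (avoid [:: None]) (Xsec R).
Proof.
apply: gsection_mat; rewrite ?oppr0 // => -[a|] //= _.
exists 0, 1, 0; rewrite !mulr0 !mulr1.
by split; [exact: value_at0 | exact: value_at_z | exact: value_at1 | exact: value_at0..].
Qed.

Lemma gsection_zX : gsection (avoid [:: Some 0]) zX.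
Proof.
rewrite /zX /Xsec scale_upper mulVf ?zvar_neq0 //.
apply: gsection_mat; rewrite ?oppr0 // => -[a|] //= a0.
  have {}a0 : a != 0 by move: a0; rewrite inE; apply: contraNneq => ->.
  exists 0, a^-1, 0; rewrite !mulr0 mul1r mulfV //.
  by split; [exact: value_at0 | exact: value_at1 | exact/value_atV/value_at_z | exact: value_at0..].
exists 0, 1, 0; rewrite !mulr0 mulr1 mul0r.
by split; [exact: value_at0 | exact: value_at1 | exact/value_at_zV_infty | exact: value_at0..].
Qed.

Lemma gsection_Y : gsection (avoid [:: Some 0]) (Ysec R).
Proof.
apply: gsection_mat; rewrite ?oppr0 // => -[a|] //= a0.
  have {}a0 : a != 0 by move: a0; rewrite inE; apply: contraNneq => ->.
  exists 0, 0, a^-1; rewrite !mulr0 mul1r mulfV //.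
  by split; [exact: value_at0.. | exact/value_atV/value_at_z | exact: value_at1].
exists 0, 0, 1; rewrite !mulr0 !mulr1.
by split; [exact: value_at0 ..| exact/value_at_zV_infty | exact: value_at1 ].
Qed.

Lemma gsection_zY : gsection (avoid [:: None]) zY.
Proof.
rewrite /zY /Ysec scale_lower mulfV ?zvar_neq0 //.
apply: gsection_mat; rewrite ?oppr0 // => -[a|] //= _.
exists 0, 0, 1; rewrite !mulr0 !mulr1.
by split; [exact: value_at0.. | exact: value_at1 | exact: value_at_z ].
Qed.

Definition Gm : zopen R := avoid [:: None; Some 0].

Lemma Gm_A1 : zsub Gm (avoid [:: None]).
Proof. by move=> p /=; rewrite !inE negb_or => /andP[]. Qed.

Lemma Gm_A1' : zsub Gm (avoid [:: Some 0]).
Proof. by move=> p /=; rewrite !inE negb_or => /andP[]. Qed.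

Lemma gsection_Xm : gsection Gm (Xsec R).
Proof. exact: gsection_sub Gm_A1 gsection_X. Qed.
Lemma gsection_Ym : gsection Gm (Ysec R).
Proof. exact: gsection_sub Gm_A1' gsection_Y. Qed.

(** The second matrix already contains the coefficients of H, X and Y. At points with z finite and
    nonzero it determines the first one through the ratio z, and identities of rational functions
    may be checked at such points alone. *)
Lemma gsection_decomp U A : gsection U A ->
  [/\ regular_on U (A.1 ord0 ord0), regular_on U (A.2 ord0 ord_max),
      regular_on U (A.2 ord_max ord0) &
      A = A.1 ord0 ord0 *: Hsec R +
          (A.2 ord0 ord_max *: Xsec R + A.2 ord_max ord0 *: Ysec R)].
Proof.
move=> gA.
split.
- by move=> p /gA[B [_ B1 _]]; eexists; exact: B1.
- by move=> p /gA[B [_ _ B2]]; eexists; exact: B2.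
- by move=> p /gA[B [_ _ B2]]; eexists; exact: B2.
have W (p : pt R) : interz U Gm p -> exists x a b c, [/\ p = Some x, x != 0 &
   [/\ forall i j, value_at (A.1 i j) p (mat2 a (x * b) c (- a) i j) &
   forall i j, value_at (A.2 i j) p (mat2 a b (x * c) (- a) i j)]].
  case=> /gA [B [[a [b [c ->]]] /= B1 B2]]; case: p B1 B2 => [x|] //= B1 B2.
  move=> x0; exists x, a, b, c; split=> //.
    by apply/eqP => xE; rewrite xE !inE eqxx in x0.
  by move: B1 B2; rewrite !mul1r.
case: A {gA} W => M N W; rewrite /fst /snd /Hsec /Xsec /Ysec.
have go f g : (forall x a b c, x != 0 -> let p := Some x in
   (forall i j, value_at (M i j) p (mat2 a (x * b) c (- a) i j)) ->
   (forall i j, value_at (N i j) p (mat2 a b (x * c) (- a) i j)) ->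
   exists2 v, value_at f p v & value_at g p v) -> f = g.
  move=> H; apply: (@ratfun_ext (interz U Gm)) => p /W[x [a [b [c [-> x0 [B1 B2]]]]]].
  exact: H x0 B1 B2.
rewrite section_algebra; congr (_, _); apply: mat2_inj; rewrite ?mat2E //; apply: go => x a b c x0 p;
  (move=> /[dup] /[dup] /[dup] /(_ ord0 ord0) + /(_ ord0 ord_max) +
     /(_ ord_max ord0) + /(_ ord_max ord_max));
  rewrite !mat2E => M1 M2 M3 M4;
  (move=> /[dup] /[dup] /[dup] /(_ ord0 ord0) + /(_ ord0 ord_max) +
     /(_ ord_max ord0) + /(_ ord_max ord_max));
  rewrite !mat2E => N1 N2 N3 N4.
- exists (x * b) => //; rewrite (mulrC x); apply: value_atM => //; exact: value_at_z.
- exists c => //; rewrite -[c](mulKf x0) (mulrC x^-1); apply: value_atM => //.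
  exact/value_atV/value_at_z.
- by exists (- a) => //; apply: value_atN.
- by exists a.
- by exists (- a) => //; apply: value_atN.
Qed.

Lemma bracket_XY : bracket (Xsec R) (Ysec R) = Hsec R.
Proof.
rewrite /bracket /fst /snd mat2_bracket; last by rewrite mulfV ?zvar_neq0.
by rewrite mat2_bracket // mulr1.
Qed.

Lemma Ad_X (a : Cplx R) : 
  Ad a (Xsec R) = ((a ^ 2)%:P%:F : ratfun R) *: Xsec R.
Proof.
rewrite -[a ^ 2]/(a * a) polyCM tofracM -(conj_upper _ (a^-1)%:P%:F).
by rewrite /Ad /hdiag invrK.
Qed.

Lemma Ad_Y (a : Cplx R) : 
  Ad a (Ysec R) = ((a ^ (- 2))%:P%:F : ratfun R) *: Ysec R.
Proof.
have -> : a ^ (- 2) = a^-1 * a^-1 by rewrite -invfM.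
rewrite polyCM tofracM -(conj_lower a%:P%:F).
by rewrite /Ad /hdiag invrK.
Qed.

End FamilySections.

(** * Operators on the generic stalk *)

Lemma scale_comb_up (S : nzRingType) (M : lmodType S) (f : S) (x y z : M) :
  0 *: x + (f *: y + 0 *: z) = f *: y.
Proof. by rewrite !scale0r add0r addr0. Qed.

Lemma scale_comb_low (S : nzRingType) (M : lmodType S) (f : S) (x y z : M) :
  0 *: x + (0 *: y + f *: z) = f *: z.
Proof. by rewrite !scale0r !add0r. Qed.

Section Operators.
Variables (R : realType) (F : gKmodule R).
Implicit Types (U V W : zopen R) (A B : mpair (ratfun R)) (a b : Cplx R)
  (x y : stalk F) (f : ratfun R) (n : int).

Definition ct a : ratfun R := a%:P%:F.

Lemma rfval_cst U a : rfval (cst U a) = ct a. Proof. by []. Qed.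

Fact kop_ex a : exists phi : stalk F -> stalk F, a != 0 ->
  linear phi /\ forall U (m : F U), phi (germ m) = germ (gk_kact a m).
Proof.
(* The axioms say nothing about a = 0; the identity is a placeholder that makes [kop] total. *)
have [a0|a0] := boolP (a != 0); last by exists id.
have [||phi [phiL phiE]] := @stalk_operator R F (avoid [::])
    (fun U (m : F U) => gk_kact a m).
- by move=> U _ f m n; apply: gk_kact_linear.
- by move=> U W h m _; apply: gk_kact_res.
- by exists phi => _; split=> // U m; apply: phiE => p.
Qed.

Definition kop a := sval (cid (kop_ex a)).

Lemma kop_linear a : a != 0 -> linear (kop a).
Proof. by move=> a0; rewrite /kop; case: cid => phi /= /(_ a0)[]. Qed.

Lemma kop_germ a U (m : F U) : a != 0 -> kop a (germ m) = germ (gk_kact a m).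
Proof. by move=> a0; rewrite /kop; case: cid => phi /= /(_ a0)[]. Qed.

(** [Gm] is the common domain of H, X and Y. An operator defined over its open subsets extends to
    all germs. *)
Fact gop_ex A : exists phi : stalk F -> stalk F, gsection (Gm R) A ->
  linear phi /\
  forall U (m : F U), zsub U (Gm R) -> phi (germ m) = germ (gk_act A m).
Proof.
have [gA|] := pselect (gsection (Gm R) A); last by exists id.
have [||phi [phiL phiE]] := @stalk_operator R F (Gm R)
    (fun U (m : F U) => gk_act A m).
- by move=> U h f m n; apply: gk_act_linear_r; apply: gsection_sub gA.
- by move=> U W h m hU; apply: gk_act_res; apply: gsection_sub gA.
- by exists phi => _.
Qed.

Definition gop A := sval (cid (gop_ex A)).

Lemma gop_linear A : gsection (Gm R) A -> linear (gop A).
Proof. by move=> gA; rewrite /gop; case: cid => phi /= /(_ gA)[]. Qed.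

Lemma gop_germ A U (m : F U) : gsection (Gm R) A -> zsub U (Gm R) ->
  gop A (germ m) = germ (gk_act A m).
Proof. by move=> gA; rewrite /gop; case: cid => phi /= /(_ gA)[_]; apply. Qed.

Definition Hop := gop (Hsec R).
Definition Xop := gop (Xsec R).
Definition Yop := gop (Ysec R).

HB.instance Definition _ := GRing.isLinear.Build _ _ _ _ Hop (gop_linear (@gsection_H R (Gm R))).
HB.instance Definition _ := GRing.isLinear.Build _ _ _ _ Xop (gop_linear (@gsection_Xm R)).
HB.instance Definition _ := GRing.isLinear.Build _ _ _ _ Yop (gop_linear (@gsection_Ym R)).

Lemma gk_actZ U A (f : regfun U) (m : F U) : gsection U A ->
  gk_act (rfval f *: A) m = f *: gk_act A m.
Proof.
(* The axiom treats only combinations f A + B, so the action of 0 is computed first, from -A + A. *)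
move=> gA; have E0 : rfval (-1 : regfun U) *: A + A = 0.
  by rewrite -[rfval _]/(-1) scaleN1r addNr.
have : gk_act (0 : mpair (ratfun R)) m = 0.
  by rewrite -E0 gk_act_linear_l // scaleN1r addNr.
rewrite -[_ *: A]addr0 gk_act_linear_l //; last exact: gsection0 gA.
by move=> ->; rewrite addr0.
Qed.

(** X and Y need not be sections over [U], but they are after removing 0 and infinity, and the germ
    does not change. Compatibility with the whole family thus reduces to H, X and Y. *)
Lemma germ_act U A (m : F U) : gsection U A ->
  germ (gk_act A m) = A.1 ord0 ord0 *: Hop (germ m) +
    (A.2 ord0 ord_max *: Xop (germ m) + A.2 ord_max ord0 *: Yop (germ m)).
Proof.
move=> gA; have [rh rx ry AE] := gsection_decomp gA.
pose W := interz U (Gm R).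
have hU : zsub W U := interl; have hG : zsub W (Gm R) := interr.
rewrite -(germ_res hU) gk_act_res // -(germ_res hU m).
set n := om_res hU m.
have toW f : regular_on U f -> regular_on W f by move=> fU p /hU/fU.
set h := A.1 ord0 ord0 in rh AE *; set x := A.2 ord0 ord_max in rx AE *.
set y := A.2 ord_max ord0 in ry AE *.
have gX := gsection_sub hG (@gsection_Xm R); have gY := gsection_sub hG (@gsection_Ym R).
have gyY := gsectionZ (toW _ ry) gY.
have gxX := gsection_comb (toW _ rx) gX gyY.
rewrite AE -[h]/(rfval (mkreg (toW _ rh))).
rewrite (gk_act_linear_l _ _ (@gsection_H R W) gxX) germD germZ.
rewrite /Hop (gop_germ _ (@gsection_H R _) hG); congr (_ + _).
rewrite -[x]/(rfval (mkreg (toW _ rx))) (gk_act_linear_l _ _ gX gyY) germD germZ.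
rewrite /Xop (gop_germ _ (@gsection_Xm R) hG); congr (_ + _).
rewrite -[y]/(rfval (mkreg (toW _ ry))) (gk_actZ _ _ gY) germZ.
by rewrite /Yop (gop_germ _ (@gsection_Ym R) hG).
Qed.

Lemma Gam_X U x : Gam U x -> ~ U None -> Gam U (Xop x).
Proof.
move=> [m <-] Un; have h : zsub U (avoid [:: None]).
  by move=> p Up /=; rewrite inE; apply/eqP => pE; apply: Un; rewrite -pE.
exists (gk_act (Xsec R) m); rewrite germ_act; last exact: gsection_sub h (@gsection_X R).
by rewrite /Xsec /fst /snd !mat2E scale_comb_up scale1r.
Qed.

Lemma Gam_Y U x : Gam U x -> ~ U (Some 0) -> Gam U (Yop x).
Proof.
move=> [m <-] Un; have h : zsub U (avoid [:: Some 0]).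
  by move=> p Up /=; rewrite inE; apply/eqP => pE; apply: Un; rewrite -pE.
exists (gk_act (Ysec R) m); rewrite germ_act; last exact: gsection_sub h (@gsection_Y R).
by rewrite /Ysec /fst /snd !mat2E scale_comb_low scale1r.
Qed.

Lemma Gam_zX U x : Gam U x -> ~ U (Some 0) -> Gam U ((zvar R)^-1 *: Xop x).
Proof.
move=> [m <-] Un; have h : zsub U (avoid [:: Some 0]).
  by move=> p Up /=; rewrite inE; apply/eqP => pE; apply: Un; rewrite -pE.
exists (gk_act (zX R) m); rewrite germ_act; last exact: gsection_sub h (@gsection_zX R).
by rewrite /zX /Xsec scale_upper /fst /snd !mat2E scale_comb_up.
Qed.

Lemma Gam_zY U x : Gam U x -> ~ U None -> Gam U (zvar R *: Yop x).
Proof.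
move=> [m <-] Un; have h : zsub U (avoid [:: None]).
  by move=> p Up /=; rewrite inE; apply/eqP => pE; apply: Un; rewrite -pE.
exists (gk_act (zY R) m); rewrite germ_act; last exact: gsection_sub h (@gsection_zY R).
by rewrite /zY /Ysec scale_lower /fst /snd !mat2E scale_comb_low.
Qed.

Lemma Xop_germ U (m : F U) : zsub U (Gm R) ->
  Xop (germ m) = germ (gk_act (Xsec R) m).
Proof. exact: gop_germ (@gsection_Xm R). Qed.

Lemma Yop_germ U (m : F U) : zsub U (Gm R) ->
  Yop (germ m) = germ (gk_act (Ysec R) m).
Proof. exact: gop_germ (@gsection_Ym R). Qed.

Lemma Hop_germ U (m : F U) : zsub U (Gm R) ->
  Hop (germ m) = germ (gk_act (Hsec R) m).
Proof. exact: gop_germ (@gsection_H R _). Qed.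

Lemma XY_comm x : Xop (Yop x) - Yop (Xop x) = Hop x.
Proof.
have [U [h [m ->]]] := germ_shrink (Gm R) x.
have gX := gsection_sub h (@gsection_Xm R); have gY := gsection_sub h (@gsection_Ym R).
have := gk_act_bracket m gX gY; rewrite bracket_XY => /(congr1 (@germ _ _ _)).
rewrite -(Hop_germ m h) germD germN => ->.
by rewrite (Yop_germ m h) (Xop_germ m h) (Xop_germ _ h) (Yop_germ _ h).
Qed.

Lemma kop_gop a A c x : a != 0 -> gsection (Gm R) A -> Ad a A = ct c *: A ->
  kop a (gop A x) = ct c *: gop A (kop a x).
Proof.
move=> a0 gA AdA; have [U [h [m ->]]] := germ_shrink (Gm R) x.
have gU := gsection_sub h gA.
rewrite (gop_germ _ gA h) !kop_germ // gk_equivariant // AdA.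
by rewrite -(rfval_cst U) (gk_actZ _ _ gU) germZ (gop_germ _ gA h).
Qed.

Lemma kop_X a x : a != 0 -> kop a (Xop x) = ct (a ^ 2) *: Xop (kop a x).
Proof. by move=> a0; apply: kop_gop (Ad_X a) => //; exact: gsection_Xm. Qed.

Lemma kop_Y a x : a != 0 -> kop a (Yop x) = ct (a ^ (- 2)) *: Yop (kop a x).
Proof. by move=> a0; apply: kop_gop (Ad_Y a) => //; exact: gsection_Ym. Qed.

Definition wt n x := forall a, a != 0 -> kop a x = ct (a ^ n) *: x.

Lemma wt_germ n U (m : F U) : wt n (germ m) <-> weight_vector n m.
Proof.
split=> H a a0; last by rewrite kop_germ // H // germZ.
by apply: germ_inj; rewrite -kop_germ // H // germZ.
Qed.

Lemma ctM a b : ct (a * b) = ct a * ct b.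
Proof. by rewrite /ct polyCM tofracM. Qed.

Lemma ct_int n : ct n%:~R = n%:~R.
Proof. by rewrite /ct !rmorph_int. Qed.

Lemma wt0 n : wt n 0.
Proof.
move=> a a0; have := kop_linear a0 (-1) 0 0.
by rewrite !scaler0 addr0 scaleN1r addNr.
Qed.

Lemma wt_lin n f x y : wt n x -> wt n y -> wt n (f *: x + y).
Proof.
by move=> wx wy a a0; rewrite kop_linear // wx // wy // scalerDr !scalerA mulrC.
Qed.

Lemma wtZ n f x : wt n x -> wt n (f *: x).
Proof. by move=> wx; rewrite -[_ *: x]addr0; apply: wt_lin wx (wt0 n). Qed.

Lemma wt_X n x : wt n x -> wt (n + 2) (Xop x).
Proof.
move=> wx a a0; rewrite kop_X // wx // linearZ /= scalerA -ctM.
by rewrite -expfzDr // addrC.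
Qed.

Lemma wt_Y n x : wt n x -> wt (n - 2) (Yop x).
Proof.
move=> wx a a0; rewrite kop_Y // wx // linearZ /= scalerA -ctM.
by rewrite -expfzDr // addrC.
Qed.

Lemma wt_H n x : wt n x -> Hop x = n%:~R *: x.
Proof.
have [U [h [m ->]]] := germ_shrink (Gm R) x => /wt_germ wm.
(* The orbit map of a weight vector is the single monomial a^n, whose derivative at 1 is n. *)
have oe : orbit_expansion (@gk_kact _ F U) m [:: n] (fun=> m).
  by move=> a a0; rewrite big_seq1; apply: wm.
rewrite (Hop_germ _ h).
rewrite (gk_differential oe) big_seq1.
rewrite -scaler_int germZ; congr (_ *: _).
exact: (rmorph_int (val : {rmorphism regfun U -> ratfun R}) n).
Qed.

End Operators.

(** * The weight decomposition *)

(** Dedekind's argument with one separating element: subtracting chi_m(g0) times the relation at g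
    from the relation at g0 g eliminates the term of index m and multiplies the others by nonzero
    factors. *)
Lemma characters_indep (S : fieldType) (M : lmodType S) (G : Type)
    (P : G -> Prop) (mul : G -> G -> G) (g0 e : G) (chi : int -> G -> S) :
  (forall g, P g -> P (mul g0 g)) -> P e -> (forall n, chi n e = 1) ->
  (forall n g, chi n (mul g0 g) = chi n g0 * chi n g) ->
  (forall n m, chi n g0 = chi m g0 -> n = m) ->
  forall (s : seq int) (c : int -> M), uniq s ->
  (forall g, P g -> \sum_(n <- s) chi n g *: c n = 0) ->
  forall n, n \in s -> c n = 0.
Proof.
move=> PM Pe chi1 chiM chi_inj; elim=> // m s IH c /= /andP[ms us] H.
have cs n : n \in s -> c n = 0.
  move=> ns; pose d n := (chi n g0 - chi m g0) *: c n.
  have dn : d n = 0.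
    apply: (IH d us) => // g Pg.
    have E1 := H _ (PM _ Pg); have E2 := H _ Pg.
    rewrite !big_cons in E1 E2.
    transitivity ((chi m (mul g0 g) *: c m + \sum_(j <- s) chi j (mul g0 g) *: c j)
        - chi m g0 *: (chi m g *: c m + \sum_(j <- s) chi j g *: c j)).
      rewrite scalerDr scaler_sumr scalerA -chiM opprD addrACA subrr add0r.
      rewrite -sumrB; apply: eq_bigr => i _.
      by rewrite /d chiM !scalerA mulrBr scalerBl ![chi i g * _]mulrC.
    by rewrite E1 E2 scaler0 subr0.
  have /eqP := dn; rewrite scaler_eq0 => /orP[|/eqP //].
  by rewrite subr_eq0 => /eqP/chi_inj nm; rewrite nm (negbTE ms) in ns.
move=> n; rewrite inE => /orP[/eqP ->|/cs //].
have := H e Pe; rewrite big_cons chi1 scale1r big_seq big1 ?addr0 //.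
by move=> i /cs ->; rewrite scaler0.
Qed.

Lemma big_pred1_uniq (M : nmodType) (I : eqType) (t : seq I) (i : I)
    (h : I -> M) : uniq t -> i \in t -> \sum_(n <- t | n == i) h n = h i.
Proof.
move=> ut it; rewrite big_mkcond (bigD1_seq i) //= eqxx big1 ?addr0 //.
by move=> j /negbTE ->.
Qed.

Section Weights.
Variables (R : realType) (F : gKmodule R).
Implicit Types (U V W : zopen R) (a b : Cplx R)
  (x y : stalk F) (f : ratfun R) (n : int) (c : int -> stalk F) (s : seq int).

Lemma ct_inj : injective (@ct R).
Proof. by move=> a b /eqP; rewrite tofrac_eq => /eqP/polyC_inj. Qed.

Lemma ct1 : ct 1 = 1 :> ratfun R.
Proof. by rewrite /ct polyC1 tofrac1. Qed.

Lemma two_neq0 : (2%:R : Cplx R) != 0.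
Proof. by have := eqr_nat R[i] 2 0 => ->. Qed.

(** The number 2 separates the characters a^n because it is not a root of unity: a positive power of
    2 is even. *)
Lemma two_exp_inj n m : (2%:R : Cplx R) ^ n = 2%:R ^ m -> n = m.
Proof.
have key (k : nat) : (2%:R : Cplx R) ^ k = 1 -> k = 0%N.
  move=> /eqP; rewrite -exprnP -natrX -[1]/(1%:R) => E.
  have := eqr_nat R[i] (2 ^ k) 1; rewrite [LHS]E => /esym.
  by case: k {E} => // k /eqP/(congr1 odd); rewrite expnS oddM.
move=> E; have {E} : (2%:R : Cplx R) ^ (n - m) = 1.
  by rewrite expfzDr ?two_neq0 // E -expfzDr ?two_neq0 // subrr expr0z.
move=> E; apply/eqP; rewrite -subr_eq0; case: (n - m) E => k E.
  by rewrite (key k E).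
move: E; rewrite NegzE -invr_expz => /eqP; rewrite invr_eq1 => /eqP/key.
by [].
Qed.

Lemma laurent_indep s c : uniq s ->
  (forall a, a != 0 -> \sum_(n <- s) ct (a ^ n) *: c n = 0) ->
  forall n, n \in s -> c n = 0.
Proof.
apply: (@characters_indep _ _ _ (fun a => a != 0) *%R 2%:R 1 (fun n a => ct (a ^ n))).
- by move=> a; apply: mulf_neq0; apply: two_neq0.
- exact: oner_neq0.
- by move=> n; rewrite exp1rz ct1.
- by move=> n a; rewrite expfzMl ctM.
- by move=> n m /ct_inj/two_exp_inj.
Qed.

(** Components are indexed by all integers, with finite support, so that uniqueness is an equality
    of functions. *)
Definition is_decomp x c := (forall n, wt n (c n)) /\
  exists s, [/\ uniq s, forall n, n \notin s -> c n = 0 & x = \sum_(n <- s) c n].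

Lemma sum_widen (M : zmodType) (h : int -> M) s t : uniq s -> uniq t ->
  {subset s <= t} -> (forall n, n \notin s -> h n = 0) ->
  \sum_(n <- s) h n = \sum_(n <- t) h n.
Proof.
move=> us ut st h0; rewrite [RHS](bigID (mem s)) /= [X in _ + X]big1 ?addr0 //.
rewrite -[RHS]big_filter; apply: perm_big; apply: uniq_perm => //; first exact: filter_uniq.
by move=> n; rewrite mem_filter; case ns : (n \in s) => //=; rewrite (st _ ns).
Qed.

Lemma is_decomp_lin f x y c c' : is_decomp x c -> is_decomp y c' ->
  is_decomp (f *: x + y) (fun n => f *: c n + c' n).
Proof.
move=> [wc [s [us sc ->]]] [wc' [s' [us' sc' ->]]]; split=> [n|].
  exact: wt_lin.
have ut : uniq (undup (s ++ s')) by exact: undup_uniq.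
exists (undup (s ++ s')); split=> // [n|].
  by rewrite mem_undup mem_cat negb_or => /andP[/sc -> /sc' ->]; rewrite scaler0 addr0.
rewrite (sum_widen us ut _ sc) => [|n ns]; last by rewrite mem_undup mem_cat ns.
rewrite (sum_widen us' ut _ sc') => [|n ns]; last by rewrite mem_undup mem_cat ns orbT.
by rewrite scaler_sumr -big_split.
Qed.

Lemma kop_sum a s c : a != 0 ->
  kop a (\sum_(n <- s) c n) = \sum_(n <- s) kop a (c n).
Proof.
move=> a0; apply: (big_morph (kop a)) => [x y|].
  by have := kop_linear a0 1 x y; rewrite !scale1r.
by have := wt0 F 0 a0; rewrite scaler0.
Qed.

Lemma is_decomp0 c : is_decomp 0 c -> forall n, c n = 0.
Proof.
move=> [wc [s [us sc E]]] n; have [ns|/sc //] := boolP (n \in s).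
apply: (laurent_indep us) ns => a a0.
transitivity (kop a (\sum_(n <- s) c n)).
  by rewrite kop_sum //; apply: eq_bigr => i _; rewrite wc.
by rewrite -E (wt0 F 0 a0) scaler0.
Qed.

Lemma is_decomp_uniq x c c' : is_decomp x c -> is_decomp x c' -> c = c'.
Proof.
move=> xc xc'; have := is_decomp_lin (-1) xc xc'.
rewrite scaleN1r addNr => /is_decomp0 E; apply/funext => n; apply/eqP.
by have /eqP := E n; rewrite scaleN1r addrC subr_eq0 => /eqP ->.
Qed.

Lemma is_decomp_wt n x : wt n x ->
  is_decomp x (fun m => if m == n then x else 0).
Proof.
move=> wx; split=> [m|]; first by case: eqP => [->|_] //; apply: wt0.
exists [:: n]; split=> // [m|]; first by rewrite inE => /negbTE ->.
by rewrite big_seq1 eqxx.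
Qed.

Lemma is_decomp_shift (T : stalk F -> stalk F) (k : int) x c : linear T ->
  (forall n y, wt n y -> wt (n + k) (T y)) ->
  is_decomp x c -> is_decomp (T x) (fun n => T (c (n - k))).
Proof.
move=> TL Tw [wc [s [us sc ->]]].
have T0 : T 0 = 0 by have := TL (-1) 0 0; rewrite scaler0 addr0 scaleN1r addNr.
have TD y z : T (y + z) = T y + T z by have := TL 1 y z; rewrite !scale1r.
split=> [n|]; first by rewrite -[X in wt X](subrK k); apply: Tw.
exists [seq n + k | n <- s]; split.
- by rewrite map_inj_uniq //; apply: addIr.
- move=> n ns; rewrite sc // ; apply: contra ns => ns.
  by apply/mapP; exists (n - k) => //; rewrite subrK.
- by rewrite big_map (big_morph T TD T0); apply: eq_bigr => i _; rewrite addrK.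
Qed.

(* Comparing the two expansions of k_(ab) m shows that the coefficient of a^n
   in the orbit map is itself a weight vector. *)
Lemma section_decomp U (m : F U) : exists (c : int -> F U) s,
  [/\ uniq s, forall n, weight_vector n (c n), forall n, n \notin s -> c n = 0 &
      m = \sum_(n <- s) c n].
Proof.
have [s [c oe]] := gk_kact_algebraic m.
pose d n := \sum_(i <- s | i == n) c i.
have ut := undup_uniq s; set t := undup s in ut.
have dt n : n \notin t -> d n = 0.
  rewrite mem_undup /d => ns; rewrite big_seq_cond big1 // => i /andP[is_ /eqP E].
  by rewrite -E is_ in ns.
have dE a : a != 0 -> gk_kact a m = \sum_(n <- t) cst U (a ^ n) *: d n.
  move=> /oe ->; transitivity (\sum_(i <- s) \sum_(n <- t | n == i) cst U (a ^ n) *: c i).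
    rewrite big_seq [RHS]big_seq; apply: eq_bigr => i is_.
    by rewrite (big_pred1_uniq (fun n => cst U (a ^ n) *: c i)) // mem_undup.
  rewrite (exchange_big_dep xpredT) //=; apply: eq_bigr => n _.
  by rewrite scaler_sumr; apply: eq_big => // i; rewrite eq_sym.
exists d, t; split=> //; last first.
  rewrite -[LHS]gk_kact1 dE ?oner_neq0 //; apply: eq_bigr => n _.
  by rewrite exp1rz -[RHS]scale1r; congr (_ *: _); apply: regfun_inj.
move=> n; have [nt|/dt ->] := boolP (n \in t); last first.
  by apply/wt_germ; rewrite germ0; apply: wt0.
apply/wt_germ => b b0.
apply/eqP; rewrite -subr_eq0; apply/eqP.
pose h n := kop b (germ (d n)) - ct (b ^ n) *: germ (d n).
apply: (laurent_indep (c := h) ut _ nt) => a a0.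
have E1 : germ (gk_kact (b * a) m) = \sum_(i <- t) ct (a ^ i) *: kop b (germ (d i)).
  rewrite gk_kactM // -kop_germ // dE // germ_sum kop_sum //.
  apply: eq_bigr => i _; rewrite germZ rfval_cst -[_ *: germ _]addr0 kop_linear //.
  by rewrite (wt0 F 0 b0) scaler0 addr0.
have E2 : germ (gk_kact (b * a) m) = \sum_(i <- t) ct (a ^ i) *: (ct (b ^ i) *: germ (d i)).
  rewrite dE ?mulf_neq0 // germ_sum; apply: eq_bigr => i _.
  by rewrite scalerA -ctM -expfzMl [a * b]mulrC germZ.
have E3 := E1; rewrite E2 in E3; apply/eqP.
have -> : \sum_(i <- t) ct (a ^ i) *: h i =
    \sum_(i <- t) ct (a ^ i) *: kop b (germ (d i)) -
    \sum_(i <- t) ct (a ^ i) *: (ct (b ^ i) *: germ (d i)).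
  rewrite -sumrB; apply: eq_bigr => i _; exact: scalerBr.
by rewrite -E3 subrr.
Qed.

(** A decomposition exists over each [U] on which [x] is a section; uniqueness in the stalk
    identifies them all, so one choice of components works for every [U]. *)
Lemma decomp_ex x : exists c, is_decomp x c /\
  forall U, Gam U x -> forall n, Gam U (c n).
Proof.
have D U (m : F U) : exists c, is_decomp (germ m) c /\ forall n, Gam U (c n).
  have [c [s [us wc sc ->]]] := section_decomp m.
  exists (fun n => germ (c n)); split=> [|n]; last by exists (c n).
  split=> [n|]; first exact/wt_germ.
  by exists s; split=> // [n /sc ->|]; rewrite ?germ0 // germ_sum.
have [U [m ->]] := germ_surj x; have [c [dc _]] := D U m.
exists c; split=> // V [m' E]; have [c' [dc' gc']] := D V m'.
by rewrite E in dc'; rewrite (is_decomp_uniq dc dc').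
Qed.

Definition wcomp x : int -> stalk F := sval (cid (decomp_ex x)).

Lemma wcompP x : is_decomp x (wcomp x).
Proof. by rewrite /wcomp; case: cid => c []. Qed.

Lemma Gam_wcomp U x n : Gam U x -> Gam U (wcomp x n).
Proof. by rewrite /wcomp; case: cid => c [] /= _ /[apply]. Qed.

Lemma wcomp_eq x c : is_decomp x c -> wcomp x = c.
Proof. exact: is_decomp_uniq (wcompP x). Qed.

Lemma wt_wcomp x n : wt n (wcomp x n).
Proof. by have [] := wcompP x. Qed.

Lemma wcomp_supp x : exists s, [/\ uniq s, forall n, n \notin s -> wcomp x n = 0 &
  x = \sum_(n <- s) wcomp x n].
Proof. by have [] := wcompP x. Qed.

Lemma wcomp_linear n : linear (wcomp^~ n).
Proof.
by move=> f x y; rewrite (wcomp_eq (is_decomp_lin f (wcompP x) (wcompP y))).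
Qed.

Lemma wcomp_wt n m x : wt n x -> wcomp x m = if m == n then x else 0.
Proof. by move=> /is_decomp_wt/wcomp_eq ->. Qed.

Lemma wcomp_X x n : wcomp (Xop x) n = Xop (wcomp x (n - 2)).
Proof.
by rewrite (wcomp_eq (is_decomp_shift (linearP (@Xop R F)) (@wt_X R F) (wcompP x))).
Qed.

Lemma wcomp_Y x n : wcomp (Yop x) n = Yop (wcomp x (n + 2)).
Proof.
rewrite (wcomp_eq (is_decomp_shift (linearP (@Yop R F)) (@wt_Y R F) (wcompP x))).
by rewrite opprK.
Qed.

Lemma wcomp_H x n : wcomp (Hop x) n = n%:~R *: wcomp x n.
Proof.
have HW m y : wt m y -> wt (m + 0) (Hop y).
  by move=> wy; rewrite addr0 (wt_H wy); apply: wtZ.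
have -> : wcomp (Hop x) n = Hop (wcomp x (n - 0)).
  by rewrite (wcomp_eq (is_decomp_shift (linearP (@Hop R F)) HW (wcompP x))).
by rewrite subr0; apply/wt_H/wt_wcomp.
Qed.

Lemma wcomp_ext x y : (forall n, wcomp x n = wcomp y n) -> x = y.
Proof.
move=> E; apply/eqP; rewrite -subr_eq0; apply/eqP.
have [s [_ _ ->]] := wcomp_supp (x - y); apply: big1 => n _.
by have /= := wcomp_linear n (-1) y x; rewrite !scaleN1r [- y + x]addrC => ->; rewrite E addNr.
Qed.

End Weights.

(** * Subspaces and functionals in finite dimension *)

Section LinearAlgebra.
Variables (S : fieldType).

Lemma subspace_mx r (P : 'rV[S]_r -> Prop) : P 0 ->
  (forall a v w, P v -> P w -> P (a *: v + w)) ->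
  exists M : 'M[S]_r, forall v, P v <-> (v <= M)%MS.
Proof.
move=> P0 Plin.
(* A matrix of maximal rank with row space inside [P] must span [P], since adjoining a further
   vector of [P] would raise the rank. *)
pose good k := `[< exists M : 'M[S]_r, \rank M = k /\ forall v : 'rV_r, (v <= M)%MS -> P v >].
have ex_good : exists k, good k.
  exists 0%N; apply/asboolP; exists 0; split=> [|v]; first exact: mxrank0.
  by move=> /submx0null ->.
have good_le k : good k -> (k <= r)%N by move=> /asboolP[M [<- _]]; apply: rank_leq_row.
case: (ex_maxnP ex_good good_le) => k /asboolP[M [rM MP]] kmax.
exists M => v; split=> [Pv|]; last exact: MP.
have good' : good (\rank (M + v)%MS).
  apply/asboolP; exists (M + v)%MS; split=> // w /sub_addsmxP[[a b] /= ->].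
  have -> : b *m v = b 0 0 *: v by rewrite -mul_scalar_mx -mx11_scalar.
  by rewrite addrC; apply: Plin => //; apply: MP; apply: submxMl.
have := kmax _ good'; rewrite -rM => le_rank.
have /mxrank_leqif_sup [le1 eq1] := addsmxSl M v.
have : (\rank M == \rank (M + v)%MS) by rewrite eqn_leq le1 le_rank.
by rewrite eq1 addsmx_sub => /andP[].
Qed.

(** The functional is an entry of the coordinate vector times a cokernel matrix for [P]. The family
    [e] may be dependent: its relations are coordinates of 0, which lies in [P], so the cokernel
    kills them and the choice of coordinates is harmless. *)
Lemma separating_functional (E : lmodType S) r (e : 'I_r -> E) (P : E -> Prop) x :
  P 0 -> (forall a y z, P y -> P z -> P (a *: y + z)) ->
  let span y := exists c : 'rV[S]_r, y = \sum_i c 0 i *: e i in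
  span x -> ~ P x ->
  exists phi : E -> S, [/\
    forall a y z, span y -> span z -> phi (a *: y + z) = a * phi y + phi z,
    forall y, span y -> P y -> phi y = 0 & phi x != 0].
Proof.
move=> P0 Plin span sx nPx.
pose lc (c : 'rV[S]_r) := \sum_i c 0 i *: e i.
have lcL a c d : lc (a *: c + d) = a *: lc c + lc d.
  rewrite /lc scaler_sumr -big_split; apply: eq_bigr => i _ /=.
  by rewrite !mxE scalerDl scalerA.
have lc0 : lc 0 = 0 by rewrite /lc big1 // => i _; rewrite mxE scale0r.
have [M MP] := @subspace_mx r (fun c => P (lc c))
  (eq_rect_r P P0 lc0) (fun a v w Pv Pw => eq_rect_r P (Plin a _ _ Pv Pw) (lcL a v w)).
have [cx xE] := sx.
have : cx *m cokermx M != 0.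
  by apply/negP => /eqP cM; apply: nPx; rewrite xE; apply/MP; rewrite submxE cM.
move/rV0Pn => [j cj].
pose phi y := if pselect (span y) is left h then (sval (cid h) *m cokermx M) 0 j else 0.
have phiE c : phi (lc c) = (c *m cokermx M) 0 j.
  rewrite /phi; case: pselect => [h|[]]; last by exists c.
  case: cid => d /= dE; have {}dE : lc c = lc d := dE.
  have : (d - c <= M)%MS.
    by apply/MP; rewrite addrC -scaleN1r lcL -dE scaleN1r addNr.
  by rewrite submxE mulmxBl subr_eq0 => /eqP ->.
exists phi; split.
- move=> a y z [c ->] [d ->]; rewrite -/(lc c) -/(lc d) -lcL !phiE.
  by rewrite mulmxDl -scalemxAl !mxE.
- move=> y [c ->] /MP; rewrite -/(lc c) phiE submxE => /eqP ->.
  by rewrite mxE.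
- by rewrite xE -/(lc cx) phiE.
Qed.

End LinearAlgebra.

Section Irreducible.
Variables (R : realType) (F : gKmodule R).
Implicit Types (U V W : zopen R) (x y : stalk F) (f : ratfun R) (n : int).

Lemma casimir_stalk (c : ratfun R) : casimir_acts_by F c -> forall x,
  Hop (Hop x) + Xop (Yop x) *+ 2 + Yop (Xop x) *+ 2 = c *: x.
Proof.
move=> cas x; have [U [h [m ->]]] := germ_shrink (interz (Gm R) (domz c)) x.
have hG := zsub_trans h interl.
have cU : regular_on U c := zsub_trans h interr.
pose aH : F U -> F U := gk_act (Hsec R); pose aX : F U -> F U := gk_act (Xsec R).
pose aY : F U -> F U := gk_act (Ysec R).
have E : aH (aH m) + aX (aY m) *+ 2 + aY (aX m) *+ 2 = mkreg cU *: m.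
  exact: cas U (mkreg cU) erefl (gsection_sub hG (@gsection_Xm R))
    (gsection_sub hG (@gsection_Ym R)) m.
have eH l : Hop (germ l) = germ (aH l) by exact: Hop_germ.
have eX l : Xop (germ l) = germ (aX l) by exact: Xop_germ.
have eY l : Yop (germ l) = germ (aY l) by exact: Yop_germ.
move: aH aX aY E eH eX eY => aH aX aY /(congr1 (@germ _ _ _)).
by rewrite germZ => E eH eX eY; rewrite !(eH, eX, eY) -E !mulr2n !germD.
Qed.

(** Replace XY by H + YX and solve for YX, which requires dividing by 4. The letters stand for the
    vectors obtained by applying the operators to [v], so this is plain linear algebra. *)
Lemma casimir_algebra (S : fieldType) (M : lmodType S) (c s : S) (h hh xy yx v : M) :
  (4%:R : S) != 0 -> h = s *: v -> hh = s *: h -> xy - yx = h ->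
  hh + xy *+ 2 + yx *+ 2 = c *: v ->
  yx = ((c - s * s - 2%:R * s) / 4%:R) *: v.
Proof.
move=> n4 hE hhE xyE E; apply: (scalerI n4); rewrite scalerA mulrC mulfVK //.
have xyE' : xy = h + yx by rewrite -xyE subrK.
have ssE : (s * s) *: v = hh by rewrite hhE hE scalerA.
have sE : (2%:R * s) *: v = h *+ 2 by rewrite hE -scalerA scaler_nat.
rewrite !scalerBl -E ssE sE xyE' mulrnDl scaler_nat.
rewrite -[hh + _ + _]addrA [hh + _]addrC addrK.
by rewrite -[h *+ 2 + _ + _]addrA [h *+ 2 + _]addrC addrK -mulrnDr.
Qed.

End Irreducible.

(** * Generic irreducibility *)

Lemma scale_comb_left (S : nzRingType) (M : lmodType S) (f : S) (x y z : M) :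
  f *: x + (0 *: y + 0 *: z) = f *: x.
Proof. by rewrite !scale0r !addr0. Qed.

Lemma big_ord3 (M : nmodType) (g : 'I_3 -> M) :
  \sum_i g i = g (@Ordinal 3 0 isT) + (g (@Ordinal 3 1 isT) + g (@Ordinal 3 2 isT)).
Proof.
rewrite !big_ord_recl big_ord0 addr0; congr (g _ + (g _ + g _)); exact: val_inj.
Qed.

Section GenericFibre.
Variables (R : realType) (k : closedFieldType) (emb : {rmorphism ratfun R -> k}).
Variable F : gKmodule R.
Implicit Types (U V W : zopen R) (x y : stalk F) (f : ratfun R) (n : int).

Lemma emb_pair_comb3 (a b c : ratfun R) (A B C : mpair (ratfun R)) :
  emb_pair emb (a *: A + (b *: B + c *: C)) =
  emb a *: emb_pair emb A + (emb b *: emb_pair emb B + emb c *: emb_pair emb C).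
Proof.
by congr (_, _); apply/matrixP => i j; rewrite !mxE !rmorphD !rmorphM.
Qed.

Local Notation eH := (emb_pair emb (Hsec R)).
Local Notation eX := (emb_pair emb (Xsec R)).
Local Notation eY := (emb_pair emb (Ysec R)).

Lemma generic_lie_comb (h x y : k) : generic_lie emb (h *: eH + (x *: eX + y *: eY)).
Proof.
exists (Gm R), 3, (fun i : 'I_3 => if i == 0%N :> nat then h else if i == 1%N :> nat then x else y),
  (fun i : 'I_3 => if i == 0%N :> nat then Hsec R else if i == 1%N :> nat then Xsec R else Ysec R).
split; last by rewrite big_ord3.
case=> [[|[|i]] ?] /=; [exact: gsection_H | exact: gsection_Xm | exact: gsection_Ym].
Qed.

(** Every section is a combination of H, X and Y over the function field, so the span over [k] has
    only these three generators. *)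
Lemma generic_lieP B : generic_lie emb B ->
  exists h x y : k, B = h *: eH + (x *: eX + y *: eY).
Proof.
move=> [U [r [c [A [gA ->]]]]].
pose h i := emb ((A i).1 ord0 ord0); pose x i := emb ((A i).2 ord0 ord_max).
pose y i := emb ((A i).2 ord_max ord0).
exists (\sum_i c i * h i), (\sum_i c i * x i), (\sum_i c i * y i).
rewrite !scaler_suml -!big_split; apply: eq_bigr => i _ /=.
have [_ _ _ AE] := gsection_decomp (gA i).
rewrite -!scalerA -!scalerDr; congr (_ *: _).
by rewrite {1}AE emb_pair_comb3.
Qed.

Lemma generic_lie0 : generic_lie emb 0.
Proof.
by have := generic_lie_comb 0 0 0; rewrite scale_comb_up (scale0r eX).
Qed.

Lemma generic_lieH : generic_lie emb eH.
Proof. by have := generic_lie_comb 1 0 0; rewrite scale_comb_left (scale1r eH). Qed.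
Lemma generic_lieX : generic_lie emb eX.
Proof. by have := generic_lie_comb 0 1 0; rewrite scale_comb_up (scale1r eX). Qed.
Lemma generic_lieY (y : k) : generic_lie emb (y *: eY).
Proof. by have := generic_lie_comb 0 0 y; rewrite scale_comb_low. Qed.
Lemma generic_lieXY (x y : k) : generic_lie emb (x *: eX + y *: eY).
Proof. by have := generic_lie_comb 0 x y; rewrite (scale0r eH) add0r. Qed.

(* W, the common kernel of the extensions to V of all functionals vanishing on
   S, is a submodule; psi witnesses that x is nonzero in V. *)
Theorem stalk_irreducible (S : stalk F -> Prop) (x : stalk F)
    (phi psi : stalk F -> (ratfun R)^o) :
  generically_irreducible emb F ->
  (forall y, S y -> S (Hop y)) -> (forall y, S y -> S (Xop y)) ->
  (forall y, S y -> S (Yop y)) -> S x -> linear psi -> psi x != 0 ->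
  linear phi -> (forall y, S y -> phi y = 0) -> forall y, phi y = 0.
Proof.
move=> [V [iota [rho [[iotaS univ] [rho_l rho_r rhoE] [_ irr]]]]] SH SX SY Sx psiL psix phiL phiS.
have [iotaD iotaZ iotaR] := iotaS.
have lift (chi : stalk F -> (ratfun R)^o) : linear chi ->
    exists l : {linear V -> k^o}, forall U (m : F U), l (iota U m) = emb (chi (germ m)).
  move=> chiL.
  have [|l [lE _]] := univ k^o (fun U m => emb (chi (germ m))); last by exists l.
  have chiD y z : chi (y + z) = chi y + chi z by have := chiL 1 y z; rewrite !scale1r.
  have chi0 : chi 0 = 0 by apply: (addrI (chi 0)); rewrite -chiD !addr0.
  have chiZ f y : chi (f *: y) = f * chi y by have := chiL f y 0; rewrite chi0 !addr0.
  split=> [U m n|U f m|U W h m].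
  - by rewrite germD chiD rmorphD.
  - by rewrite germZ chiZ rmorphM.
  - by rewrite germ_res.
pose W v := forall chi : stalk F -> (ratfun R)^o, linear chi ->
  (forall y, S y -> chi y = 0) -> forall l : {linear V -> k^o},
  (forall U (m : F U), l (iota U m) = emb (chi (germ m))) -> l v = 0.
have W0 : W 0 by move=> chi _ _ l _; rewrite linear0.
have Wlin a v w : W v -> W w -> W (a *: v + w).
  move=> Wv Ww chi chiL chiS l lE; rewrite linearP.
  by rewrite (Wv _ chiL chiS l lE) (Ww _ chiL chiS l lE) scaler0 addr0.
have Wop (A : mpair (ratfun R)) (T : {linear stalk F -> stalk F}) v :
    gsection (Gm R) A -> generic_lie emb (emb_pair emb A) ->
    (forall U (m : F U), zsub U (Gm R) -> T (germ m) = germ (gk_act A m)) ->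
    (forall y, S y -> S (T y)) -> W v -> W (rho (emb_pair emb A) v).
  move=> gA lA TE TS Wv chi chiL chiS l lE.
  have l'L : linear (fun v => l (rho (emb_pair emb A) v) : k^o).
    by move=> a u w; rewrite rho_r // linearP.
  pose l'l := GRing.isLinear.Build _ _ _ _ _ l'L.
  pose l' : {linear V -> k^o} := HB.pack (fun v => l (rho (emb_pair emb A) v) : k^o) l'l.
  have chi'L : linear (fun y => chi (T y)) by move=> a y z; rewrite linearP chiL.
  apply: (Wv (fun y => chi (T y)) chi'L _ l') => [y /TS/chiS //|U m] /=.
  rewrite -(iotaR _ _ (interl (V := Gm R))) rhoE; last exact: gsection_sub interr gA.
  by rewrite lE -TE ?germ_res //; apply: interr.
have [] := irr W W0 Wlin.
- move=> A v /generic_lieP[a [b [c ->]]] Wv.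
  rewrite rho_l; [|exact: generic_lieH|exact: generic_lieXY].
  have WH := Wop _ (@Hop R F) v (@gsection_H R _) generic_lieH (@Hop_germ R F) SH Wv.
  have WX := Wop _ (@Xop R F) v (@gsection_Xm R) generic_lieX (@Xop_germ R F) SX Wv.
  have lY : generic_lie emb eY by have := generic_lieY 1; rewrite (scale1r eY).
  have WY := Wop _ (@Yop R F) v (@gsection_Ym R) lY (@Yop_germ R F) SY Wv.
  apply: (Wlin) => //; rewrite rho_l; [|exact: generic_lieX|exact: generic_lieY].
  apply: (Wlin) => //; rewrite -[c *: eY]addr0 rho_l //; last exact: generic_lie0.
  apply: (Wlin) => //.
  have := rho_l (-1) eY eY v lY lY; rewrite (scaleN1r eY) (addNr eY) => ->.
  by rewrite scaleN1r addNr; exact: W0.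
- move=> Wz; exfalso; have [l lE] := lift _ psiL.
  have [U [m xE]] := germ_surj x.
  have : iota U m = 0.
    by apply: Wz => chi chiL chiS l' l'E; rewrite l'E -xE chiS // rmorph0.
  move=> /(congr1 l); rewrite lE linear0 -xE => /eqP; rewrite fmorph_eq0.
  by rewrite (negbTE psix).
- move=> WT y; have [l lE] := lift _ phiL; have [U [m ->]] := germ_surj y.
  have /eqP := WT (iota U m) _ phiL phiS l lE.
  by rewrite lE fmorph_eq0 => /eqP.
Qed.

End GenericFibre.

Section RankOne.
Variables (R : realType) (F : gKmodule R).
Hypothesis qa : quasi_admissible F.
Implicit Types (U V W : zopen R) (x y : stalk F) (f : ratfun R) (n : int).

Lemma weight_generators n U : affine U -> exists r (e : 'I_r -> stalk F),
  (forall i, wt n (e i) /\ Gam U (e i)) /\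
  forall y, wt n y -> Gam U y -> exists c : 'I_r -> ratfun R,
    (forall i, regular_on U (c i)) /\ y = \sum_i c i *: e i.
Proof.
move=> aU; have [r [e [we eP]]] := qa n aU.
exists r, (fun i => germ (e i)); split=> [i|y wy [m mE]].
  by split; [exact/wt_germ | exists (e i)].
have [c mc] : exists c : 'I_r -> regfun U, m = \sum_i c i *: e i.
  by apply: eP; apply/wt_germ; rewrite mE.
exists (fun i => rfval (c i)); split=> [i|]; first exact: regfunP.
by rewrite -mE mc germ_sum; apply: eq_bigr => i _; rewrite germZ.
Qed.

Lemma affine_avoid (p : pt R) : affine (avoid [:: p]).
Proof. by exists p; rewrite /= inE eqxx. Qed.

(** Coherence bounds only sections over an affine open set, but every germ becomes a section over
    the affine line after multiplication by a nonzero function. *)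
Lemma weight_span n : exists r (e : 'I_r -> stalk F),
  forall y, wt n y -> exists c : 'rV[ratfun R]_r, y = \sum_i c 0 i *: e i.
Proof.
have [r [e [we eP]]] := weight_generators n (affine_avoid None).
exists r, e => y wy.
have [V [hV gy]] := Gam_shrink (avoid [:: None]) y.
have [f [_ fu gfy]] := Gam_qc (affine_avoid None) hV gy.
have [p Vp] := zopen_nonempty V; have f0 := unit_at_neq0 (fu p Vp).
have [c [_ cE]] := eP _ (wtZ f wy) gfy.
exists (\row_i (f^-1 * c i)); apply: (scalerI f0).
rewrite cE scaler_sumr; apply: eq_bigr => i _.
by rewrite mxE scalerA mulrA mulfV // mul1r.
Qed.

(** A functional on the weight space is extended to the stalk by composing it with the projection,
    so that it sees only the component of weight n. *)
Lemma weight_functional n (P : stalk F -> Prop) x : P 0 ->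
  (forall a y z, P y -> P z -> P (a *: y + z)) -> wt n x -> ~ P x ->
  exists phi : stalk F -> (ratfun R)^o, [/\ linear phi,
    forall y, P (wcomp y n) -> phi y = 0 & phi x != 0].
Proof.
move=> P0 Plin wx nPx; have [r [e eP]] := weight_span n.
have [phi [p1 p2 p3]] := separating_functional P0 Plin (eP _ wx) nPx.
exists (fun y => phi (wcomp y n)); split=> [a y z|y Py|].
- by rewrite wcomp_linear p1 //; apply/eP/wt_wcomp.
- by apply: p2 => //; apply/eP/wt_wcomp.
- by rewrite (wcomp_wt n wx) eqxx.
Qed.

Lemma weight_functional0 n x : wt n x -> x != 0 ->
  exists phi : stalk F -> (ratfun R)^o, [/\ linear phi,
    forall y, wcomp y n = 0 -> phi y = 0 & phi x != 0].
Proof.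
move=> wx x0; apply: (weight_functional (P := fun z => z = 0)) => //.
  by move=> a y z -> ->; rewrite scaler0 addr0.
exact/eqP.
Qed.

Variables (k : closedFieldType) (emb : {rmorphism ratfun R -> k}).
Hypothesis irr : generically_irreducible emb F.
Variable cas : ratfun R.
Hypothesis casE : casimir_acts_by F cas.

(* From C = H^2 + 2H + 4YX. *)
Definition YX_coef (c : ratfun R) n : ratfun R :=
  (c - n%:~R * n%:~R - 2%:R * n%:~R) / 4%:R.

Lemma YX_wt n x : wt n x -> Yop (Xop x) = YX_coef cas n *: x.
Proof.
move=> wx; apply: (@casimir_algebra _ _ _ _ (Hop x) (Hop (Hop x)) (Xop (Yop x))).
- rewrite -[4%:R]/(4%:~R) -(ct_int R 4) tofrac_eq0 polyC_eq0.
  by have := eqr_nat R[i] 4 0 => /= ->.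
- exact: wt_H.
- by rewrite {1}(wt_H wx) linearZ.
- exact: XY_comm.
- exact: casimir_stalk.
Qed.

Lemma XY_wt n x : wt n x -> exists q, Xop (Yop x) = q *: x.
Proof.
move=> wx; exists (n%:~R + YX_coef cas n).
by rewrite scalerDl -(wt_H wx) -(YX_wt wx) -XY_comm subrK.
Qed.

(** The string through [e], placed at weight n + 2j when [e] has weight n. As [Negz i] is -(i + 1),
    the negative side starts with one application of Y. *)
Let u (e : stalk F) (j : int) :=
  match j with Posz i => iter i (@Xop R F) e | Negz i => iter i.+1 (@Yop R F) e end.

Let u_wt n e j : wt n e -> wt (n + j * 2) (u e j).
Proof.
move=> we; case: j => i.
  elim: i => [|i IH]; first by rewrite mul0r addr0.
  by rewrite intS mulrDl mul1r addrCA addrC; apply: wt_X.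
rewrite /u; elim: i => [|i IH]; first by rewrite NegzE mulN1r; apply: wt_Y.
suff -> : n + Negz i.+1 * 2 = n + Negz i * 2 - 2 by apply: wt_Y.
by rewrite !NegzE [in LHS]intS opprD mulrDl mulN1r addrA addrAC.
Qed.

Let u_X n e j : wt n e -> exists q, Xop (u e j) = q *: u e (j + 1).
Proof.
move=> we; case: j => i.
  by exists 1; rewrite scale1r -[Posz i + 1]/(Posz (i + 1)) addn1.
have [q qE] : exists q, Xop (Yop (u e (Negz i + 1))) = q *: u e (Negz i + 1).
  exact: XY_wt (u_wt _ we).
exists q; rewrite -qE; congr (Xop _).
by case: i {qE} => [|i] //; rewrite NegzE intS opprD addrAC addNr add0r -NegzE.
Qed.

Let u_Y n e j : wt n e -> exists q, Yop (u e j) = q *: u e (j - 1).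
Proof.
move=> we; case: j => [[|i]|i].
- by exists 1; rewrite scale1r.
- exists (YX_coef cas (n + Posz i * 2)).
  have -> : Posz i.+1 - 1 = Posz i by rewrite -addn1 PoszD addrK.
  by rewrite -(YX_wt (u_wt (Posz i) we)).
- have -> : Negz i - 1 = Negz i.+1 by rewrite !NegzE [in RHS]intS opprD addrC.
  by exists 1; rewrite scale1r.
Qed.

(* S is spanned by the X^i e and Y^i e in the weights n + 2j, and unconstrained
   in the other weights. *)
Lemma rank_one n e y : wt n e -> e != 0 -> wt n y -> exists f, y = f *: e.
Proof.
move=> we e0 wy; apply: contrapT => nf.
pose P z := exists f, z = f *: e.
have P0 : P 0 by exists 0; rewrite scale0r.
have Pl a z t : P z -> P t -> P (a *: z + t).
  by move=> [f ->] [g ->]; exists (a * f + g); rewrite scalerDl scalerA.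
have [phi [phiL phiP phiy]] := weight_functional P0 Pl wy nf.
have [psi [psiL _ psie]] := weight_functional0 we e0.
pose S (z : stalk F) := forall j : int, exists q, wcomp z (n + j * 2) = q *: u e j.
have := stalk_irreducible irr (S := S) (x := e) (phi := phi) (psi := psi).
move=> /(_ _ _ _ _ psiL psie phiL) H; move: phiy; rewrite H ?eqxx //.
- move=> z Sz j; have [q qE] := Sz j; exists ((n + j * 2)%:~R * q).
  by rewrite wcomp_H qE scalerA.
- move=> z Sz j; have [q qE] := Sz (j - 1); have [q' q'E] := u_X (j - 1) we.
  exists (q * q'); rewrite wcomp_X.
  have -> : n + j * 2 - 2 = n + (j - 1) * 2 by rewrite mulrBl mul1r addrA.
  by rewrite qE linearZ /= q'E subrK scalerA.
- move=> z Sz j; have [q qE] := Sz (j + 1); have [q' q'E] := u_Y (j + 1) we.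
  exists (q * q'); rewrite wcomp_Y.
  have -> : n + j * 2 + 2 = n + (j + 1) * 2 by rewrite [(j + 1) * 2]mulrDl mul1r [RHS]addrA.
  by rewrite qE linearZ /= q'E addrK scalerA.
- move=> j; rewrite (wcomp_wt _ we); case: eqP => [E|_].
    have -> : j = 0.
      move/eqP: E; rewrite -subr_eq0 addrAC subrr add0r mulf_eq0 orbF.
      by move/eqP.
    by exists 1; rewrite scale1r.
  by exists 0; rewrite scale0r.
- move=> z Sz; apply: phiP; have [q] := Sz 0; rewrite mul0r addr0 => ->.
  by exists q.
Qed.

(** If X x = 0, the vectors without components in the weights n + 2, n + 4, ... form a submodule: X
    cannot enter weight n + 2, since the weight space n is spanned by [x]. It contains [x] but not
    [y], against irreducibility. *)
Lemma Xop_neq0 n x y :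
  wt n x -> x != 0 -> wt (n + 2) y -> y != 0 -> Xop x != 0.
Proof.
move=> wx x0 wy y0; apply/negP => /eqP Xx.
have [psi [psiL _ psix]] := weight_functional0 wx x0.
have [phi [phiL phiP phiy]] := weight_functional0 wy y0.
pose S (z : stalk F) := forall i : nat, wcomp z (n + 2 + i%:Z * 2) = 0.
have := stalk_irreducible irr (S := S) (x := x) (phi := phi) (psi := psi).
move=> /(_ _ _ _ _ psiL psix phiL) H; move: phiy; rewrite H ?eqxx //.
- by move=> z Sz i; rewrite wcomp_H Sz scaler0.
- move=> z Sz [|i]; rewrite wcomp_X.
    rewrite mul0r addr0 addrK; have [f ->] := rank_one wx x0 (wt_wcomp z n).
    by rewrite linearZ /= Xx scaler0.
  have -> : n + 2 + i.+1%:Z * 2 - 2 = n + 2 + i%:Z * 2.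
    by lia.
  by rewrite Sz linear0.
- move=> z Sz i; rewrite wcomp_Y.
  have -> : n + 2 + i%:Z * 2 + 2 = n + 2 + i.+1%:Z * 2.
    by lia.
  by rewrite Sz linear0.
- move=> i; rewrite (wcomp_wt _ wx); case: eqP => // /eqP.
  by rewrite -addrA -[X in _ == X]addr0 (inj_eq (addrI n)).
- by move=> z /(_ 0%N); rewrite mul0r addr0 => /phiP.
Qed.

(** Mirror image of [Xop_neq0], with the submodule of vectors without components in the weights n, n
    - 2, ... *)
Lemma Yop_neq0 n x y :
  wt n x -> x != 0 -> wt (n + 2) y -> y != 0 -> Yop y != 0.
Proof.
move=> wx x0 wy y0; apply/negP => /eqP Yy.
have [psi [psiL _ psiy]] := weight_functional0 wy y0.
have [phi [phiL phiP phix]] := weight_functional0 wx x0.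
pose S (z : stalk F) := forall i : nat, wcomp z (n - i%:Z * 2) = 0.
have := stalk_irreducible irr (S := S) (x := y) (phi := phi) (psi := psi).
move=> /(_ _ _ _ _ psiL psiy phiL) H; move: phix; rewrite H ?eqxx //.
- by move=> z Sz i; rewrite wcomp_H Sz scaler0.
- move=> z Sz i; rewrite wcomp_X.
  have -> : n - i%:Z * 2 - 2 = n - i.+1%:Z * 2.
    by lia.
  by rewrite Sz linear0.
- move=> z Sz [|i]; rewrite wcomp_Y.
    rewrite mul0r subr0; have [f ->] := rank_one wy y0 (wt_wcomp z (n + 2)).
    by rewrite linearZ /= Yy scaler0.
  have -> : n - i.+1%:Z * 2 + 2 = n - i%:Z * 2.
    by lia.
  by rewrite Sz linear0.
- move=> i; rewrite (wcomp_wt _ wy); case: eqP => // /eqP.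
  by rewrite (inj_eq (addrI n)) => /eqP; case: (i : nat).
- by move=> z /(_ 0%N); rewrite mul0r subr0 => /phiP.
Qed.

End RankOne.

(** * Weight spaces as line bundles *)

Lemma cancel_factor (S : fieldType) (a b c : S) :
  a != 0 -> a * b * (c / a) = b * c.
Proof. by move=> a0; rewrite [a * b]mulrC -mulrA [c / a]mulrC mulVKf. Qed.

Lemma cancel_twist (S : fieldType) (a b c : S) :
  b != 0 -> c != 0 -> a = a * b * (c * b)^-1 * c.
Proof.
by move=> b0 c0; rewrite invfM [c^-1 * _]mulrC mulrA mulfK // mulfVK.
Qed.

Section LineBundle.
Variables (R : realType).
Implicit Types (U V W : zopen R) (p : pt R) (f g : ratfun R) (d : int).

(* f e is a section over U of the line bundle generated by e on the affine line
   and by z^d e at infinity. *)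
Definition twist_regular d U f : Prop :=
  (forall a, U (Some a) -> regular_at f (Some a)) /\
  (U None -> regular_at (f * zvar R ^ (- d)) None).

Lemma common_denominator r (g : 'I_r -> ratfun R) :
  exists2 D : {poly (Cplx R)}, D != 0 &
    forall i, exists n : {poly (Cplx R)}, D%:F * g i = n%:F.
Proof.
have den i : exists nd : {poly (Cplx R)} * {poly (Cplx R)},
    nd.2 != 0 /\ g i = nd.1%:F / nd.2%:F.
  by have [n [d [d0 E]]] := fraction_repr (g i); exists (n, d).
pose nd i := sval (cid (den i)).
have [nd0 ndE] : (forall i, (nd i).2 != 0) /\ forall i, g i = (nd i).1%:F / (nd i).2%:F.
  by split=> i; rewrite /nd; case: cid => ? [].
exists (\prod_i (nd i).2); first by apply/prodf_neq0 => i _.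
move=> i; exists ((\prod_(j | j != i) (nd j).2) * (nd i).1).
rewrite (bigD1 i) //= ndE !tofracM cancel_factor // tofrac_eq0.
exact: nd0.
Qed.

(** Since z^-1 is a uniformizer at infinity, [d] is the largest pole order there among the nonzero
    [g i]. *)
Lemma max_pole r (g : 'I_r -> ratfun R) : (exists i, g i != 0) ->
  exists d, (forall i, regular_at (g i * zvar R ^ (- d)) None) /\
    exists i, unit_at (g i * zvar R ^ (- d)) None.
Proof.
move=> [i0 gi0].
have pole i : exists o : int, g i != 0 -> unit_at (g i * zvar R ^ (- o)) None.
  have [->|gi] := eqVneq (g i) 0; first by exists 0.
  have [o /ord_atP oE] := ord_at_exists None gi.
  by exists (- o) => _; move: oE; rewrite /= exprz_inv.
pose o i := sval (cid (pole i)).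
have oP i : g i != 0 -> unit_at (g i * zvar R ^ (- o i)) None by rewrite /o; case: cid.
case: (@Order.TotalTheory.arg_maxP _ _ _ i0 (fun i => g i != 0) o gi0) => i gi imax.
exists (o i); split; last by exists i; apply: oP.
move=> j; have [->|gj] := eqVneq (g j) 0; first by rewrite mul0r; apply: regular_at0.
have -> : zvar R ^ (- o i) = zvar R ^ (- o j) * zvar R ^ (- (o i - o j)).
  by rewrite -expfzDr ?zvar_neq0 //; congr (_ ^ _); lia.
rewrite mulrA; apply: regular_atM; first exact/unit_regular/oP.
rewrite -exprz_inv; apply: (@uniformizer_exp_regular _ None).
by rewrite subr_ge0; apply: imax.
Qed.

Variable F : gKmodule R.
Hypothesis qa : quasi_admissible F.
Variable n : int.
Hypothesis rank1 : forall e y : stalk F, wt n e -> e != 0 -> wt n y ->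
  exists f, y = f *: e.
Implicit Types (x y e : stalk F).

Local Notation A0 := (avoid [:: (None : pt R)]).
Local Notation A1 := (avoid [:: (Some 0 : pt R)]).

Lemma A0P p : A0 p <-> exists a, p = Some a.
Proof.
rewrite /= inE; case: p => [a|] /=; first by split=> // _; exists a.
by split=> // -[].
Qed.

Lemma zvar_unit a (i : int) : a != 0 -> unit_at (zvar R ^ i) (Some a).
Proof.
by move=> a0; apply: unit_at_exp; exists a => //; apply: value_at_z.
Qed.

Lemma nonzero_section x U : affine U -> wt n x -> x != 0 ->
  exists y, [/\ wt n y, y != 0 & Gam U y].
Proof.
move=> aU wx x0; have [V [hV gx]] := Gam_shrink U x.
have [f [_ fu gfx]] := Gam_qc aU hV gx.
have [p Vp] := zopen_nonempty V; exists (f *: x); split=> //; first exact: wtZ.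
by rewrite scaler_eq0 negb_or x0 (unit_at_neq0 (fu p Vp)).
Qed.

(* Clearing denominators, the sections over the affine line become an ideal of
   the polynomial ring, hence a principal one. *)
Lemma affine_generator x : wt n x -> x != 0 -> exists e,
  [/\ wt n e, e != 0, Gam A0 e & forall f, Gam A0 (f *: e) ->
      exists q : {poly (Cplx R)}, f = q%:F].
Proof.
move=> wx x0.
have [r [e [we eP]]] := weight_generators qa n (affine_avoid None).
have ex i : exists g, e i = g *: x by apply: rank1 => //; case: (we i).
pose g i := sval (cid (ex i)).
have gE i : e i = g i *: x by rewrite /g; case: cid.
have [D D0 DP] := common_denominator g.
have D0' : D%:F != 0 :> ratfun R by rewrite tofrac_eq0.
pose s := (D%:F : ratfun R)^-1 *: x.
have ws : wt n s by apply: wtZ.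
have s0 : s != 0 by rewrite scaler_eq0 invr_eq0 negb_or D0'.
have coefs y : wt n y -> Gam A0 y -> exists q : {poly (Cplx R)}, y = q%:F *: s.
  move=> wy gy; have [c [cr ->]] := eP y wy gy.
  have T i : exists q : {poly (Cplx R)}, c i *: e i = q%:F *: s.
    have [m mE] : exists m : {poly (Cplx R)}, c i = m%:F.
      by apply: regular_poly => a; apply: cr; apply/A0P; exists a.
    have [l lE] := DP i; exists (m * l).
    rewrite gE mE tofracM -lE /s !scalerA; congr (_ *: _).
    by rewrite -[in RHS]mulrA [D%:F * _]mulrC mulfK.
  elim/big_rec: _ => [|i y' _ [q ->]]; first by exists 0; rewrite tofrac0 scale0r.
  by have [q' ->] := T i; exists (q' + q); rewrite tofracD scalerDl.
pose I (q : {poly (Cplx R)}) := `[< Gam A0 (q%:F *: s) >] && (q != 0).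
have [k0 k0P] : exists k, `[< exists q, I q /\ size q = k >].
  have [y [wy y0 gy]] := nonzero_section (affine_avoid None) wx x0.
  have [q qE] := coefs y wy gy; exists (size q); apply/asboolP; exists q; split=> //.
  apply/andP; split; first by apply/asboolP; rewrite -qE.
  by apply: contra_neq y0 => q0; rewrite qE q0 tofrac0 scale0r.
case: (ex_minnP (ex_intro (fun k => `[< exists q, I q /\ size q = k >]) k0 k0P)).
move=> k /asboolP[q [/andP[/asboolP gq q0] sq]] kmin.
have q0' : q%:F != 0 :> ratfun R by rewrite tofrac_eq0.
exists (q%:F *: s); split=> //; first exact: wtZ.
  by rewrite scaler_eq0 negb_or q0'.
move=> f gf; have [t tE] := coefs _ (wtZ f (wtZ _ ws)) gf.
have {tE}ft : f * q%:F = t%:F.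
  by move: tE; rewrite scalerA => /eqP; rewrite -subr_eq0 -scalerBl scaler_eq0
     (negbTE s0) orbF subr_eq0 => /eqP.
have gt : Gam A0 (t%:F *: s) by rewrite -ft -scalerA.
suff tq : t %% q = 0.
  exists (t %/ q); apply: (mulIf q0').
  by rewrite ft -tofracM {1}(divp_eq t q) tq addr0.
apply/eqP; apply: contraT => m0; exfalso.
have : (k <= size (t %% q)%R)%N.
  apply: kmin; apply/asboolP; exists (t %% q); split=> //.
  apply/andP; split=> //; apply/asboolP.
  have -> : t %% q = - (t %/ q) * q + t.
    by apply: (addrI (t %/ q * q)); rewrite -divp_eq mulNr addNKr.
  rewrite tofracD tofracM scalerDl -scalerA; apply: GamD => //.
  by apply: GamZ => // -[a|] // _; apply: regular_at_poly.
by rewrite -sq leqNgt ltn_modp q0.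
Qed.

(** The generators on the chart at infinity are multiples g_i e of the affine generator. The local
    ring at infinity is a valuation ring, so the one with the largest pole order generates there,
    and that order is the twist [d]. *)
Lemma normal_generator x : wt n x -> x != 0 -> exists e d,
  [/\ wt n e, e != 0 & forall U f, Gam U (f *: e) <-> twist_regular d U f].
Proof.
move=> wx x0; have [e [we e0 ge eP]] := affine_generator wx x0.
have [r [e' [we' e'P]]] := weight_generators qa n (affine_avoid (Some 0 : pt R)).
have ex i : exists g, e' i = g *: e by apply: rank1 => //; case: (we' i).
pose g i := sval (cid (ex i)).
have gE i : e' i = g i *: e by rewrite /g; case: cid.
have scal_inj f f' : f *: e = f' *: e -> f = f'.
  move=> /eqP; rewrite -subr_eq0 -scalerBl scaler_eq0 (negbTE e0) orbF.
  by rewrite subr_eq0 => /eqP.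
have lin y : wt n y -> Gam A1 y -> exists c : 'I_r -> ratfun R,
    (forall i, regular_on A1 (c i)) /\ y = (\sum_i c i * g i) *: e.
  move=> wy gy; have [c [cr ->]] := e'P y wy gy; exists c; split=> //.
  by rewrite scaler_suml; apply: eq_bigr => i _; rewrite gE scalerA.
have [d [dr [i iu]]] : exists d, (forall i, regular_at (g i * zvar R ^ (- d)) None) /\
    exists i, unit_at (g i * zvar R ^ (- d)) None.
  apply: max_pole; apply: contrapT => /forallNP g0.
  have [y [wy y0 gy]] := nonzero_section (affine_avoid (Some 0)) wx x0.
  have [c [_ yE]] := lin y wy gy; move: y0; rewrite yE big1 ?scale0r ?eqxx // => j _.
  by have /negP := g0 j; rewrite negbK => /eqP ->; rewrite mulr0.
have zd0 : zvar R ^ (- d) != 0 by rewrite expfz_neq0 ?zvar_neq0.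
exists e, d; split=> // U f; split=> [gf|[f1 f2]].
  split=> [a Ua|U8].
    have [h [hr hu gh]] := Gam_qc (affine_avoid None) (interr (U := U)) (Gam_sub interl gf).
    rewrite scalerA in gh; have [q qE] := eP _ gh.
    have ha : unit_at h (Some a) by apply: hu; split=> //; apply/A0P; exists a.
    have -> : f = h^-1 * q%:F by rewrite -qE mulKf ?(unit_at_neq0 ha).
    by apply: regular_atM; [exact/unit_regular/unit_atV | exact: regular_at_poly].
  have [h [hr hu gh]] := Gam_qc (affine_avoid (Some 0)) (interr (U := U)) (Gam_sub interl gf).
  have [c [cr /esym cE]] := lin _ (wtZ h (wtZ f we)) gh.
  have hN : unit_at h None by apply: hu.
  rewrite scalerA in cE; have {}cE := scal_inj _ _ cE.
  have -> : f * zvar R ^ (- d) = h^-1 * \sum_i c i * (g i * zvar R ^ (- d)).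
    have -> : \sum_i c i * (g i * zvar R ^ (- d)) = (\sum_i c i * g i) * zvar R ^ (- d).
      by rewrite mulr_suml; apply: eq_bigr => j _; apply: mulrA.
    by rewrite cE -[h * f * _]mulrA mulKf ?(unit_at_neq0 hN).
  apply: regular_atM; first exact/unit_regular/unit_atV.
  by apply: regular_at_sum => j _; apply: regular_atM => //; apply: cr.
apply: Gam_glue => -[a|] Up.
  exists (interz U A0); split; first by split=> //; apply/A0P; exists a.
  apply: GamZ; last exact: Gam_sub interr ge.
  by move=> p [Up' /A0P[b pE]]; rewrite pE in Up' *; apply: f1.
(* The coefficient of f e with respect to the local generator [e' i]; it is regular at infinity
   because [g i] has pole order exactly [d]. *)
pose w := f * zvar R ^ (- d) * (g i * zvar R ^ (- d))^-1.
have wN : regular_at w None.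
  by apply: regular_atM; [exact: f2 | exact/unit_regular/unit_atV].
exists (interz (domz w) A1); split=> //.
have -> : f *: e = w *: e' i.
  rewrite gE scalerA; congr (_ *: _).
  have /unit_at_neq0 := iu; rewrite mulf_eq0 negb_or => /andP[gi0 _].
  exact: (cancel_twist f zd0 gi0).
apply: GamZ; first exact: interl.
by apply: Gam_sub interr _; case: (we' i).
Qed.

End LineBundle.

(** * The twist is the degree *)

Section Degree.
Variables (R : realType) (F : gKmodule R) (n d : int) (e : stalk F).
Hypotheses (we : wt n e) (e0 : e != 0).
Hypothesis rank1 : forall y : stalk F, wt n y -> exists f, y = f *: e.
Hypothesis GamE : forall (U : zopen R) f, Gam U (f *: e) <-> twist_regular d U f.
Implicit Types (U V W : zopen R) (p : pt R) (f g : ratfun R) (y : stalk F).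

Local Notation A0 := (avoid [:: (None : pt R)]).
Local Notation A1 := (avoid [:: (Some 0 : pt R)]).

Lemma stalk_scaleI f f' : f *: e = f' *: e -> f = f'.
Proof.
move=> /eqP; rewrite -subr_eq0 -scalerBl scaler_eq0 (negbTE e0) orbF.
by rewrite subr_eq0 => /eqP.
Qed.

Lemma local_generatorP U (m : F U) u : u != 0 -> germ m = u *: e ->
  (forall V f, zsub V U -> twist_regular d V f -> regular_on V (f / u)) ->
  local_generator n m.
Proof.
move=> u0 mE H; split=> [|V h m' wm'].
  by apply/wt_germ; rewrite mE; apply: wtZ.
have [f fE] := rank1 (proj2 (wt_germ n m') wm').
have tf : twist_regular d V f by apply/GamE; rewrite -fE; exists m'.
exists (mkreg (H V f h tf)); split=> [|g m'E].
  by apply: germ_inj; rewrite germZ germ_res fE mE scalerA /= mulfVK.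
apply: regfun_inj => /=; apply: (mulIf u0); rewrite mulfVK //.
by apply: stalk_scaleI; rewrite -scalerA -mE -fE m'E germZ germ_res.
Qed.

Lemma Gam_e : Gam A0 e.
Proof.
rewrite -[e]scale1r; apply/GamE; split=> // a _; exact: regular_at1.
Qed.

Lemma zvar_regular_A1 (i : int) (V : zopen R) a :
  zsub V A1 -> V (Some a) -> unit_at (zvar R ^ i) (Some a).
Proof.
move=> hV Va; apply: zvar_unit; have /= := hV _ Va; rewrite inE.
by apply: contraNneq => ->.
Qed.

Lemma Gam_ze : Gam A1 (zvar R ^ d *: e).
Proof.
apply/GamE; split=> [a Va|_].
  exact: unit_regular (zvar_regular_A1 d (@zsub_refl _ A1) Va).
by rewrite -expfzDr ?zvar_neq0 // subrr expr0z; apply: regular_at1.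
Qed.

(** The section [e] has no zeros on the affine line. At infinity z^d e generates and e = z^(-d) (z^d
    e), so its order there is d. *)
Lemma is_degree_exists : is_degree F n d.
Proof.
have [m mE] := Gam_e; have [m' m'E] := Gam_ze.
pose o (p : pt R) : int := if p is Some _ then 0 else d.
have z0 := zvar_neq0 R.
exists A0, m, o; split.
- by apply/wt_germ; rewrite mE.
- by move=> m0; move: e0; rewrite -mE m0 germ0 eqxx.
- move=> [a|].
    exists A0, m, A0, zsub_refl, zsub_refl, 1; split=> //.
    + apply: (@local_generatorP _ _ 1); rewrite ?oner_neq0 ?mE ?scale1r //.
      move=> V f hV [fV _] p Vp; have /A0P[b pE] := hV p Vp.
      by rewrite divr1 pE in Vp *; apply: fV.
    + by rewrite scale1r.
    + exact/ord_at_unit/unit_at1.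
  have rz : regular_on (interz A0 A1) (zvar R ^ (- d)).
    move=> p [/A0P[a ->] Ap]; apply/unit_regular.
    exact: (zvar_regular_A1 (- d) (@zsub_refl _ A1) Ap).
  exists A1, m', (interz A0 A1), interr, interl, (mkreg rz); split=> //.
  + apply: (local_generatorP _ m'E); first by rewrite expfz_neq0.
    move=> V f hV [f1 f2] [a|] Vp; rewrite invr_expz; last exact: f2.
    apply: regular_atM; first exact: f1.
    exact: unit_regular (zvar_regular_A1 (- d) hV Vp).
  + apply: germ_inj; rewrite germZ !germ_res mE m'E scalerA.
    by rewrite -expfzDr // addNr expr0z scale1r.
  + apply/ord_atP; rewrite /uniformizer exprz_inv opprK -expfzDr // addNr expr0z.
    exact: unit_at1.
- apply: sub_finite_set (finite_set1 (None : pt R)) => -[a|] //=.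
- rewrite -(fsbig_widen [set None]%classic) ?fsbig_set1 //.
  by move=> [a|] // [_ []].
Qed.

(** Any local generator and the standard one ([e], or z^d e at infinity) are regular multiples of
    each other, hence differ by a unit. *)
Lemma local_generator_order U (m : F U) u p : local_generator n m -> U p ->
  germ m = u *: e -> ord_at u p (if p is Some _ then 0 else - d).
Proof.
move=> [wm gen] Up mE; have gm : Gam U (u *: e) by rewrite -mE; exists m.
have [u1 u2] := (GamE U u).1 gm.
case: p Up => [a|] Up.
  have h : zsub (interz U A0) U := interl.
  have [t tE] : Gam (interz U A0) e by apply: Gam_sub interr Gam_e.
  have [g [gE _]] : exists! g : regfun (interz U A0), t = g *: om_res h m.
    by apply: gen; apply/wt_germ; rewrite tE.
  have {gE} gu : rfval g * u = 1.
    apply: stalk_scaleI; rewrite scale1r -scalerA -mE -[RHS]tE gE germZ germ_res //.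
  have gr : regular_at (rfval g) (Some a).
    by apply: regfunP; split=> //; apply/A0P; exists a.
  apply/ord_at_unit; have [v uv] := u1 a Up; exists v => //.
  have [w gw] := gr; apply/eqP => v0; have := value_atM gw uv.
  rewrite gu v0 mulr0 => /(value_at_uniq (value_at1 _))/eqP.
  by rewrite oner_eq0.
have h : zsub (interz U A1) U := interl.
have [t tE] : Gam (interz U A1) (zvar R ^ d *: e) by apply: Gam_sub interr Gam_ze.
have [g [gE _]] : exists! g : regfun (interz U A1), t = g *: om_res h m.
  by apply: gen; apply/wt_germ; rewrite tE; apply: wtZ.
have {gE} gu : rfval g * u = zvar R ^ d.
  by apply: stalk_scaleI; rewrite -scalerA -mE -tE gE germZ germ_res.
have gr : regular_at (rfval g) None by apply: regfunP; split.
apply/ord_atP; rewrite /uniformizer exprz_inv opprK.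
have [v uv] := u2 Up; exists v => //.
have [w gw] := gr; apply/eqP => v0; have := value_atM gw uv.
rewrite mulrA gu -expfzDr ?zvar_neq0 // subrr expr0z v0 mulr0.
by move=> /(value_at_uniq (value_at1 _))/eqP; rewrite oner_eq0.
Qed.

(** Write the given section as f e. Its divisor and the principal divisor of f differ by the
    contribution -d of the generators at infinity, and the principal one has degree 0. *)
Lemma is_degree_uniq d' : is_degree F n d' -> d' = d.
Proof.
move=> [V [s [o [ws s0 so fo ->]]]].
have [f fE] := rank1 (proj2 (wt_germ n s) ws).
have f0 : f != 0.
  apply/eqP => f0; apply: s0; apply: germ_inj.
  by rewrite fE f0 scale0r germ0.
have [o' [fo' fin' sum']] := principal_divisorP f0.
pose dd (p : pt R) : int := if p is Some _ then 0 else - d.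
have o'E p : o' p = o p + dd p.
  have [U [m [W [hU [hV [g [Up gen sE go]]]]]]] := so p.
  have [u uE] := rank1 (proj2 (wt_germ n m) gen.1).
  have ou := local_generator_order gen Up uE.
  apply: (ord_at_uniq (fo' p)).
  suff -> : f = rfval g * u by apply: ord_atM.
  apply: stalk_scaleI; rewrite -scalerA -uE -fE -(germ_res hV) sE.
  by rewrite germZ germ_res.
have find : finite_set [set p | dd p != 0]%classic.
  by apply: sub_finite_set (finite_set1 (None : pt R)) => -[a|] //=.
have [_] := fsum_split fo find.
have -> : \sum_(p \in [set: pt R]%classic) (o p + dd p) = 0.
  by apply: etrans sum'; apply: eq_fsbigr => p _; rewrite o'E.
have -> : \sum_(p \in [set: pt R]%classic) dd p = - d.
  rewrite -(fsbig_widen [set None]%classic) ?fsbig_set1 //.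
  by move=> [a|] // [_ []].
by move=> /esym/eqP; rewrite subr_eq0 => /eqP.
Qed.

Lemma degE : deg F n = d.
Proof.
apply: is_degree_uniq; rewrite /deg.
by have := xgetPex 0 (ex_intro (fun d => is_degree F n d) d is_degree_exists).
Qed.

End Degree.

(** * Frames *)

(** Each parity class of integers is a chain, so the recursion can be run upwards and downwards from
    1 at n = 0 and n = 1 without any consistency condition. *)
Lemma two_step_scaling (S : fieldType) (r : int -> S) : (forall n, r n != 0) ->
  exists l : int -> S, (forall n, l n != 0) /\ forall n, l (n + 2) = r n * l n.
Proof.
move=> r0.
pose up := fix up k := if k is k'.+2 then r k' * up k' else 1.
(* [dn k] is the value at [Negz k], that is at -(k + 1); its first two entries come from the values
   1 at n = 1 and n = 0. *)
pose dn := fix dn k := match k with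
  | 0 => (r (- 1))^-1 | 1 => (r (- 2))^-1
  | k'.+2 => (r (Negz k'.+2))^-1 * dn k' end.
have up0 k : up k != 0.
  suff : up k != 0 /\ up k.+1 != 0 by case.
  by elim: k => [|k [IH1 IH2]]; rewrite /= ?oner_neq0 //; split=> //; rewrite mulf_neq0.
have dn0 k : dn k != 0.
  suff : dn k != 0 /\ dn k.+1 != 0 by case.
  elim: k => [|k [IH1 IH2]]; first by rewrite /= !invr_eq0.
  by split=> //; rewrite /= mulf_neq0 ?invr_eq0.
exists (fun n => match n with Posz k => up k | Negz k => dn k end); split; first by case.
case=> [k|[|[|k]]].
- by rewrite -[Posz k + 2]/(Posz (k + 2)) addn2.
- by rewrite /= mulfV.
- by rewrite /= mulfV.
- have -> : Negz k.+2 + 2 = Negz k by lia.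
  by rewrite /= mulVKf.
Qed.

Section Frames.
Variable R : realType.
Implicit Types (F G : gKmodule R) (U V : zopen R) (n : int) (f : ratfun R).

(* If the degree drops from n to n + 2, then X : F_n(-1) -> F_(n+2) is an
   isomorphism, which is normalized to X e_n = e_(n+2); otherwise it is
   zY e_(n+2) = e_n.  The other coefficient follows from YX e_n = q_n e_n. *)
Definition frame_X (W : int -> Prop) (d : int -> int) (q : int -> ratfun R) n :=
  if `[< W n /\ W (n + 2) >]
  then if d (n + 2) < d n then 1 else zvar R * q n else 0.

Definition frame_Y (W : int -> Prop) (d : int -> int) (q : int -> ratfun R) n :=
  if `[< W n /\ W (n + 2) >]
  then if d (n + 2) < d n then q n else (zvar R)^-1 else 0.

(** The vectors are indexed by all integers and vanish off [W], which lets the equations for X and Y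
    hold without case distinction. *)
Record normal_frame F (W : int -> Prop) (d : int -> int) (a b : int -> ratfun R)
    (e : int -> stalk F) : Prop := NormalFrame {
  nf_wt : forall n, wt n (e n);
  nf_neq0 : forall n, W n <-> e n != 0;
  nf_span : forall n y, wt n y -> exists f, y = f *: e n;
  nf_Gam : forall n U f, W n -> Gam U (f *: e n) <-> twist_regular (d n) U f;
  nf_X : forall n, Xop (e n) = a n *: e (n + 2);
  nf_Y : forall n, Yop (e (n + 2)) = b n *: e n }.

Lemma is_weightP F n : is_weight F n <-> exists x : stalk F, wt n x /\ x != 0.
Proof.
split=> [[U [m [wm m0]]]|[x [wx x0]]].
  exists (germ m); split; first exact/wt_germ.
  by apply/eqP => gm; apply: m0; apply: germ_inj; rewrite gm germ0.
have [U [m xE]] := germ_surj x; exists U, m; split.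
  by apply/wt_germ; rewrite -xE.
by move=> m0; move: x0; rewrite xE m0 germ0 eqxx.
Qed.

Section Isomorphism.
Variables (F G : gKmodule R) (W : int -> Prop) (d : int -> int).
Variables (a b : int -> ratfun R) (e : int -> stalk F) (e' : int -> stalk G).
Hypotheses (nf : normal_frame W d a b e) (nf' : normal_frame W d a b e').

(** The graph of the linear map sending each [e n] to [e' n]. Working with the graph makes the
    inverse a matter of symmetry and avoids carrying chosen coefficients. *)
Definition frame_rel (y : stalk F) (y' : stalk G) : Prop :=
  forall n, exists f, wcomp y n = f *: e n /\ wcomp y' n = f *: e' n.

Lemma frame_rel_uniq y y1 y2 : frame_rel y y1 -> frame_rel y y2 -> y1 = y2.
Proof.
move=> r1 r2; apply: wcomp_ext => n.
have [f1 [E1 ->]] := r1 n; have [f2 [E2 ->]] := r2 n.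
have [Wn|nW] := pselect (W n).
  by rewrite (@stalk_scaleI _ _ (e n) (proj1 (nf_neq0 nf n) Wn) f1 f2) // -E1.
suff -> : e' n = 0 by rewrite !scaler0.
by apply/eqP; apply: contrapT => /negP/(nf_neq0 nf').
Qed.

Lemma frame_rel_ex y : exists y', frame_rel y y'.
Proof.
have ex n : exists f, wcomp y n = f *: e n by apply: (nf_span nf); apply: wt_wcomp.
pose c n := sval (cid (ex n)).
have cE n : wcomp y n = c n *: e n by rewrite /c; case: cid.
have [s [us sc _]] := wcomp_supp y.
pose g n := if n \in s then c n *: e' n else 0.
have dg : is_decomp (\sum_(n <- s) g n) g.
  split=> [n|]; first by rewrite /g; case: ifP => _; [apply/wtZ/(nf_wt nf') | apply: wt0].
  by exists s; split=> // n /negbTE ns; rewrite /g ns.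
exists (\sum_(n <- s) g n) => n; rewrite (wcomp_eq dg) /g.
case: ifPn => ns; first by exists (c n).
by exists 0; rewrite !scale0r sc.
Qed.

(** Being a section can be tested on weight components, and on each of them the condition is the
    same twist in both modules. *)
Lemma frame_rel_Gam U y y' : frame_rel y y' -> Gam U y -> Gam U y'.
Proof.
move=> r gy; have [s [_ _ ->]] := wcomp_supp y'; apply: Gam_sum => n _.
have [f [E ->]] := r n; have [Wn|nW] := pselect (W n).
  by apply/(nf_Gam nf' _ _ Wn)/(nf_Gam nf _ _ Wn); rewrite -E; apply: Gam_wcomp.
suff -> : e' n = 0 by rewrite scaler0; apply: Gam0.
by apply/eqP; apply: contrapT => /negP/(nf_neq0 nf').
Qed.

Lemma frame_rel_lin f y1 y1' y2 y2' : frame_rel y1 y1' -> frame_rel y2 y2' ->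
  frame_rel (f *: y1 + y2) (f *: y1' + y2').
Proof.
move=> r1 r2 n; have [f1 [E1 E1']] := r1 n; have [f2 [E2 E2']] := r2 n.
exists (f * f1 + f2); rewrite !wcomp_linear E1 E1' E2 E2'.
by rewrite !scalerDl !scalerA.
Qed.

Lemma frame_rel0 : frame_rel 0 0.
Proof.
by move=> n; exists 0; rewrite !(wcomp_wt _ (wt0 _ n)) eqxx !scale0r.
Qed.

Lemma frame_relZ f y y' : frame_rel y y' -> frame_rel (f *: y) (f *: y').
Proof. by move=> r; have := frame_rel_lin f r frame_rel0; rewrite !addr0. Qed.

Lemma frame_relD y1 y1' y2 y2' : frame_rel y1 y1' -> frame_rel y2 y2' ->
  frame_rel (y1 + y2) (y1' + y2').
Proof. by move=> r1 r2; have := frame_rel_lin 1 r1 r2; rewrite !scale1r. Qed.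

Lemma frame_rel_H y y' : frame_rel y y' -> frame_rel (Hop y) (Hop y').
Proof.
move=> r n; have [f [E E']] := r n; exists (n%:~R * f).
by rewrite !wcomp_H E E' !scalerA.
Qed.

Lemma frame_rel_X y y' : frame_rel y y' -> frame_rel (Xop y) (Xop y').
Proof.
move=> r n; have [f [E E']] := r (n - 2); exists (f * a (n - 2)).
by rewrite !wcomp_X E E' !linearZ /= (nf_X nf) (nf_X nf') subrK !scalerA.
Qed.

Lemma frame_rel_Y y y' : frame_rel y y' -> frame_rel (Yop y) (Yop y').
Proof.
move=> r n; have [f [E E']] := r (n + 2); exists (f * b n).
by rewrite !wcomp_Y E E' !linearZ /= (nf_Y nf) (nf_Y nf') !scalerA.
Qed.

Lemma wcomp_kop (H : gKmodule R) c (y : stalk H) n : c != 0 ->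
  wcomp (kop c y) n = ct (c ^ n) *: wcomp y n.
Proof.
move=> c0; have [s [us sc yE]] := wcomp_supp y.
rewrite (@wcomp_eq _ _ _ (fun m => ct (c ^ m) *: wcomp y m)) //.
split=> [m|]; first by apply/wtZ/wt_wcomp.
exists s; split=> // [m /sc ->|]; first by rewrite scaler0.
by rewrite {1}yE kop_sum //; apply: eq_bigr => m _; rewrite (wt_wcomp y m).
Qed.

Lemma frame_rel_kop c y y' : c != 0 -> frame_rel y y' ->
  frame_rel (kop c y) (kop c y').
Proof.
move=> c0 r n; have [f [E E']] := r n; exists (ct (c ^ n) * f).
by rewrite !wcomp_kop // E E' !scalerA.
Qed.

Lemma frame_map_ex U (m : F U) : exists m' : G U, frame_rel (germ m) (germ m').
Proof.
have [y' r] := frame_rel_ex (germ m).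
have [m' m'E] : Gam U y' by apply: frame_rel_Gam r _; exists m.
by exists m'; rewrite m'E.
Qed.

Definition frame_map U (m : F U) : G U := sval (cid (frame_map_ex m)).

Lemma frame_mapP U (m : F U) : frame_rel (germ m) (germ (frame_map m)).
Proof. by rewrite /frame_map; case: cid. Qed.

Lemma frame_map_eq U (m : F U) (m' : G U) :
  frame_rel (germ m) (germ m') -> frame_map m = m'.
Proof. by move=> r; apply: germ_inj; apply: frame_rel_uniq (frame_mapP m) r. Qed.

Fact frame_map_linear U : linear (@frame_map U).
Proof.
move=> f m1 m2; apply: frame_map_eq; rewrite !germD !germZ.
by apply: frame_rel_lin; apply: frame_mapP.
Qed.

HB.instance Definition _ U := GRing.isLinear.Build (regfun U) (F U) (G U) _
  (@frame_map U) (@frame_map_linear U).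

End Isomorphism.

Lemma frame_rel_sym F G (e : int -> stalk F) (e' : int -> stalk G) y y' :
  frame_rel e e' y y' -> frame_rel e' e y' y.
Proof. by move=> r n; have [f [E E']] := r n; exists f. Qed.

Theorem isomorphic_frames F G W d a b (e : int -> stalk F) (e' : int -> stalk G) :
  normal_frame W d a b e -> normal_frame W d a b e' -> isomorphic F G.
Proof.
move=> nf nf'; exists (fun U => @frame_map F G W d a b e e' nf nf' U : {linear F U -> G U}).
split=> [U|U V h m|U A m gA|U c m c0].
- exists (@frame_map G F W d a b e' e nf' nf U) => m /=; apply: frame_map_eq;
    exact/frame_rel_sym/frame_mapP.
- by apply: frame_map_eq; rewrite !germ_res; apply: frame_mapP.
- apply: frame_map_eq; rewrite !germ_act //.
  have r := frame_mapP nf nf' m.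
  apply: frame_relD; first by apply/frame_relZ/frame_rel_H.
  by apply: frame_relD; apply: frame_relZ; [apply: (frame_rel_X nf nf') | apply: (frame_rel_Y nf nf')].
- apply: frame_map_eq; rewrite -!kop_germ //.
  by apply: frame_rel_kop => //; apply: frame_mapP.
Qed.

End Frames.

(** * Normal form of a module *)

(** Bookkeeping at infinity: the coefficient of z^-1 X (z^d e) in O(d') is regular there exactly
    when that of X e satisfies the condition of O(d' - d + 1). *)
Lemma twist_shift_up (S : fieldType) (z x : S) (d d' : int) : z != 0 ->
  z^-1 * (z ^ d * x) * z ^ (- d') = x * z ^ (- (d' - d + 1)).
Proof.
move=> z0; rewrite mulrA -[z^-1]exprN1 -expfzDr // mulrAC -expfzDr // mulrC.
by congr (_ * z ^ _); lia.
Qed.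

Lemma twist_shift_down (S : fieldType) (z x : S) (d d' : int) : z != 0 ->
  z ^ d' * x * z ^ (- d) = z * x * z ^ (- (d - d' + 1)).
Proof.
move=> z0; rewrite mulrAC -expfzDr // [RHS]mulrAC -{2}[z]expr1z -expfzDr //.
by congr (z ^ _ * _); lia.
Qed.

Section NormalForm.
Variables (R : realType) (F : gKmodule R).
Variables (k : closedFieldType) (emb : {rmorphism ratfun R -> k}).
Hypotheses (qa : quasi_admissible F) (irr : generically_irreducible emb F).
Hypothesis dist : consecutive_degrees_distinct F.
Variable cas : ratfun R.
Hypothesis casE : casimir_acts_by F cas.
Implicit Types (U V : zopen R) (n : int) (f : ratfun R).

Local Notation z := (zvar R).
Local Notation q := (YX_coef cas).

Lemma generators : exists e : int -> stalk F, [/\ forall n, wt n (e n),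
  forall n, is_weight F n <-> e n != 0,
  forall n y, wt n y -> exists f, y = f *: e n &
  forall n U f, is_weight F n ->
    Gam U (f *: e n) <-> twist_regular (deg F n) U f].
Proof.
have ex n : exists e : stalk F, [/\ wt n e, is_weight F n <-> e != 0,
    forall y, wt n y -> exists f, y = f *: e &
    is_weight F n -> forall U f, Gam U (f *: e) <-> twist_regular (deg F n) U f].
  have [wn|nw] := pselect (is_weight F n); last first.
    exists 0; split=> // [||y wy]; first exact: wt0.
      by rewrite eqxx; split.
    exists 0; rewrite scaler0; apply/eqP; apply: contrapT => /negP y0.
    by apply: nw; apply/is_weightP; exists y.
  have /is_weightP[x [wx x0]] := wn.
  have rk e y := @rank_one R F qa k emb irr cas casE n e y.
  have [e [d [we e0 GamE]]] := normal_generator qa rk wx x0.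
  exists e; split=> // [y wy|_ U f]; first exact: rk.
  by rewrite (degE we e0 (fun y wy => rk e y we e0 wy) GamE).
exists (fun n => sval (cid (ex n))).
by split=> [n|n|n|n U f wn]; case: (cid (ex n)) => e [] //= _ _ _ H; apply: H.
Qed.

(** The coefficients of X e and of zY e' are nonzero global sections of O(d' - d + 1) and O(d - d' +
    1), as seen by testing the generators on both charts. Distinct degrees make one of the twists 0,
    and that coefficient a constant. *)
Lemma adjacent_weights n (e e' : stalk F) :
  wt n e -> e != 0 -> wt (n + 2) e' -> e' != 0 ->
  (forall y, wt n y -> exists f, y = f *: e) ->
  (forall y, wt (n + 2) y -> exists f, y = f *: e') ->
  (forall U f, Gam U (f *: e) <-> twist_regular (deg F n) U f) ->
  (forall U f, Gam U (f *: e') <-> twist_regular (deg F (n + 2)) U f) ->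
  exists r : Cplx R, r != 0 /\
    ((deg F (n + 2) < deg F n /\ Xop e = ct r *: e') \/
     (deg F n < deg F (n + 2) /\ z *: Yop e' = ct r *: e)).
Proof.
move=> we e0 we' e0' span span' GamE GamE'.
have z0 := zvar_neq0 R.
set d := deg F n in GamE *; set d' := deg F (n + 2) in GamE' *.
have ge := Gam_e GamE; have ge' := Gam_e GamE'.
have gz := Gam_ze GamE; have gz' := Gam_ze GamE'.
have A0N : ~ avoid [:: (None : pt R)] None by [].
have A1N : ~ avoid [:: (Some 0 : pt R)] (Some 0) by rewrite /= inE eqxx.
have A0S a : avoid [:: (None : pt R)] (Some a) by [].
have A1S : avoid [:: (Some 0 : pt R)] None by [].
have Xe0 := Xop_neq0 qa irr casE we e0 we' e0'.
have Ye0 := Yop_neq0 qa irr casE we e0 we' e0'.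
have [x xE] := span' _ (wt_X we).
have wYe : wt n (Yop e') by rewrite -[X in wt X](addrK 2); apply: wt_Y.
have [y yE] := span _ wYe.
have x0 : x != 0 by apply: contra_neq Xe0 => x0; rewrite xE x0 scale0r.
have y0 : y != 0 by apply: contra_neq Ye0 => y0; rewrite yE y0 scale0r.
have zy0 : z * y != 0 := mulf_neq0 z0 y0.
have [] := @twisted_global_sections _ x (d' - d + 1) x0.
- have := Gam_X ge A0N; rewrite xE => /GamE'[H _] a; exact: H.
- have := Gam_zX gz A1N; rewrite linearZ /= xE !scalerA => /GamE'[_ /(_ A1S)].
  by rewrite -mulrA twist_shift_up.
move=> m0 xc; have [] := @twisted_global_sections _ (z * y) (d - d' + 1) zy0.
- have := Gam_zY ge' A0N; rewrite yE scalerA => /GamE[H _] a; exact: H.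
- have := Gam_Y gz' A1N; rewrite linearZ /= yE scalerA => /GamE[_ /(_ A1S)].
  by rewrite twist_shift_down.
move=> m0' yc.
have dd : d <> d'.
  by apply: dist; apply/is_weightP; [exists e | exists e'].
case: (ltgtP d d') => [lt|lt|//].
- have [c c0 cE] := yc ltac:(lia); exists c; split=> //; right; split=> //.
  by rewrite yE scalerA cE.
- have [c c0 cE] := xc ltac:(lia); exists c; split=> //; left; split=> //.
  by rewrite xE cE.
Qed.

Lemma twist_regular_const d U f (c : Cplx R) : c != 0 ->
  twist_regular d U (f * ct c) <-> twist_regular d U f.
Proof.
have half g a : a != 0 -> twist_regular d U g -> twist_regular d U (g * ct a).
  move=> a0 [g1 g2]; split=> [b Ub|UN].
    by apply: regular_atM; [exact: g1 | exact: regular_at_const].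
  by rewrite mulrAC; apply: regular_atM; [exact: g2 | exact: regular_at_const].
move=> c0; split=> [H|]; last exact: half.
have cc : ct c * ct c^-1 = 1 by rewrite -ctM mulfV // ct1.
by rewrite -[f]mulr1 -cc mulrA; apply: half; rewrite ?invr_eq0.
Qed.

Theorem normal_frame_exists (W : int -> Prop) (d : int -> int) :
  (forall n, W n <-> is_weight F n) -> (forall n, W n -> deg F n = d n) ->
  exists e : int -> stalk F,
    normal_frame W d (frame_X W d q) (frame_Y W d q) e.
Proof.
move=> WE dE; have [e [we e0 span GamE]] := generators.
have ex n : exists r : Cplx R, r != 0 /\ (W n -> W (n + 2) ->
    (d (n + 2) < d n /\ Xop (e n) = ct r *: e (n + 2)) \/
    (d n < d (n + 2) /\ z *: Yop (e (n + 2)) = ct r *: e n)).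
  have [[Wn Wn2]|nW] := pselect (W n /\ W (n + 2)); last first.
    (* A placeholder: the scaling requires a nonzero factor for every n, also where no two weights
       are adjacent. *)
    by exists 1; split; [exact: oner_neq0 | move=> Wn Wn2; case: nW].
  have wn := (WE n).1 Wn; have wn2 := (WE (n + 2)).1 Wn2.
  have [r [r0 rP]] := adjacent_weights (we n) ((e0 n).1 wn) (we (n + 2))
    ((e0 (n + 2)).1 wn2) (span n) (span (n + 2)) (fun U f => GamE n U f wn)
    (fun U f => GamE (n + 2) U f wn2).
  by exists r; split=> // _ _; rewrite -!dE.
pose r n := sval (cid (ex n)).
have r0 n : r n != 0 by rewrite /r; case: cid => c [].
have rP n : W n -> W (n + 2) ->
    (d (n + 2) < d n /\ Xop (e n) = ct (r n) *: e (n + 2)) \/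
    (d n < d (n + 2) /\ z *: Yop (e (n + 2)) = ct (r n) *: e n).
  by rewrite /r; case: cid => c [].
have z0 := zvar_neq0 R.
(* With e1_n = l_n e_n, the equation X e1_n = e1_(n+2) asks for l_(n+2) = r_n l_n, and zY e1_(n+2) =
   e1_n asks for the inverse factor. *)
have [l [l0 lE]] := @two_step_scaling _
  (fun n => if d (n + 2) < d n then r n else (r n)^-1)
  (fun n => if d (n + 2) < d n as b return (if b then r n else (r n)^-1) != 0
            then r0 n else eq_ind_r (fun t => ~~ t) (r0 n) (invr_eq0 (r n))).
have ct0 c : c != 0 -> ct c != 0 :> ratfun R.
  by move=> c0; rewrite tofrac_eq0 polyC_eq0.
pose e1 n := ct (l n) *: e n.
have we1 n : wt n (e1 n) by apply: wtZ.
have e10 n : W n <-> e1 n != 0.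
  by rewrite WE e0 /e1 scaler_eq0 negb_or ct0.
have span1 n y : wt n y -> exists f, y = f *: e1 n.
  move=> wy; have [f ->] := span n y wy; exists (f * (ct (l n))^-1).
  by rewrite scalerA mulfVK ?ct0.
have e1Z n : ~ W n -> e1 n = 0.
  by move=> nW; apply/eqP; apply: contrapT => /negP/(e10 n).
have wtZ0 n (y : stalk F) : ~ W n -> wt n y -> y = 0.
  by move=> nW wy; have [f ->] := span1 n y wy; rewrite e1Z // scaler0.
have XY n : W n -> W (n + 2) ->
    Xop (e1 n) = (if d (n + 2) < d n then 1 else z * q n) *: e1 (n + 2) /\
    Yop (e1 (n + 2)) = (if d (n + 2) < d n then q n else z^-1) *: e1 n.
  move=> Wn Wn2; have lEn := lE n.
  have [[lt XE]|[lt YE]] := rP n Wn Wn2.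
    rewrite lt in lEn *.
    have X1 : Xop (e1 n) = e1 (n + 2).
      by rewrite linearZ /= XE scalerA /e1 lEn -ctM [l n * _]mulrC.
    by rewrite scale1r -X1; split=> //; apply: YX_wt casE _ _ (we1 n).
  rewrite ltNge (ltW lt) /= in lEn *.
  have Y1 : Yop (e1 (n + 2)) = z^-1 *: e1 n.
    apply: (scalerI z0); rewrite [RHS]scalerA mulfV // scale1r.
    rewrite linearZ /= scalerA mulrC -scalerA YE scalerA -ctM lEn.
    by rewrite mulrAC mulVf // mul1r.
  split=> //; have [f fE] := span1 _ _ (wt_X (we1 n)).
  (* If X e1_n = f e1_(n+2), then YX e1_n = f z^-1 e1_n must equal q_n e1_n, which gives f = z
     q_n. *)
  have := YX_wt casE (we1 n); rewrite fE linearZ /= Y1 scalerA => qE.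
  congr (_ *: _); have {}qE := stalk_scaleI ((e10 n).1 Wn) qE.
  by rewrite -qE mulrCA mulfV // mulr1.
exists e1; split=> // [n U f Wn|n|n].
- rewrite /e1 scalerA; have wn := (WE n).1 Wn.
  by rewrite (GamE n U _ wn) (dE n Wn); apply: twist_regular_const.
- rewrite /frame_X; case: asboolP => [[Wn Wn2]|nW]; first by case: (XY n Wn Wn2).
  rewrite scale0r; have [Wn|nWn] := pselect (W n); last by rewrite e1Z ?linear0.
  by apply: (@wtZ0 (n + 2)); [move=> Wn2; apply: nW | exact: wt_X].
- rewrite /frame_Y; case: asboolP => [[Wn Wn2]|nW]; first by case: (XY n Wn Wn2).
  rewrite scale0r; have [Wn|nWn] := pselect (W (n + 2)); last by rewrite e1Z ?linear0.
  apply: (@wtZ0 n); first by move=> Wn2; apply: nW.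
  by rewrite -[X in wt X](addrK 2); apply: wt_Y.
Qed.

End NormalForm.

Theorem mainTheorem2 (R : realType)
  (k : closedFieldType) (emb : {rmorphism ratfun R -> k})
  (hk : algebraic_closure emb)
  (F G : gKmodule R)
  (qaF : quasi_admissible F) (qaG : quasi_admissible G)
  (irrF : generically_irreducible emb F) (irrG : generically_irreducible emb G)
  (degF : consecutive_degrees_distinct F)
  (degG : consecutive_degrees_distinct G)
  (same_weights : forall n : int, is_weight F n <-> is_weight G n)
  (same_degrees : forall n : int, is_weight F n -> deg F n = deg G n)
  (same_casimir : exists c : ratfun R,
     casimir_acts_by F c /\ casimir_acts_by G c) :
  isomorphic F G.
Proof.
have [c [cF cG]] := same_casimir.
have [e nf] := normal_frame_exists qaF irrF degF cF (W := is_weight F)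
  (d := deg F) (fun n => conj id id) (fun n _ => erefl).
(* The frame of [G] is indexed by the weights and degrees of [F], so that both modules have
   literally the same normal form. *)
have [e' nf'] := normal_frame_exists qaG irrG degG cG same_weights
  (fun n wn => esym (same_degrees n wn)).
exact: isomorphic_frames nf nf'.
Qed.
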